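(* Let $k$ be a positive integer, $n=k(k+1)/2$, and let $\rho_k=(k,k-1,\ldots,2,1)$. (1) Assume $0\le j\le n/2$ and $j$ is not one of the exceptional values for $k$. Then all constituents of $\chi_{\mathrm{hook}}\cdot[n-j,j]$ are constituents of $[\rho_k]^2$. (2) All characters $[n-j,j]$, $0\le j\le n/2$, are constituents of $[\rho_k]^2$.
   Context: For a partition $\mu$ of $n$, $[\mu]$ denotes the irreducible complex character of $S_n$ labelled by $\mu$ (with $[n-0,0]=[n]$ the trivial character); products are pointwise products of characters. $\chi_{\mathrm{hook}}=\sum_{j=0}^{n-1}[n-j,1^j]$ is the sum of all hook characters of $S_n$. For integers $k\ge1$, $m\ge0$, let $d_k(m)$ be the number of partitions of $m$ into pairwise distinct positive parts, all at most $k$. An integer $j$ with $0\le j\le n/2$ is called an exceptional value for $k$ if $j\ge 1$ and $d_k(j-1)=d_k(j)$. Explicitly, with $1\le j\le n/2$, the exceptional values are: $j=1$ (for $k\ge2$); $j=2$ (for $k\ge 3$); $j=4$ (for $k\ge 4$); and additionally for $k=4$: $j=5$; $k=5$: $j=6,7$; $k=6$: $j=7,8,10$; $k=7$: $j=8,11,13,14$; $k=8$: $j=16,17$; $k=9$: $j=19,22$; $k=10$: $j=26$; $k=11$: $j=32$. *)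

(* Defs.v *)
From HB Require Import structures.
From mathcomp Require Import all_boot all_order all_algebra.
From mathcomp Require Import all_fingroup all_solvable all_field all_character.

Set Implicit Arguments.
Unset Strict Implicit.
Unset Printing Implicit Defensive.

Import Order.TTheory GRing.Theory Num.Theory GroupScope.
Local Open Scope ring_scope.

(* Partitions are non-increasing sequences of positive integers. *)
Definition is_partition (n : nat) (mu : seq nat) : bool :=
  [&& sorted geq mu, 0%N \notin mu & sumn mu == n].

Definition conj_part (mu : seq nat) : seq nat :=
  [seq count (fun m => j < m)%N mu | j <- iota 0 (head 0%N mu)].

Definition Symn (n : nat) : {group 'S_n} := [set: 'S_n]%G.

Section FiberStabilizer.
Variables (n : nat) (f : 'I_n -> nat).

Definition fiber_stab : {set 'S_n} := [set s : 'S_n | [forall i, f (s i) == f i]].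

Lemma fiber_stabP (s : 'S_n) : reflect (forall i, f (s i) = f i) (s \in fiber_stab).
Proof. by rewrite inE; apply: (iffP forallP) => H i; apply/eqP. Qed.

Lemma fiber_stab_group_set : group_set fiber_stab.
Proof.
apply/group_setP; split=> [|s t /fiber_stabP fs /fiber_stabP ft].
  by apply/fiber_stabP=> i; rewrite perm1.
by apply/fiber_stabP=> i; rewrite permM ft fs.
Qed.

Canonical fiber_stab_group : {group 'S_n} := Group fiber_stab_group_set.
End FiberStabilizer.

(* The Young subgroup S_mu of S_n, for sumn mu = n: reshape_index mu i is the
   index of the block containing i when 0, ..., n-1 is cut into consecutive
   blocks of sizes mu_1, mu_2, ... *)
Definition young_subgroup (n : nat) (mu : seq nat) : {group 'S_n} :=
  fiber_stab_group (fun i : 'I_n => reshape_index mu i).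

Definition sign_mx (n : nat) (s : 'S_n) : 'M[algC]_1 := ((-1) ^+ s)%:M.

Lemma sign_mx_repr (n : nat) : mx_repr (Symn n) (@sign_mx n).
Proof.
split=> [|s t _ _]; first by rewrite /sign_mx odd_perm1.
by rewrite /sign_mx odd_permM signr_addb scalar_mxM.
Qed.

Definition cf_sign (n : nat) : 'CF(Symn n) :=
  cfRepr (MxRepresentation (@sign_mx_repr n)).

Definition ind_triv (n : nat) (mu : seq nat) : 'CF(Symn n) :=
  'Ind[Symn n, young_subgroup n mu] 1.

Definition ind_sign (n : nat) (mu : seq nat) : 'CF(Symn n) :=
  'Ind[Symn n] ('Res[young_subgroup n mu] (cf_sign n)).

(* As in James and Kerber, [mu] is the unique common irreducible constituent
   of the characters induced from 1 on S_mu and from sgn on S_mu', where mu' is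
   the conjugate of mu; existence and uniqueness are part_indexP below.  The
   value when mu is not a partition of n is irrelevant.  As the characters of
   a finite group take algebraic values, algC stands for the complex numbers. *)
Definition part_index (n : nat) (mu : seq nat) : Iirr (Symn n) :=
  odflt 0 [pick i in irr_constt (ind_triv n mu)
             | i \in irr_constt (ind_sign n (conj_part mu))].

Definition part_char (n : nat) (mu : seq nat) : 'CF(Symn n) :=
  'chi_(part_index n mu).

Definition two_row (n j : nat) : seq nat :=
  if j == 0%N then [:: n] else [:: (n - j)%N; j].

Definition hook (n j : nat) : seq nat := (n - j)%N :: nseq j 1%N.

Definition chi_hook (n : nat) : 'CF(Symn n) :=
  \sum_(j < n) part_char n (hook n j).

Definition staircase (k : nat) : seq nat := rev (iota 1 k).

(* A partition into distinct parts at most k is the set of its parts, a subset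
   of {1, ..., k}; here i : 'I_k stands for the part i + 1. *)
Definition num_distinct_parts (k m : nat) : nat :=
  #|[set A : {set 'I_k} | (\sum_(i in A) i.+1 == m)%N]|.

Definition exceptional (k j : nat) : bool :=
  (0 < j)%N && (num_distinct_parts k j.-1 == num_distinct_parts k j).

Lemma cf_signE (n : nat) (s : 'S_n) : cf_sign n s = (-1) ^+ s.
Proof. by rewrite cfunE inE mulr1n /= mxtrace_scalar. Qed.

Lemma cf_sign_char (n : nat) : cf_sign n \is a character.
Proof. exact: cfRepr_char. Qed.

Lemma perm_eq_perm (T : eqType) (n : nat) (u v : 'I_n -> T) :
  perm_eq [seq u i | i <- enum 'I_n] [seq v i | i <- enum 'I_n] ->
  exists p : 'S_n, forall i, u i = v (p i).
Proof.
have tupE (w : 'I_n -> T) : [seq w i | i <- enum 'I_n] = [tuple w i | i < n] by [].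
rewrite !tupE => /tuple_permP[p /val_inj e]; exists p => i.
by have := congr1 (fun t : n.-tuple T => tnth t i) e; rewrite !tnth_mktuple.
Qed.

Section CommonConstituent.
Variables (n : nat) (f h : 'I_n -> nat).

Definition transverse (y : 'S_n) := injectiveb (fun i => (f (y i), h i)).

Lemma sum_sign_transverse (y : 'S_n) :
  \sum_(s in fiber_stab h | (s ^ y)%g \in fiber_stab f) ((-1) ^+ s : algC)
  = (transverse y)%:R.
Proof.
have memJ (s : 'S_n) : reflect (forall i, f (y (s i)) = f (y i))
    ((s ^ y)%g \in fiber_stab f).
  apply: (iffP (fiber_stabP _ _)) => H i; last first.
    by rewrite /conjg !permM H permKV.
  by rewrite -[in RHS](H (y i)) /conjg !permM permK.
case: (boolP (transverse y)) => [/injectiveP inj | /injectivePn[i [j nij [ef eh]]]].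
  rewrite (big_pred1 1%g) ?odd_perm1 // => s; apply/andP/eqP=> [[/fiber_stabP hs /memJ fs]|->].
    by apply/permP=> i; rewrite perm1; apply: inj; rewrite hs fs.
  by rewrite conj1g !group1.
set S := \sum_(s in _ | _) _.
have tt' : tperm i j \in fiber_stab h.
  by apply/fiber_stabP=> x; case: tpermP => // ->.
have tf : (tperm i j ^ y)%g \in fiber_stab f.
  by apply/memJ=> x; case: tpermP => // ->.
suff: S = - S by move/eqP; rewrite -addr_eq0 -mulr2n mulrn_eq0 /= => /eqP.
rewrite {1}/S (reindex_inj (mulgI (tperm i j))) -sumrN /=.
apply: eq_big => [s|s _]; last by rewrite odd_permM odd_tperm nij signr_addb mulN1r.
by rewrite groupMl // conjMg groupMl.
Qed.

Lemma cfdot_ind_triv_sign :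
  '['Ind[Symn n, fiber_stab_group f] 1,
    'Ind[Symn n] ('Res[fiber_stab_group h] (cf_sign n))]
  = (#|fiber_stab f| * #|fiber_stab h|)%:R^-1 * #|transverse|%:R.
Proof.
have -> : #|transverse|%:R = \sum_y ((transverse y)%:R : algC).
  rewrite -sum1_card natr_sum big_mkcond; apply: eq_bigr => y _.
  by rewrite unfold_in /transverse; case: injectiveb.
rewrite (eq_bigr _ (fun y _ => esym (sum_sign_transverse y))).
rewrite -cfdot_Res_l cfdotE mulnC natrM invfM -mulrA; congr (_ * _).
rewrite (exchange_big_dep (mem (fiber_stab h))) /= => [|x s _ /andP[-> _] //].
rewrite mulr_sumr; apply: eq_bigr => s hs.
rewrite !cfResE ?subsetT // cf_signE rmorph_sign cfIndE ?subsetT // -mulrA.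
congr (_ * _); rewrite mulr_suml [RHS]big_mkcond /=.
apply: eq_big => [y|y _]; first by rewrite !inE.
by rewrite cfun1E hs; case: (_ \in _); rewrite ?mul1r ?mul0r.
Qed.

Lemma card_transverse (y0 : 'S_n) : transverse y0 ->
  (forall y, transverse y -> perm_eq [seq (f (y i), h i) | i <- enum 'I_n]
                                     [seq (f (y0 i), h i) | i <- enum 'I_n]) ->
  #|transverse| = (#|fiber_stab f| * #|fiber_stab h|)%N.
Proof.
move=> /injectiveP inj0 codom_eq.
pose g (u : 'S_n * 'S_n) := (u.2 * y0 * u.1)%g.
have <- : #|[set g u | u in setX (fiber_stab f) (fiber_stab h)]|
          = (#|fiber_stab f| * #|fiber_stab h|)%N.
  rewrite card_in_imset ?cardsX // => -[x k] [x' k'] /setXP[/= hx hk] /setXP[/= hx' hk'].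
  rewrite /g /= => e; suff ek : k = k'.
    by move: e; rewrite ek => /mulgI ->.
  apply/permP=> i; apply: inj0.
  move/fiber_stabP: hx => hx; move/fiber_stabP: hx' => hx'.
  move/fiber_stabP: hk => hk; move/fiber_stabP: hk' => hk'.
  rewrite hk hk'; congr (_, _).
  by have := congr1 (fun p : 'S_n => f (p i)) e; rewrite /= !permM hx hx'.
apply: eq_card => y; apply/idP/imsetP => [ty|[[x k] /setXP[/= /fiber_stabP hx /fiber_stabP hk] ->]].
  have [k ek] := perm_eq_perm (codom_eq y ty).
  pose x := ((k * y0)^-1 * y)%g.
  have key i : f (y i) = f (y0 (k i)) /\ h i = h (k i) by case: (ek i).
  exists (x, k); last by rewrite /g /= /x mulgA mulgV mul1g.
  apply/setXP; split=> /=; apply/fiber_stabP => i; last by case: (key i).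
  rewrite /x permM; case: (key ((k * y0)^-1%g i)) => -> _.
  by rewrite -(permM k y0) permKV.
apply/injectiveP=> i j; rewrite /g /= !permM !hx => -[e1 e2].
by apply: (@perm_inj _ k); apply: inj0; rewrite e1 !hk e2.
Qed.

End CommonConstituent.

Section Shape.
Variables (n : nat) (mu : seq nat).
Hypothesis sum_mu : sumn mu = n.

Lemma card_reshape_index r :
  #|[set i : 'I_n | reshape_index mu i == r]| = nth 0%N mu r.
Proof.
have lt_n (c : 'I_(nth 0%N mu r)) : (flatten_index mu r c < n)%N.
  by rewrite -sum_mu flatten_indexP.
pose g c := Ordinal (lt_n c).
rewrite -[RHS]card_ord -cardsT -(card_imset _ (f := g)); last first.
  move=> c c' /(congr1 (fun i : 'I_n => reshape_offset mu i)) /=.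
  by rewrite !flatten_indexKr // => /val_inj.
apply: eq_card => i; rewrite inE; apply/eqP/imsetP => [e|[c _ ->]]; last first.
  by rewrite /= flatten_indexKl.
have lt_c : (reshape_offset mu i < nth 0%N mu r)%N.
  by rewrite -e reshape_offsetP // sum_mu.
exists (Ordinal lt_c) => //; apply: val_inj => /=.
by rewrite -[LHS](reshape_indexK mu) e.
Qed.

Lemma card_reshape_offset c :
  #|[set i : 'I_n | reshape_offset mu i == c]| = count (fun m => c < m)%N mu.
Proof.
have -> : count (fun m => c < m)%N mu
          = #|[set r : 'I_(size mu) | (c < nth 0%N mu r)%N]|.
  rewrite -sum1_count (big_nth 0%N) big_mkord -sum1_card.
  by apply: eq_bigl => r; rewrite inE.
set A := [set r : 'I_(size mu) | _].
have lt_n (r : 'I_(size mu)) : r \in A -> (flatten_index mu r c < n)%N.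
  by rewrite inE -sum_mu => /flatten_indexP.
have [n0|n_gt0] := posnP n.
  have A0 : A = set0.
    by apply/setP=> r; rewrite [RHS]inE; apply/negP=> /lt_n; rewrite n0.
  rewrite A0 cards0; apply/eqP; rewrite cards_eq0; apply/eqP/setP=> i.
  by have: (i < 0)%N by rewrite -[X in (_ < X)%N]n0.
pose g (r : 'I_(size mu)) := insubd (Ordinal n_gt0) (flatten_index mu r c).
have g_val r : r \in A -> g r = flatten_index mu r c :> nat.
  by move=> /lt_n lt; rewrite /g val_insubd lt.
rewrite -(card_in_imset (f := g)); last first.
  move=> r r' hr hr' /(congr1 (fun i : 'I_n => reshape_index mu i)) /=.
  rewrite !g_val //; move: hr hr'; rewrite !inE => hr hr'.
  by rewrite !flatten_indexKl // => /val_inj.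
apply: eq_card => i; rewrite inE; apply/eqP/imsetP => [e|[r hr ->]]; last first.
  by rewrite g_val // flatten_indexKr //; move: hr; rewrite inE.
have lt_i : (i < sumn mu)%N by rewrite sum_mu.
have hr : Ordinal (reshape_indexP lt_i) \in A by rewrite inE /= -e reshape_offsetP.
exists (Ordinal (reshape_indexP lt_i)) => //.
by apply: val_inj; rewrite [RHS]g_val //= -[LHS](reshape_indexK mu) e.
Qed.

End Shape.

Lemma sum_count_gt (mu : seq nat) (t : nat) :
  (\sum_(c < t) count (fun m => c < m)%N mu = \sum_(m <- mu) minn m t)%N.
Proof.
have cnt c : count (fun m => c < m)%N mu = (\sum_(m <- mu) (c < m))%N.
  by rewrite -sum1_count big_mkcond; apply: eq_bigr => m _; case: (_ < _)%N.
under [LHS]eq_bigr do rewrite cnt.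
rewrite exchange_big; apply: eq_bigr => m _ /=.
elim: t => [|t IH]; first by rewrite big_ord0 minn0.
rewrite big_ord_recr /= IH; case: ltnP => lt; last first.
  by rewrite addn0 !(minn_idPl _) ?(leqW lt).
by rewrite addn1 !(minn_idPr _) // ltnW.
Qed.

Section Partition.
Variables (n : nat) (mu : seq nat).
Hypothesis part_mu : is_partition n mu.

Let sum_mu : sumn mu = n. Proof. by case/and3P: part_mu => _ _ /eqP. Qed.

Lemma head_max m : m \in mu -> (m <= head 0%N mu)%N.
Proof.
case/and3P: part_mu => + _ _; case: mu => //= a s; rewrite path_sortedE; last first.
  by move=> x y z; exact: (fun h1 h2 => leq_trans h2 h1).
by case/andP=> /allP h _; rewrite inE => /predU1P[-> //|/h].
Qed.

Lemma nth_conj_part c : nth 0%N (conj_part mu) c = count (fun m => c < m)%N mu.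
Proof.
have [lt|ge] := ltnP c (head 0%N mu).
  by rewrite (nth_map 0%N) ?size_iota // nth_iota.
rewrite nth_default ?size_map ?size_iota //; apply/esym/eqP.
rewrite -leqn0 leqNgt -has_count; apply/hasPn => m /head_max le.
by rewrite -leqNgt (leq_trans le).
Qed.

Lemma sumn_conj_part : sumn (conj_part mu) = n.
Proof.
rewrite sumnE (big_nth 0%N) size_map size_iota big_mkord.
under [LHS]eq_bigr do rewrite nth_conj_part.
rewrite sum_count_gt -sum_mu sumnE; apply: eq_big_seq => m /head_max le.
exact/minn_idPl.
Qed.

Let f (i : 'I_n) := reshape_index mu i.
Let h (i : 'I_n) := reshape_index (conj_part mu) i.

Lemma transverse_exists : exists y, transverse f h y.
Proof.
have: perm_eq [seq h i | i <- enum 'I_n]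
              [seq reshape_offset mu (i : 'I_n) | i <- enum 'I_n].
  apply/allP => c _ /=; apply/eqP; rewrite !count_map.
  have cnt (P : pred 'I_n) : count P (Finite.enum 'I_n) = #|[set i | P i]|.
    by rewrite cardsE cardE -size_filter.
  rewrite !cnt (card_reshape_index sumn_conj_part) nth_conj_part.
  by rewrite (card_reshape_offset sum_mu).
case/perm_eq_perm => p key; exists p; apply/injectiveP => i j [e1 e2].
apply: (@perm_inj _ p); apply: val_inj.
by rewrite -[LHS](reshape_indexK mu) -[RHS](reshape_indexK mu) -!key -/(f _) -/(f _) e1 e2.
Qed.

Lemma transverse_sub y i : transverse f h y -> (h i < nth 0%N mu (f (y i)))%N.
Proof.
move=> /injectiveP inj.
pose a r t := #|[set j | (f (y j) == r) && (h j < t)%N]|.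
have card_row r : #|[set j | f (y j) == r]| = nth 0%N mu r.
  rewrite -(card_reshape_index sum_mu) -(card_imset _ (@perm_inj _ y)).
  apply: eq_card => j; rewrite inE; apply/imsetP/idP => [[j' + ->]|e].
    by rewrite inE.
  by exists ((y^-1)%g j); rewrite ?inE ?permKV.
have a_le r t : (a r t <= minn (nth 0%N mu r) t)%N.
  rewrite leq_min -card_row; apply/andP; split.
    by apply/subset_leq_card/subsetP => j; rewrite !inE => /andP[].
  case: t => [|t].
    by rewrite leqn0 cards_eq0; apply/eqP/setP=> j; rewrite !inE andbF.
  rewrite -[X in (_ <= X)%N](card_ord t.+1).
  rewrite /a -(card_in_imset (f := fun j => inord (h j) : 'I_t.+1)) ?max_card //.
  move=> j j'; rewrite !inE => /andP[/eqP e lt] /andP[/eqP e' lt'].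
  move/(congr1 val); rewrite /= !inordK // => eh.
  by apply: inj; rewrite e e' eh.
have a_sum t : (\sum_(r < size mu) a r t = \sum_(r < size mu) minn (nth 0%N mu r) t)%N.
  have -> : (\sum_(r < size mu) minn (nth 0%N mu r) t = \sum_(m <- mu) minn m t)%N.
    by rewrite (big_nth 0%N) big_mkord.
  rewrite -sum_count_gt.
  under [RHS]eq_bigr do
    rewrite -nth_conj_part -(card_reshape_index sumn_conj_part) -sum1dep_card.
  under [LHS]eq_bigr do rewrite /a -sum1dep_card.
  have lt_r j : (f (y j) < size mu)%N by rewrite reshape_indexP // sum_mu.
  transitivity (\sum_(j | (h j < t)%N) 1)%N.
    rewrite (partition_big (fun j => Ordinal (lt_r j)) xpredT) //=.
    by apply: eq_bigr => r _; apply: eq_bigl => j; rewrite andbC.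
  case: t => [|t]; first by rewrite big_ord0 big_pred0.
  rewrite (partition_big (fun j => inord (h j) : 'I_t.+1) xpredT) //=.
  apply: eq_bigr => c _; apply: eq_bigl => j; rewrite -/(h j).
  apply/andP/eqP => [[lt /eqP <-]|e]; first by rewrite inordK.
  by rewrite e ltn_ord inord_val.
have a_eq (r : 'I_(size mu)) t : a r t = minn (nth 0%N mu r) t.
  have /eqP := a_sum t.
  have le (r' : 'I_(size mu)) (_ : true) := leqif_eq (a_le r' t).
  by rewrite (leqif_sum le).2 => /forallP/(_ r)/eqP.
rewrite ltnNge; apply/negP => le.
have lt_r : (f (y i) < size mu)%N by rewrite reshape_indexP // sum_mu.
have := a_eq (Ordinal lt_r) (h i); rewrite /= (minn_idPl le) -card_row => e.
have /eqP/setP/(_ i) : [set j | (f (y j) == f (y i)) && (h j < h i)%N]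
                       == [set j | f (y j) == f (y i)].
  rewrite eqEcard -e leqnn andbT.
  by apply/subsetP => j; rewrite !inE => /andP[].
by rewrite !inE eqxx ltnn.
Qed.

Lemma transverse_codom y : transverse f h y ->
  perm_eq [seq (f (y i), h i) | i <- enum 'I_n]
          [seq (f i, reshape_offset mu (i : nat)) | i <- enum 'I_n].
Proof.
move=> ty; have /injectiveP inj := ty.
have uA : uniq [seq (f (y i), h i) | i <- enum 'I_n].
  by rewrite map_inj_uniq ?enum_uniq.
have uD : uniq [seq (f i, reshape_offset mu (i : nat)) | i <- enum 'I_n].
  rewrite map_inj_uniq ?enum_uniq // => i j [e1 e2]; apply: val_inj.
  by rewrite -[LHS](reshape_indexK mu) -[RHS](reshape_indexK mu) -/(f _) -/(f _) e1 e2.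
have sub : {subset [seq (f (y i), h i) | i <- enum 'I_n]
            <= [seq (f i, reshape_offset mu (i : nat)) | i <- enum 'I_n]}.
  move=> _ /mapP[i _ ->]; have lt := transverse_sub i ty.
  have ltn : (flatten_index mu (f (y i)) (h i) < n)%N by rewrite -[X in (_ < X)%N]sum_mu flatten_indexP.
  apply/mapP; exists (Ordinal ltn); first by rewrite mem_enum.
  by rewrite /f /= flatten_indexKl // flatten_indexKr.
apply: uniq_perm => //.
by apply: (uniq_min_size uA sub _).2; rewrite !size_map.
Qed.

Lemma cfdot_ind_part : '[ind_triv n mu, ind_sign n (conj_part mu)] = 1.
Proof.
rewrite cfdot_ind_triv_sign; have [y0 t0] := transverse_exists.
rewrite (card_transverse t0) ?mulVf //.
  by rewrite pnatr_eq0 muln_eq0 negb_or -!lt0n !cardG_gt0.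
move=> y ty; rewrite (perm_trans (transverse_codom ty)) // perm_sym.
exact: transverse_codom.
Qed.

Lemma part_indexP (i : Iirr (Symn n)) :
  (i \in irr_constt (ind_triv n mu)) && (i \in irr_constt (ind_sign n (conj_part mu)))
  = (i == part_index n mu).
Proof.
have Nt : ind_triv n mu \is a character by rewrite cfInd_char ?rpred1.
have Ns : ind_sign n (conj_part mu) \is a character.
  by rewrite cfInd_char ?cfRes_char ?cf_sign_char.
have := cfdot_ind_part; rewrite cfdot_char_r //.
case/natr_sum_eq1 => [j _|j [_ ej nj]].
  by rewrite rpredM ?Cnat_cfdot_char_irr.
have key k : (k \in irr_constt (ind_triv n mu))
             && (k \in irr_constt (ind_sign n (conj_part mu))) = (k == j).
  rewrite !irr_consttE -negb_or -mulf_eq0.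
  have [->|/nj ->] := eqVneq k j; first by rewrite ej oner_eq0.
    by rewrite eqxx.
  by [].
rewrite key /part_index; case: pickP => [k /=|/(_ j)]; last by rewrite /= key eqxx.
by rewrite key => /eqP ->.
Qed.

End Partition.

(* Main.v *)
(* Let N be n or n + 1, so that k + (N - n) is odd, and let G be the group of signed
   products of N anticommuting generators, extended by S_n permuting n of them.  An
   irreducible character W of G with W(-g) = - W(g) vanishes on a permutation s unless
   all cycles of s are odd, and kappa, the character of S_n on the Clifford algebra, is
   the sum over l of the characters H_l induced from sgn x 1 on S_l x S_(n-l).

   The multiplicities of W in the permutation characters of Young subgroups satisfy the
   relations of Schur's q-functions, so they have a leading strict partition mu.  A norm
   estimate, together with the anticommuting operators given by the sums of the generators
   over the parts of mu, determines |W| at the product of a permutation of cycle type mu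
   and of one generator per cycle; comparison with the centralizer shows that the odd part
   of W is supported on that class up to sign.  Choosing W nonzero at the staircase class
   forces mu to be the staircase, which then dominates every partition nu occurring in the
   restriction of W, and its conjugate: the restriction is a multiple of [rho_k].

   Restricting |W|^2 in even degree gives a character Theta of S_n with kappa * Theta
   proportional to [rho_k]^2, and Theta contains every psi not vanishing at the cycle
   type rho_k.  The hook [n-l, 1^l] is a constituent of H_l, and [n-j, j] takes at rho_k
   the value d_k(j) - d_k(j-1), whence (1).  For (2), Theta is supported where H_j
   coincides with the permutation character on j-subsets, and contains 1. *)
From HB Require Import structures.
Require Import Defs.
From mathcomp Require Import all_boot all_order all_algebra.
From mathcomp Require Import all_fingroup all_solvable all_field all_character.
From mathcomp Require Import ring lra zify.
From Stdlib Require Import Classical_Prop.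

Set Implicit Arguments.
Unset Strict Implicit.
Unset Printing Implicit Defensive.

Import Order.TTheory GRing.Theory Num.Theory.
Local Open Scope ring_scope.

(** * Words and Gram forms *)

(** The estimates leave no slack, and this replaces a classification of the characters W. Put b =
    size mu + (N - n). The projector onto the invariants of the Young subgroup of mu commutes with b
    anticommuting operators, so its trace is m 2^[b/2] with m > 0, where [b/2] is rounded down; the
    norm estimate gives 2 (m 2^[b/2])^2 <= 2^b, which forces m = 1 and b odd. With the trace this
    small, |W|^2 = 2^(b-1) prod(mu) at the product g. The centralizer of g has order at most 2^(b+1)
    prod(mu), so the classes of g and -g already carry |G|/2, all that |W|^2 sums to in odd degree.
    For the staircase the choice of N makes b odd; g is then an odd element not conjugate to -g, and
    some W does not vanish there. The large group is needed for Theta: up to a factor it is |W|^2 /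
    kappa where kappa is nonzero, and 0 elsewhere. That this quotient is a character is not visible
    inside S_n. *)

Fixpoint box (z : seq nat) : seq (seq nat) :=
  if z is x :: y then [seq i :: l | i <- iota 0 x.+1, l <- box y] else [:: [::]].

Fixpoint subw (z l : seq nat) : seq nat :=
  match z, l with x :: z', i :: l' => (x - i)%N :: subw z' l' | _, _ => [::] end.

Arguments box : simpl never.

Lemma mem_box_cons x y l : reflect (exists i l', [/\ (i <= x)%N, l' \in box y & l = i :: l'])
  (l \in box (x :: y)).
Proof.
apply: (iffP allpairsPdep) => [[i [l' [h1 h2 ->]]]|[i [l' [h1 h2 ->]]]]; exists i, l'; split=> //.
  by move: h1; rewrite mem_iota.
by rewrite mem_iota.
Qed.

Lemma box_cons (R : nmodType) (x : nat) (y : seq nat) (P : pred (seq nat)) (F : seq nat -> R) :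
  \sum_(l <- box (x :: y) | P l) F l
  = \sum_(i < x.+1) \sum_(l <- box y | P (val i :: l)) F (val i :: l).
Proof.
rewrite big_mkcond -[box _]/[seq i :: l | i <- index_iota 0 x.+1, l <- box y].
rewrite (big_allpairs_dep (op := +%R)) big_mkord.
by apply: eq_bigr => i _; rewrite -big_mkcond.
Qed.

Lemma box_nil (R : nmodType) (P : pred (seq nat)) (F : seq nat -> R) :
  \sum_(l <- box [::] | P l) F l = if P [::] then F [::] else 0.
Proof. by rewrite big_mkcond big_seq1. Qed.

Lemma sumn_subw z l : l \in box z -> (sumn (subw z l) + sumn l = sumn z)%N.
Proof.
elim: z l => [|x z IH] l; first by rewrite inE => /eqP ->.
by case/mem_box_cons=> i [l' [hi hl' ->]]; have := IH _ hl'; move: hi => /=; lia.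
Qed.

Section Form.
Variables (R : comNzRingType) (kap : nat -> R).

Definition kapw (l : seq nat) : R := \prod_(i <- l) kap i.

(** Sum over the nonnegative integer matrices with row sums [nu] and column sums [z] of the product
    of [kap] over the entries. For [kap2] it is the inner product of two products of Schur's
    q-functions, for the constant 1 that of two products of complete symmetric functions. *)
Fixpoint wform (nu z : seq nat) : R :=
  if nu is r :: w then \sum_(l <- box z | sumn l == r) kapw l * wform w (subw z l)
  else (sumn z == 0%N)%:R.

Lemma kapw_cons i l : kapw (i :: l) = kap i * kapw l.
Proof. exact: big_cons. Qed.

(** Matrices can be peeled by columns as well as by rows. Both expansions remove the first row and
    the first column: [p] is the corner entry, [l] the rest of the row, [j] the rest of the
    column. *)
Lemma form_colE nu i z : wform nu (i :: z) =
  \sum_(j <- box nu | sumn j == i) kapw j * wform (subw nu j) z.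
Proof.
elim: nu i z => [|r w IH] i z.
  rewrite box_nil /= /kapw big_nil mul1r addn_eq0 [0%N == i]eq_sym.
  by case: (i == 0%N).
rewrite [LHS]/= !box_cons.
pose T (p : nat) l j : R := if (p + sumn l == r)%N && (p + sumn j == i)%N
  then kap p * (kapw l * (kapw j * wform (subw w j) (subw z l))) else 0.
(* The corner entry is bounded by [i] in one expansion and by [r] in the other; [T] vanishes beyond
   either bound, so both ranges can be enlarged to a common one. *)
have widen m : (m = i \/ m = r) -> \sum_(p < m.+1) \sum_(l <- box z) \sum_(j <- box w) T p l j
    = \sum_(p < (i + r).+1) \sum_(l <- box z) \sum_(j <- box w) T p l j.
  move=> hm; have le : (m.+1 <= (i + r).+1)%N by lia.
  rewrite (big_ord_widen_cond _ xpredT (fun p => \sum_(l <- _) \sum_(j <- _) T p l j) le).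
  rewrite [LHS]big_mkcond; apply: eq_bigr => p _ /=; case: ifP => // hp.
  rewrite big1 // => l _; rewrite big1 // => j _; rewrite /T; case: ifP => // hh; lia.
transitivity (\sum_(p < i.+1) \sum_(l <- box z) \sum_(j <- box w) T p l j).
  apply: eq_bigr => p _; rewrite big_mkcond; apply: eq_bigr => l _ /=; rewrite /T.
  case: ifP => _ /=; last by rewrite big1.
  rewrite IH kapw_cons -mulrA mulr_sumr mulr_sumr big_mkcond; apply: eq_bigr => j _ /=.
  by congr (if _ then _ else _); have := ltn_ord p; lia.
rewrite (widen i (or_introl erefl)) -(widen r (or_intror erefl)).
apply: eq_bigr => p _; rewrite exchange_big [RHS]big_mkcond; apply: eq_bigr => j _ /=; rewrite /T.
case: ifP => h; last by rewrite big1 // => l _; rewrite andbF.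
rewrite kapw_cons -mulrA mulr_sumr mulr_sumr [RHS]big_mkcond; apply: eq_bigr => l _ /=.
have -> : (sumn l == r - p)%N = (p + sumn l == r)%N by have := ltn_ord p; lia.
by rewrite andbT; case: ifP => // _; ring.
Qed.

(** For [kap2] the coefficients are those of (1 - R) / (1 + R), so this is the value at Schur's
    Q-function of [mu] of the linear functional given by [phi] on products of q-functions: each part
    is raised at the expense of the later ones. *)
Fixpoint raise (mu : seq nat) (phi : seq nat -> R) : R :=
  if mu is a :: mu' then
    raise mu' (fun nu => \sum_(j <- box nu)
      (-1) ^+ sumn j * kapw j * phi ((a + sumn j)%N :: subw nu j))
  else phi [::].

Lemma eq_raise mu phi psi :
  (forall nu, sumn nu = sumn mu -> phi nu = psi nu) -> raise mu phi = raise mu psi.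
Proof.
elim: mu phi psi => [|a mu IH] phi psi e /=; first exact: e.
apply: IH => nu h; apply: eq_big_seq => j hj; rewrite e //= -h -(sumn_subw hj); lia.
Qed.

Lemma raise_sum (I : finType) mu (c : I -> R) (phi : I -> seq nat -> R) :
  raise mu (fun nu => \sum_s c s * phi s nu) = \sum_s c s * raise mu (phi s).
Proof.
elim: mu phi => [|a mu IH] phi //=; rewrite -IH; apply: eq_raise => nu _.
under eq_bigr => j _ do rewrite mulr_sumr.
rewrite exchange_big; apply: eq_bigr => s _; rewrite mulr_sumr.
by apply: eq_bigr => j _; ring.
Qed.

Lemma raiseZ mu c phi : raise mu (fun nu => c * phi nu) = c * raise mu phi.
Proof.
have := raise_sum mu (fun _ : 'I_1 => c) (fun _ => phi).
by rewrite big_ord1 => <-; apply: eq_raise => nu _; rewrite big_ord1.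
Qed.

Lemma raiseD mu phi psi : raise mu (fun nu => phi nu + psi nu) = raise mu phi + raise mu psi.
Proof.
have := raise_sum mu (fun _ : bool => 1) (fun b nu => if b then phi nu else psi nu).
by rewrite big_bool !mul1r => <-; apply: eq_raise => nu _; rewrite big_bool !mul1r.
Qed.

Lemma raise_big (T : eqType) mu (r : seq T) (P : pred T) (phi : T -> seq nat -> R) :
  raise mu (fun nu => \sum_(s <- r | P s) phi s nu) = \sum_(s <- r | P s) raise mu (phi s).
Proof.
elim: r => [|x r IH].
  have <- : 0 * raise mu (fun _ => 0) = \sum_(s <- [::] | P s) raise mu (phi s) by rewrite big_nil mul0r.
  by rewrite -raiseZ; apply: eq_raise => nu _; rewrite big_nil mul0r.
rewrite big_cons -IH; case: (boolP (P x)) => hx.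
  by rewrite -raiseD; apply: eq_raise => nu _; rewrite big_cons hx.
by apply: eq_raise => nu _; rewrite big_cons (negPf hx).
Qed.

(** Lexicographic maximality of [mu] in the support of [phi]: words that follow [mu] up to some
    place and have a larger entry there are sent to 0. *)
Fixpoint bounded (mu : seq nat) (phi : seq nat -> R) : Prop :=
  if mu is a :: mu' then (forall c w, (a < c)%N -> phi (c :: w) = 0)
     /\ bounded mu' (fun w => phi (a :: w))
  else True.

Lemma boundedM c mu phi psi :
  (forall w, psi w = c * phi w) -> bounded mu phi -> bounded mu psi.
Proof.
elim: mu phi psi => [|x mu IH] phi psi e // [b1 b2]; split=> [d w lt|].
  by rewrite e b1 ?mulr0.
by apply: IH b2 => w; apply: e.
Qed.

Lemma box0 nu : nseq (size nu) 0%N \in box nu.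
Proof. by elim: nu => //= x nu IH; apply/mem_box_cons; exists 0%N, (nseq (size nu) 0%N). Qed.

Lemma subw0 nu : subw nu (nseq (size nu) 0%N) = nu.
Proof. by elim: nu => //= x nu ->; rewrite subn0. Qed.

Lemma box_sum0 nu l : l \in box nu -> sumn l = 0%N -> l = nseq (size nu) 0%N.
Proof.
elim: nu l => [|x nu IH] l; first by rewrite inE => /eqP ->.
case/mem_box_cons=> i [l' [_ hl' ->]] /= e.
by rewrite -(IH l') //; last lia; congr (_ :: _); lia.
Qed.

Lemma box_uniq nu : uniq (box nu).
Proof.
elim: nu => // x nu IH; apply: allpairs_uniq_dep => [|y _|[i l] [i' l'] _ _ [-> ->] //] //.
exact: iota_uniq.
Qed.

Lemma big_box_sum0 nu (F : seq nat -> R) :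
  \sum_(l <- box nu | sumn l == 0%N) F l = F (nseq (size nu) 0%N).
Proof.
rewrite -big_filter.
have -> : [seq l <- box nu | sumn l == 0%N] = [:: nseq (size nu) 0%N].
  have := filter_uniq (fun l => sumn l == 0%N) (box_uniq nu).
  have h l : (l \in [seq l <- box nu | sumn l == 0%N]) = (l == nseq (size nu) 0%N).
    rewrite mem_filter; apply/andP/eqP=> [[/eqP e hl]|->]; first exact: box_sum0.
    by rewrite box0 sumn_nseq.
  case: (filter _ _) h => [|x [|y r]] h; first by have := h (nseq (size nu) 0%N); rewrite eqxx.
    by have := h x; rewrite inE eqxx => /esym/eqP ->.
  have := h x; have := h y; rewrite !inE !eqxx orbT => /esym/eqP -> /esym/eqP ->.
  by rewrite /= inE eqxx.
by rewrite big_seq1.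
Qed.

Hypothesis kap0 : kap 0 = 1.

Lemma kapw0 m : kapw (nseq m 0%N) = 1.
Proof. by rewrite /kapw big1_seq // => i /andP[_ /nseqP[-> _]]. Qed.

(** A nonzero [j] raises the first part above [a], where [phi] vanishes, so only the unraised word
    contributes. *)
Lemma raise_bounded mu phi : bounded mu phi -> raise mu phi = phi mu.
Proof.
elim: mu phi => [|a mu IH] phi //= [b1 b2]; rewrite -(IH _ b2); apply: eq_raise => nu _.
rewrite (bigID (fun j => sumn j == 0%N)) big_box_sum0 /= [X in _ + X]big1 ?addr0.
  by rewrite kapw0 sumn_nseq subw0 addn0 !mul1r.
by move=> j hj; rewrite b1 ?mulr0 //; lia.
Qed.

(** The amounts [j] taken from the later rows form a new first column, of sum [sumn l - a];
    [form_colE] then folds the sum over [j] back into one form. *)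
Lemma raise_form_cons a mu z :
  raise (a :: mu) (wform^~ z) = \sum_(l <- box z | (a <= sumn l)%N)
    (-1) ^+ (sumn l - a) * kapw l * raise mu (wform^~ ((sumn l - a)%N :: subw z l)).
Proof.
under [RHS]eq_bigr => l _ do rewrite -raiseZ.
rewrite -raise_big /=; apply: eq_raise => nu _.
under [LHS]eq_bigr => j _ do rewrite mulr_sumr big_mkcond.
rewrite exchange_big [RHS]big_mkcond; apply: eq_bigr => l _ /=.
case: ifP => hl; last first.
  by rewrite big1 // => j _; case: ifP => //; lia.
rewrite form_colE mulr_sumr [RHS]big_mkcond; apply: eq_bigr => j _.
have -> : (sumn l == a + sumn j)%N = (sumn j == sumn l - a)%N by lia.
by case: ifP => // /eqP ->; ring.
Qed.

End Form.

Definition kap2 (R : comNzRingType) (m : nat) : R := if m == 0%N then 1 else 2.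

(** The rules obeyed by products of Schur's q-functions: commutativity, q_0 = 1, and the
    coefficients of the identity Q(t) Q(-t) = 1 for their generating function. *)
Record qlike (R : comNzRingType) (X : seq nat -> R) : Prop := QLike {
  qlike_perm : forall u v, perm_eq u v -> X u = X v;
  qlike0 : forall w, X (0%N :: w) = X w;
  qlike_rel : forall m w, (0 < m)%N ->
    \sum_(i < m.+1) (-1) ^+ i * X (val i :: (m - i)%N :: w) = 0 }.

Section RaiseStep.
Variables (R : comNzRingType) (X : seq nat -> R).
Hypothesis qX : qlike X.
Variable a : nat.
Hypothesis a_gt0 : (0 < a)%N.
Hypothesis bX : forall d w, (a <= d)%N -> X (d :: w) = 0.

Let bX2 d i w : (a <= d)%N -> X (i :: d :: w) = 0.
Proof.
move=> h; rewrite (qlike_perm qX (v := d :: i :: w)) ?bX //.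
by apply/seq.permP => P /=; rewrite addnCA.
Qed.

(** In [raise_step], [j] is the first coordinate of [l] and [e] the sum of the others. Up to terms
    killed by [bX] the sum is twice a relation of [qlike], unless that relation has weight 0. *)
Lemma raise_step_sum c e w : (a <= c)%N ->
  \sum_(j < c.+1 | (a <= j + e)%N)
    (-1) ^+ (j + e - a) * kap2 R j * X ((j + e - a)%N :: (c - j)%N :: w)
  = if (c == a) && (e == 0%N) then 2 * X w else 0.
Proof.
move=> le_ac; case: (ltnP e a) => [lt_ea|le_ae].
  (* Here the index starts at [t > 0], so each weight [kap2] is 2 and the shifted sum is the whole
     relation of weight [m]; only [m = 0] survives. *)
  set m := (c + e - a)%N; set t := (a - e)%N.
  rewrite -(big_mkord (fun j => a <= j + e)%N (fun j =>
    (-1) ^+ (j + e - a) * kap2 R j * X ((j + e - a)%N :: (c - j)%N :: w))).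
  rewrite (big_cat_nat (n := t)) //=; last by lia.
  rewrite big1_seq ?add0r; last first.
    by move=> j /andP[h1]; rewrite mem_index_iota; lia.
  rewrite -{1}[t]add0n big_addn; have -> : (c.+1 - t = m.+1)%N by lia.
  rewrite big_mkord.
  transitivity (2 * \sum_(i < m.+1) (-1) ^+ i * X (val i :: (m - i)%N :: w)).
    rewrite mulr_sumr; apply: eq_big => [j|j _]; first by lia.
    have -> : (j + t + e - a)%N = j by lia.
    have -> : (c - (j + t))%N = (m - j)%N by lia.
    by rewrite /kap2 ifF; [ring | lia].
  have [m0|m_gt0] := posnP m.
    rewrite m0 big_ord1 /= subnn (qlike0 qX) (qlike0 qX) mul1r.
    by rewrite ifT //; lia.
  rewrite (qlike_rel qX) // mulr0 ifF //; lia.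
rewrite ifF; last by lia.
(* This sum is the tail of the relation of weight [c + t]: for [i < t] the second entry [c + t - i]
   is at least [a] and the term vanishes. *)
have main : \sum_(j < c.+1) (-1) ^+ (j + e - a) * X ((j + e - a)%N :: (c - j)%N :: w) = 0.
  set t := (e - a)%N; have := qlike_rel qX w (m := c + t) ltac:(lia).
  rewrite -(big_mkord xpredT (fun i => (-1) ^+ i * X (i :: (c + t - i)%N :: w))).
  rewrite (big_cat_nat (n := t)) //=; last by lia.
  rewrite big1_seq ?add0r; last first.
    by move=> j /andP[_]; rewrite mem_index_iota => h; rewrite bX2 ?mulr0 //; lia.
  rewrite -{1}[t]add0n big_addn -addSn addnK big_mkord => {2}<-.
  apply: eq_bigr => j _; have -> : (j + e - a)%N = (j + t)%N by lia.
  by have -> : (c + t - (j + t))%N = (c - j)%N by lia.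
(* The term [j = 0] has weight 1 and not 2, but its second entry is [c], so it vanishes and may be
   counted twice. *)
transitivity (2 * \sum_(j < c.+1) (-1) ^+ (j + e - a) * X ((j + e - a)%N :: (c - j)%N :: w)).
  rewrite mulr_sumr; apply: eq_big => [j|j _]; first by lia.
  rewrite /kap2; case: eqP => [->|_]; last by ring.
  by rewrite subn0 bX2 ?mulr0.
by rewrite main mulr0.
Qed.

Lemma raise_step c y : (a <= c)%N ->
  \sum_(l <- box (c :: y) | (a <= sumn l)%N)
    (-1) ^+ (sumn l - a) * kapw (kap2 R) l * X ((sumn l - a)%N :: subw (c :: y) l)
  = if c == a then 2 * X y else 0.
Proof.
move=> le_ac; rewrite box_cons; under eq_bigr => i _ do rewrite big_mkcond.
rewrite exchange_big /=.
transitivity (\sum_(l <- box y) kapw (kap2 R) l * 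
   (if (c == a) && (sumn l == 0%N) then 2 * X (subw y l) else 0)).
  apply: eq_bigr => l _; rewrite -raise_step_sum // mulr_sumr [RHS]big_mkcond.
  by apply: eq_bigr => i _; case: ifP => // _; rewrite kapw_cons; ring.
case: (c == a) => /=; last by rewrite big1 // => l _; rewrite mulr0.
rewrite (bigID (fun j => sumn j == 0%N)) big_box_sum0 /= [X in _ + X]big1 ?addr0.
  by rewrite kapw0 // sumn_nseq subw0 mul1r.
by move=> j /negPf ->; rewrite mulr0.
Qed.

End RaiseStep.

Definition strict_part (mu : seq nat) : bool := sorted gtn mu && (0%N \notin mu).

Section RaiseNorm.
Variables (R : comNzRingType).
Notation form2 := (wform (kap2 R)).
Notation raise2 := (raise (kap2 R)).
Hypothesis qform : forall nu, qlike (form2 nu).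

Lemma qlike_raise mu (phi : seq nat -> seq nat -> R) :
  (forall nu, qlike (phi nu)) -> qlike (fun z => raise2 mu (phi^~ z)).
Proof.
move=> q; split=> [u v uv|w|m w m_gt0].
- by apply: eq_raise => nu _; apply: qlike_perm (q nu) _ _ uv.
- by apply: eq_raise => nu _; apply: qlike0 (q nu) _.
rewrite -raise_sum -[RHS](mul0r (raise2 mu (fun=> 0))) -raiseZ.
by apply: eq_raise => nu _; rewrite mul0r (qlike_rel (q nu)).
Qed.

(** Triangularity of Q-functions against words. Strictness of [mu] is what lets the induction work:
    the tail vanishes on entries above its head, hence on all entries at least [a], as [raise_step]
    requires. *)
Lemma raise_formP mu : strict_part mu ->
  [/\ forall c w, (head 0%N mu < c)%N -> raise2 mu (form2^~ (c :: w)) = 0,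
      bounded mu (fun z => raise2 mu (form2^~ z)) &
      raise2 mu (form2^~ mu) = 2 ^+ size mu].
Proof.
elim: mu => [|a mu IH].
  by move=> _; split=> //= c w; case: c.
move=> /andP[sm nm].
have smu : strict_part mu.
  by rewrite /strict_part (path_sorted sm); move: nm; rewrite inE negb_or => /andP[].
have [b1 b2 b3] := IH smu.
have a_gt0 : (0 < a)%N by move: nm; rewrite inE; lia.
have ha : (head 0%N mu < a)%N by case: (mu) sm => //= x s /andP[].
have qX := qlike_raise mu qform.
have bX d w : (a <= d)%N -> raise2 mu (form2^~ (d :: w)) = 0 by move=> h; apply: b1; lia.
have step c y : (a <= c)%N -> raise2 (a :: mu) (form2^~ (c :: y))
    = if c == a then 2 * raise2 mu (form2^~ y) else 0.
  by move=> le; rewrite raise_form_cons (raise_step qX a_gt0 bX).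
split=> [c w lt||].
- rewrite -[head _ _]/a in lt; by rewrite step ?ifF //=; [apply/eqP; lia | exact: ltnW].
- split=> [c w lt|]; first by rewrite step ?ifF //; [apply/eqP; lia | exact: ltnW].
  have E w : raise2 (a :: mu) (form2^~ (a :: w)) = 2 * raise2 mu (form2^~ w) by rewrite step ?eqxx.
  exact: (boundedM E b2).
by rewrite step // eqxx b3 /= exprS.
Qed.

(** The squared norm of a Q-function: the outer [raise] is applied to a bounded functional and only
    sees its diagonal value. *)
Lemma raise_form_norm mu : strict_part mu ->
  raise2 mu (fun z => raise2 mu (form2^~ z)) = 2 ^+ size mu.
Proof. by move=> /raise_formP[_ b <-]; rewrite raise_bounded. Qed.

End RaiseNorm.

(** * Straightening *)

Section Chain.
Variable R : comNzRingType.

Lemma qlike_cons (phi : seq nat -> R) a : qlike phi -> qlike (fun w => phi (a :: w)).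
Proof.
move=> q; split=> [u v uv|w|m w m_gt0].
- by apply: (qlike_perm q); rewrite perm_cons.
- rewrite -(qlike0 q (a :: w)); apply: (qlike_perm q).
  by apply/seq.permP => P /=; rewrite addnCA.
rewrite -[RHS](qlike_rel q (a :: w) m_gt0); apply: eq_bigr => i _; congr (_ * _).
by apply: (qlike_perm q); apply/seq.permP => P /=; lia.
Qed.

Lemma qlike_swap (phi : seq nat -> R) a b w : qlike phi -> phi (a :: b :: w) = phi (b :: a :: w).
Proof. by move=> q; apply: (qlike_perm q); apply/seq.permP => P /=; lia. Qed.

Lemma qlike_nseq0 (phi : seq nat -> R) w : qlike phi -> sumn w = 0%N -> phi w = phi [::].
Proof. by move=> q; elim: w => //= -[|x] w IH e; [rewrite (qlike0 q) IH | lia]. Qed.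

(** In the relation of weight [a.*2] all terms but the middle one vanish, those with [i > a] after
    exchanging the two entries. *)
Lemma qlike_double (phi : seq nat -> R) a w : qlike phi -> (0 < a)%N ->
  (forall i, (i < a)%N -> phi (i :: (a.*2 - i)%N :: w) = 0) -> phi (a :: a :: w) = 0.
Proof.
move=> q a_gt0 h; have := qlike_rel q w (m := a.*2) ltac:(lia).
have ha : (a < a.*2.+1)%N by lia.
rewrite (bigD1 (Ordinal ha)) //= big1 => [|i /eqP ne].
  rewrite addr0; have -> : (a.*2 - a)%N = a by lia.
  by move/(congr1 (fun x => (-1) ^+ a * x)); rewrite mulr0 signrMK.
have {}ne : (i : nat) <> a by move=> e; apply: ne; apply: val_inj.
case: (ltnP i a) => lt; first by rewrite h ?mulr0.
rewrite qlike_swap //; have := h (a.*2 - i)%N ltac:(lia).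
have -> : (a.*2 - (a.*2 - i))%N = i by have := ltn_ord i; lia.
by move=> ->; rewrite mulr0.
Qed.

(** Greedy choice: take the largest first entry [a] that occurs, then continue with the words
    starting with [a]. No part repeats, since [qlike_double] would rewrite it through words with an
    entry larger than [a]. *)
Lemma qlike_chain n (phi : seq nat -> R) w0 : qlike phi ->
  (forall w, phi w != 0 -> sumn w = n) -> phi w0 != 0 ->
  exists mu, [/\ strict_part mu, bounded mu phi, phi mu != 0 & sumn mu = n].
Proof.
elim/ltn_ind: n phi w0 => n IH phi w0 q hn h0.
have [n0|n_gt0] := posnP n.
  exists [::]; split=> //.
  by rewrite -(qlike_nseq0 q (w := w0)) // hn.
have [c [w1 [c_gt0 h1]]] : exists c w1, (0 < c)%N /\ phi (c :: w1) != 0.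
  have : has (leq 1) w0.
    rewrite -(hn _ h0) in n_gt0; elim: (w0) n_gt0 => //= x s IHs; case: x => //=.
  case/hasP=> c hc c_gt0; exists c, (rem c w0); split=> //.
  by rewrite (qlike_perm q (v := w0)) // perm_sym perm_to_rem.
pose P a := exists w, phi (a :: w) != 0.
have Pn a : P a -> (a <= n)%N by case=> w /hn /=; lia.
have [a [[w2 h2] amax]] : exists a, P a /\ forall b, P b -> (b <= a)%N.
  have : exists2 a, P a & (n - a < n.+1)%N by exists c; [exists w1 | lia].
  elim: n.+1 => [|m IHm] [a Pa ha]; first by lia.
  (* [P] quantifies over all words, so the maximum is found by excluded middle; the climb stops at
     [n] because of [Pn]. *)
  have [[b [Pb lt]]|nb] := classic (exists b, P b /\ (a < b)%N).
    by apply: IHm; exists b => //; have := Pn _ Pb; lia.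
  exists a; split=> // b Pb; rewrite leqNgt; apply/negP => lt.
  by apply: nb; exists b.
have le_ca : (c <= a)%N by apply: amax; exists w1.
have a_gt0 : (0 < a)%N by lia.
have big0 b w : (a < b)%N -> phi (b :: w) = 0.
  move=> lt; apply/eqP; apply: contraTT lt => nz; rewrite -leqNgt.
  by apply: amax; exists w.
have an := hn _ h2; rewrite /= in an.
have [|w /hn /= e|mu [smu bmu nmu emu]] := IH (n - a)%N _ (fun w => phi (a :: w)) w2 (qlike_cons a q) _ h2.
- lia.
- lia.
exists (a :: mu); split=> //=; last by lia.
case/andP: smu => s1 s2; rewrite /strict_part inE negb_or s2 andbT.
apply/andP; split; last by apply/eqP; lia.
case: mu s1 {s2 bmu emu} nmu => //= d mu -> nmu; rewrite andbT.
have le : (d <= a)%N by apply: amax; exists (a :: mu); rewrite qlike_swap.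
rewrite ltn_neqAle le andbT; apply/eqP => e; move: nmu; rewrite e.
rewrite (qlike_double q a_gt0) ?eqxx // => i lt.
by rewrite qlike_swap // big0 //; lia.
Qed.

Lemma sumn_uniq_le k u : uniq u -> (forall x, x \in u -> (x <= k)%N) -> (size u <= k)%N ->
  (sumn u <= \sum_(i < size u) (k - i))%N.
Proof.
elim: k u => [|k IH] u un le_k; first by case: u un le_k => // x u un le; rewrite ltn0.
case: (boolP (k.+1 \in u)) => hk sz.
  rewrite (perm_sumn (perm_to_rem hk)) /=.
  have s0 : (0 < size u)%N by case: (u) hk.
  rewrite -(prednK s0) big_ord_recl /= subn0 leq_add2l -(size_rem hk).
  under eq_bigr do rewrite /bump add1n subSS.
  apply: IH; rewrite ?rem_uniq ?size_rem //; last by lia.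
  move=> x; rewrite mem_rem_uniq // inE => /andP[/eqP ne /le_k]; lia.
have {}le_k x : x \in u -> (x <= k)%N.
  move=> hx; have := le_k x hx; rewrite leq_eqVlt => /orP[/eqP e|//].
  by rewrite -e hx in hk.
have [le|lt] := leqP (size u) k.
  apply: leq_trans (IH u un le_k le) _; apply: leq_sum => i _; lia.
have e : size u = k.+1 by lia.
have : (sumn u <= \sum_(i < k.+1) i)%N.
  have /perm_sumn -> : perm_eq u (iota 0 k.+1).
    apply: uniq_perm; rewrite ?iota_uniq //.
    have sub : {subset u <= iota 0 k.+1} by move=> x /le_k; rewrite mem_iota.
    by apply: (uniq_min_size un sub _).2; rewrite size_iota e.
  by rewrite sumnE -[iota 0 k.+1]/(index_iota 0 k.+1) big_mkord.
move=> h; apply: leq_trans h _; rewrite e (reindex_inj rev_ord_inj) /=.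
by apply: leq_sum => i _; have := ltn_ord i; lia.
Qed.

Definition sqsum (u : seq nat) := sumn [seq (x ^ 2)%N | x <- u].

Lemma perm_sqsum u v : perm_eq u v -> sqsum u = sqsum v.
Proof. by move=> uv; apply: perm_sumn; apply: perm_map. Qed.

Lemma sqsum_le u : (sqsum u <= sumn u ^ 2)%N.
Proof. by elim: u => //= x u; rewrite /sqsum /= => h; rewrite sqrnD -addnA leq_add2l (leq_trans h) ?leq_addr. Qed.

Lemma perm_dup (u : seq nat) : ~~ uniq u -> exists (a : nat) (v : seq nat), perm_eq u (a :: a :: v).
Proof.
elim: u => //= x u IH; rewrite negb_and negbK => /orP[hx|/IH[a [v uv]]].
  by exists x, (rem x u); rewrite perm_cons perm_to_rem.
exists a, (x :: v); rewrite -(perm_cons x) in uv; apply: perm_trans uv _.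
by apply/seq.permP => P /=; lia.
Qed.

(* Two equal entries a, a can be replaced, modulo the relation, by pairs
   a - i, a + i, which increases the sum of squares. *)
Lemma qlike_dominated k (phi : seq nat -> R) u w : qlike phi ->
  (forall c w, (k < c)%N -> phi (c :: w) = 0) -> (size u <= k)%N ->
  (\sum_(i < size u) (k - i) < sumn u)%N -> phi (u ++ w) = 0.
Proof.
move=> q bk; elim: {u}(size u) {-2}u (erefl (size u)) w => [|r IHr] u; first by case: u => //=; rewrite big_ord0.
have [d] := ubnP (sumn u ^ 2 - sqsum u)%N; elim: d u => // d IHd u le_d e w sz lt.
have [hk|/hasPn hk] := boolP (has (ltn k) u).
  case/hasP: hk => x hx ltk.
  rewrite (qlike_perm q (v := x :: (rem x u ++ w))) ?bk //.
  by rewrite -cat_cons perm_cat2r perm_to_rem.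
have {}hk x : x \in u -> (x <= k)%N by move/hk; rewrite -leqNgt.
have [un|/perm_dup[a [v uv]]] := boolP (uniq u).
  by have := sumn_uniq_le un hk sz; rewrite leqNgt lt.
have ev : size v = r.-1 /\ (0 < r)%N by have := perm_size uv; rewrite e /=; lia.
have sv := perm_sumn uv; have qv := perm_sqsum uv.
rewrite (qlike_perm q (v := a :: a :: (v ++ w))); last by rewrite -!cat_cons perm_cat2r.
(* If the repeated entry is 0, one copy is dropped: the sum stays the same, while fewer entries have
   a smaller bound. *)
have [a0|a_gt0] := posnP a.
  have sav : size (a :: v) = r. by rewrite /=; lia.
  rewrite {1}a0 (qlike0 q) -cat_cons; apply: IHr => //; first by rewrite sav; lia.
  by move: lt; rewrite sav sv e big_ord_recr /=; lia.
apply: qlike_double => // i lt_ia; rewrite -!cat_cons; apply: IHd => //=.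
- move: le_d; rewrite sv qv /sqsum /=; set S := sumn [seq _ | _ <- _].
  have := sqsum_le [:: i, (a.*2 - i)%N & v]; rewrite /sqsum /= -/S.
  have -> : (i + (a.*2 - i + sumn v))%N = (a + (a + sumn v))%N by lia.
  have : (a ^ 2 + a ^ 2 < i ^ 2 + (a.*2 - i) ^ 2)%N by rewrite !expnS !expn0; nia.
  lia.
- by lia.
- by lia.
have -> : (size v).+2 = size u by lia.
by apply: leq_trans lt _; rewrite sv /=; lia.
Qed.

End Chain.

(** * Anticommuting matrices *)

Lemma mxtrace_idem (F : fieldType) d (P : 'M[F]_d) : P *m P = P -> \tr P = (\rank P)%:R.
Proof.
move=> PP; have : row_base P *m col_base P = 1%:M.
  apply: (row_full_inj (col_base_full P)); apply: (row_free_inj (row_base_free P)).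
  by rewrite /= mulmx1 mulmxA mulmx_base -mulmxA mulmx_base.
by move=> e; rewrite -{1}(mulmx_base P) mxtrace_mulC e mxtrace1.
Qed.

Lemma mxtraceN (R : pzRingType) d (M : 'M[R]_d) : \tr (- M) = - \tr M.
Proof. by rewrite raddfN. Qed.

Section CliffordFamily.
Variable d : nat.
Implicit Types (P : 'M[algC]_d) (x y : 'M[algC]_d * algC) (XC : seq ('M[algC]_d * algC)).

Definition cliff_fam P XC :=
  all (fun x => [&& x.1 *m P == P *m x.1, x.1 *m x.1 == x.2%:M & x.2 != 0]) XC
  && pairwise (fun x y => x.1 *m y.1 == - (y.1 *m x.1)) XC.

Definition fam_prod XC : 'M[algC]_d := foldr (fun x M => x.1 *m M) 1%:M XC.

Section Reduce.
Variables (P X1 X2 : 'M[algC]_d) (c1 c2 : algC) (XC : seq ('M[algC]_d * algC)).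
Hypothesis PP : P *m P = P.
Hypothesis fam : cliff_fam P ((X1, c1) :: (X2, c2) :: XC).

(** [S] is an involution commuting with [P], and [P'] projects onto its eigenvalue 1 inside the
    image of [P]. [X2] exchanges the two eigenspaces, which halves the trace; its products with the
    remaining operators preserve them and anticommute again. *)
Let S := (sqrtC c1)^-1 *: X1.
Let P' := 2^-1 *: (P + P *m S).
Let XC' := [seq (X2 *m x.1, - (c2 * x.2)) | x <- XC].

Let famE : [/\ X1 *m P = P *m X1, X1 *m X1 = c1%:M, c1 != 0, X2 *m P = P *m X2 & X2 *m X2 = c2%:M]
  /\ [/\ c2 != 0, X1 *m X2 = - (X2 *m X1),
        (forall x, x \in XC -> [/\ x.1 *m P = P *m x.1, x.1 *m x.1 = x.2%:M, x.2 != 0,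
           X1 *m x.1 = - (x.1 *m X1) & X2 *m x.1 = - (x.1 *m X2)]) &
        pairwise (fun x y => x.1 *m y.1 == - (y.1 *m x.1)) XC].
Proof.
case/andP: fam => /= /and3P[/and3P[/eqP h1 /eqP h2 h3] /and3P[/eqP h4 /eqP h5 h6] /allP h7].
case/andP=> /andP[/eqP h8 /allP h9] /andP[/allP h10 h11].
split; split=> // x hx; have /and3P[/eqP a /eqP b c] := h7 x hx.
by have /eqP := h9 x hx; have /eqP := h10 x hx.
Qed.

Let SS : S *m S = 1%:M.
Proof.
case: famE => -[_ h h0 _ _] _; rewrite /S -scalemxAl -scalemxAr h scalerA -invfM -expr2 sqrtCK.
by rewrite scale_scalar_mx mulVf.
Qed.

Let SP : S *m P = P *m S.
Proof. by case: famE => -[h _ _ _ _] _; rewrite /S -scalemxAl h scalemxAr. Qed.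

Let SX2 : S *m X2 = - (X2 *m S).
Proof. by case: famE => _ [_ h _ _]; rewrite /S -scalemxAl h scalerN scalemxAr. Qed.

Lemma reduce_idem : P' *m P' = P'.
Proof.
rewrite /P' -scalemxAl -scalemxAr mulmxDl !mulmxDr PP mulmxA PP -!mulmxA SP.
rewrite [S *m (P *m S)]mulmxA SP -mulmxA SS mulmx1 PP [_ *m (P *m S)]mulmxA PP.
rewrite [_ *m S + _]addrC -mulr2n -scaler_nat !scalerA; congr (_ *: _); rewrite mulVf ?mulr1 ?pnatr_eq0 //.
Qed.

Let conjX2 M : \tr (X2 *m M *m X2) = c2 * \tr M.
Proof.
case: famE => -[_ _ _ _ h] _.
by rewrite mxtrace_mulC mulmxA h mul_scalar_mx mxtraceZ.
Qed.

Lemma reduce_trace : \tr P = 2 * \tr P'.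
Proof.
rewrite /P' mxtraceZ mulrA mulfV ?pnatr_eq0 // mul1r mxtraceD.
suff -> : \tr (P *m S) = 0 by rewrite addr0.
have := conjX2 (P *m S); case: famE => -[_ _ _ h h'] [c20 _ _ _].
rewrite mulmxA h -!mulmxA SX2 !mulmxN mxtraceN [X2 *m (X2 *m _)]mulmxA h'.
rewrite mul_scalar_mx -scalemxAr mxtraceZ.
move/eqP; rewrite eq_sym -addr_eq0 -mulr2n mulrn_eq0 mulf_eq0 (negPf c20) /=.
by move/eqP.
Qed.

Lemma reduce_fam : cliff_fam P' XC'.
Proof.
case: famE => -[h1 h2 h3 h4 h5] [c20 h6 h7 h8].
apply/andP; split.
  apply/allP => _ /mapP[x hx ->] /=; have [a b c e1 e2] := h7 x hx.
  apply/and3P; split.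
  - have SY : S *m (X2 *m x.1) = X2 *m x.1 *m S.
      rewrite mulmxA SX2 mulNmx -!mulmxA -mulmxN; congr (_ *m _).
      by rewrite /S -scalemxAl -scalemxAr e1 scalerN opprK.
    have YP : X2 *m x.1 *m P = P *m (X2 *m x.1) by rewrite -mulmxA a mulmxA h4 mulmxA.
    rewrite /P' -scalemxAl -scalemxAr mulmxDl mulmxDr YP; apply/eqP; congr (_ *: (_ + _)).
    rewrite [LHS]mulmxA YP -[LHS]mulmxA -SY; exact: mulmxA.
  - have e2' : x.1 *m X2 = - (X2 *m x.1) by rewrite e2 opprK.
    rewrite -!mulmxA [x.1 *m (X2 *m x.1)]mulmxA e2' mulNmx mulmxN -!mulmxA b.
    by rewrite mul_mx_scalar -scalemxAr h5 scale_scalar_mx raddfN /= mulrC.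
  - by rewrite oppr_eq0 mulf_neq0.
rewrite /XC'; elim: (XC) h7 h8 => //= x XC0 IH h7 /andP[/allP h8 h9].
rewrite IH ?andbT //; last by move=> y hy; apply: h7; rewrite inE hy orbT.
apply/allP => _ /mapP[y hy ->] /=.
have [_ _ _ _ ex] := h7 x ltac:(by rewrite inE eqxx).
have [_ _ _ _ ey] := h7 y ltac:(by rewrite inE hy orbT).
have /eqP exy := h8 y hy.
have ex' : x.1 *m X2 = - (X2 *m x.1) by rewrite ex opprK.
have ey' : y.1 *m X2 = - (X2 *m y.1) by rewrite ey opprK.
rewrite -!mulmxA [x.1 *m _]mulmxA ex' [y.1 *m (X2 *m _)]mulmxA ey' !mulNmx !mulmxN -!mulmxA exy.
by rewrite !mulmxN.
Qed.

(** Collecting the factors [X2] in pairs gives a scalar of modulus [|c2|] for each pair, and one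
    [X2] is left over. Only moduli are needed later, so the sign is not tracked. *)
Let fam_prodN2 r : odd (size r) -> (forall x, x \in r -> x \in XC) ->
  exists2 t, `|t| = `|c2| ^+ (size r)./2 &
  fam_prod [seq (X2 *m x.1, - (c2 * x.2)) | x <- r] = t *: (X2 *m fam_prod r).
Proof.
elim: {r}(size r) {-2}r (leqnn (size r)) => [|m IH] [|x [|y r]] //=.
  by move=> _ _ _; exists 1; rewrite ?normr1 // scale1r mulmxA.
rewrite negbK => le od sub.
have sub' z : z \in r -> z \in XC by move=> hz; apply: sub; rewrite !inE hz !orbT.
have [t nt ->] := IH r (ltnW le) od sub'.
exists (- c2 * t); first by rewrite normrM normrN nt exprS.
case: famE => -[_ _ _ _ h5] [_ _ h7 _].
have [_ _ _ _ ex] := h7 x (sub x ltac:(by rewrite inE eqxx)).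
have [_ _ _ _ ey] := h7 y (sub y ltac:(by rewrite !inE eqxx orbT)).
have ey' : y.1 *m X2 = - (X2 *m y.1) by rewrite ey opprK.
rewrite -scalemxAr -!scalemxAr -scalerA; 
rewrite -!mulmxA [y.1 *m (X2 *m _)]mulmxA ey' !mulNmx !mulmxN -!mulmxA.
rewrite [X2 *m (X2 *m (y.1 *m _))]mulmxA h5 mul_scalar_mx -!scalemxAr.
by rewrite scaleNr scalerN !scalerA mulrC.
Qed.

(** Since [XC] has odd size, [X2] anticommutes with [Z], the product of [X2] and [fam_prod XC].
    Hence the trace of [P *m Z] is zero, and that of [P *m S *m Z] is twice the trace of
    [P' *m Z]. *)
Lemma reduce_prod : odd (size XC) ->
  `|\tr (P *m fam_prod ((X1, c1) :: (X2, c2) :: XC))| ^+ 2 * `|c2| ^+ (size XC).-1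
  = 4 * `|c1| * `|\tr (P' *m fam_prod XC')| ^+ 2.
Proof.
move=> od; have [t nt ->] := fam_prodN2 od (fun x h => h).
case: famE => -[h1 h2 h3 h4 h5] [c20 h6 h7 h8].
set Z := X2 *m fam_prod XC.
have X1E : X1 = sqrtC c1 *: S by rewrite /S scalerA mulfV ?scale1r // sqrtC_eq0.
have ZX2 : Z *m X2 = - (X2 *m Z).
  rewrite /Z -mulmxA -mulmxN; congr (_ *m _).
  have : forall r, (forall x, x \in r -> x \in XC) ->
     fam_prod r *m X2 = (-1) ^+ size r *: (X2 *m fam_prod r).
    elim=> [|x r IH] sub /=; first by rewrite mul1mx mulmx1 scale1r.
    have [_ _ _ _ ex] := h7 x (sub x ltac:(by rewrite inE eqxx)).
    rewrite -mulmxA IH; last by move=> y hy; apply: sub; rewrite inE hy orbT.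
    by rewrite -scalemxAr !mulmxA ex mulNmx scalerN exprS mulN1r scaleNr opprK.
  by move=> /(_ XC (fun x h => h)) ->; rewrite -signr_odd od expr1 scaleN1r.
have {ZX2} key : \tr (P *m (S *m Z)) = \tr (P *m S *m Z + P *m Z).
  move: Z ZX2 => Z ZX2.
  rewrite mulmxA mxtraceD; suff -> : \tr (P *m Z) = 0 by rewrite addr0.
  have := conjX2 (P *m Z); rewrite mulmxA h4 -!mulmxA ZX2 !mulmxN [X2 *m (X2 *m _)]mulmxA h5.
  rewrite mul_scalar_mx -scalemxAr mxtraceN mxtraceZ.
  move/eqP; rewrite eq_sym -addr_eq0 -mulr2n mulrn_eq0 mulf_eq0 (negPf c20) /=.
  by move/eqP.
have -> : \tr (P *m fam_prod ((X1, c1) :: (X2, c2) :: XC)) = sqrtC c1 * (2 * \tr (P' *m Z)).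
  rewrite [fam_prod _]/= -/Z X1E -scalemxAl -scalemxAr mxtraceZ key /P' -scalemxAl mxtraceZ.
  by rewrite mulmxDl addrC; congr (_ * _); rewrite mulrA mulfV ?pnatr_eq0 // mul1r.
have nc1 : `|sqrtC c1| ^+ 2 = `|c1| by rewrite -normrX sqrtCK.
rewrite -scalemxAr mxtraceZ !normrM !exprMn nc1 nt -exprM.
have -> : ((size XC)./2 * 2)%N = (size XC).-1 by rewrite muln2; lia.
by rewrite ger0_norm ?ler0n //; ring.
Qed.

End Reduce.

(** Each reduction uses up two operators and halves the trace; at the end the trace is the rank of
    an idempotent. *)
Lemma cliff_fam_trace P XC : P *m P = P -> cliff_fam P XC ->
  exists m : nat, \tr P = (m * 2 ^ (size XC)./2)%:R.
Proof.
elim: {XC}(size XC) {-2}XC (leqnn (size XC)) P => [|m IH] [|[X1 c1] [|[X2 c2] XC]] //= le P PP fam;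
  try by exists (\rank P); rewrite mxtrace_idem ?muln1.
have := IH _ _ _ (reduce_idem PP fam) (reduce_fam fam).
rewrite size_map => /(_ ltac:(lia)) [r er]; exists r.
by rewrite (reduce_trace fam) er -natrM expnS mulnCA.
Qed.

(** With the smallest possible trace, the reductions end at a projector of rank one, on which the
    last operator acts by a square root of its scalar. *)
Lemma cliff_fam_top P XC : P *m P = P -> cliff_fam P XC -> odd (size XC) ->
  \tr P = (2 ^ (size XC)./2)%:R ->
  `|\tr (P *m fam_prod XC)| ^+ 2 = 2 ^+ (size XC).-1 * \prod_(x <- XC) `|x.2|.
Proof.
elim: {XC}(size XC) {-2}XC (leqnn (size XC)) P => [|m IH] [|[X1 c1] [|[X2 c2] XC]] //= le P PP fam.
  move=> _ e; have /eqP rk : (\rank P == 1)%N by rewrite -(eqr_nat algC) -mxtrace_idem // e.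
  case/and3P: fam => /= /andP[/and3P[/eqP h1 /eqP h2 h3] _] _ _.
  rewrite big_seq1 mul1r mulmx1 /= -normrX; congr (`| _ |).
  set l := \tr _.
  have PXP : P *m X1 *m P = l *: P.
    rewrite /l; rewrite -(mulmx_base P); move: (col_base P) (row_base P).
    rewrite rk => A B; have -> : \tr (A *m B *m X1) = (B *m X1 *m A) 0 0.
      by rewrite -mulmxA mxtrace_mulC /mxtrace big_ord1.
    have -> : A *m B *m X1 *m (A *m B) = A *m (B *m X1 *m A) *m B by rewrite !mulmxA.
    by rewrite {1}[B *m X1 *m A]mx11_scalar mul_mx_scalar -scalemxAl.
  have : P *m X1 *m (P *m X1) = l ^+ 2 *: P.
    rewrite mulmxA PXP -scalemxAl -[P in P *m X1]PP -mulmxA -h1 mulmxA PXP.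
    by rewrite scalerA expr2.
  rewrite mulmxA -[P *m X1 *m P]mulmxA h1 mulmxA PP -mulmxA h2 mul_mx_scalar.
  move/(congr1 (fun M => \tr M)); rewrite !mxtraceZ e !mulr1.
  by [].
rewrite negbK => od e; have od' := od.
have := reduce_prod fam od.
rewrite (IH _ _ _ (reduce_idem PP fam) (reduce_fam fam)) ?size_map //; last first.
  have := reduce_trace fam; rewrite e expnS natrM => h.
  by apply: (mulfI (x := 2)); rewrite ?pnatr_eq0.
  by lia.
rewrite !big_cons big_map /=.
have -> : \prod_(j <- XC) `|- (c2 * j.2)| = `|c2| ^+ size XC * \prod_(j <- XC) `|j.2|.
  elim: (XC) => [|x r IHr]; first by rewrite !big_nil mul1r.
  by rewrite !big_cons IHr normrN normrM exprS; ring.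
have c20 : `|c2| != 0 by case/andP: fam => /= /and3P[_ /and3P[_ _ h] _] _; rewrite normr_eq0.
have sz : (0 < size XC)%N by case: (size XC) od.
move=> h; apply: (mulIf (expf_neq0 (size XC).-1 c20)); rewrite h.
rewrite -[in `|c2| ^+ size XC](prednK sz) exprS -[in 2 ^+ (size XC).+1](prednK sz) !exprS.
by ring.
Qed.

End CliffordFamily.

(** * Signed Clifford group *)

Lemma F2_addxx (x : 'F_2) : x + x = 0.
Proof. by apply: val_inj; case: x => [[|[|m]] h] //=. Qed.

Lemma F2_opp (x : 'F_2) : - x = x.
Proof. by apply/eqP; rewrite eq_sym -addr_eq0 F2_addxx. Qed.

Lemma F2_cases (x : 'F_2) : x = 0 \/ x = 1.
Proof.
by case: x => [[|[|m]] h] //; [left | right]; apply: val_inj.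
Qed.

Lemma F2_eq (x y z : 'F_2) : x - y = z + z -> x = y.
Proof. by rewrite F2_addxx => /eqP; rewrite subr_eq0 => /eqP. Qed.

Definition F2sg (x : 'F_2) : algC := (-1) ^+ (x : nat).

Lemma F2sgD x y : F2sg (x + y) = F2sg x * F2sg y.
Proof.
rewrite /F2sg; case: (F2_cases x) => ->; case: (F2_cases y) => ->;
  by rewrite ?addr0 ?add0r ?F2_addxx /= ?expr0 ?expr1 ?mulr1 ?mul1r ?mulrNN ?mulr1.
Qed.

Lemma F2sg0 : F2sg 0 = 1. Proof. by []. Qed.
Lemma F2sg1 : F2sg 1 = -1. Proof. by []. Qed.

(** In characteristic two the terms at [(x, y)] and [(y, x)] cancel. *)
Lemma F2sum_sym0 n (e : 'I_n -> 'I_n -> 'F_2) :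
  (forall x y, e x y = e y x) -> (forall x, e x x = 0) -> \sum_x \sum_y e x y = 0.
Proof.
move=> sym diag; rewrite pair_big /=.
rewrite (bigID (fun p : 'I_n * 'I_n => (p.1 < p.2)%N)) /=.
rewrite [X in _ + X](bigID (fun p : 'I_n * 'I_n => (p.2 < p.1)%N)) /=.
rewrite [X in _ + (_ + X)]big1 ?addr0; last first.
  move=> [x y] /=; rewrite -!leqNgt => /andP[h1 h2].
  by have -> : x = y by apply: val_inj; apply/eqP; rewrite eqn_leq h1 h2.
rewrite [X in _ + X](reindex_inj (h := fun p : 'I_n * 'I_n => (p.2, p.1))) /=; last first.
  by move=> [x y] [x' y'] [-> ->].
rewrite [X in _ + X](eq_big (fun p : 'I_n * 'I_n => (p.1 < p.2)%N) (fun p => e p.1 p.2)).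
- exact: F2_addxx.
- by move=> [x y] /=; case: ltngtP.
by move=> [x y] _ /=.
Qed.

Section CliffordSigns.
Variable N : nat.
Notation V := {ffun 'I_N -> 'F_2}.
Implicit Types (A B C : V) (s t : 'S_N).

Definition vact A s : V := [ffun x => A (s^-1%g x)].
(** Parity of the number of exchanges that sort the product of the increasing monomials e_A and
    e_B. *)
Definition vbeta A B : 'F_2 := \sum_(x < N) \sum_(y < N) (y < x)%N%:R * (A x * B y).
Definition vdot A B : 'F_2 := \sum_x A x * B x.
Definition vwt A : 'F_2 := \sum_x A x.
(* Sorting the monomial e_B permuted by s costs one sign for each inversion of
   s on the support of B. *)
Definition vinv s B : 'F_2 :=
  \sum_(x < N) \sum_(y < N) ((x < y) && (s y < s x))%N%:R * (B x * B y).

Lemma vact1 A : vact A 1 = A.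
Proof. by apply/ffunP => x; rewrite ffunE invg1 perm1. Qed.

Lemma vactM A s t : vact A (s * t) = vact (vact A s) t.
Proof. by apply/ffunP => x; rewrite !ffunE invMg permM. Qed.

Lemma vactD A B s : vact (A + B) s = vact A s + vact B s.
Proof. by apply/ffunP => x; rewrite !ffunE. Qed.

Lemma vact0 s : vact 0 s = 0.
Proof. by apply/ffunP => x; rewrite !ffunE. Qed.

Lemma vaddxx A : A + A = 0.
Proof. by apply/ffunP => x; rewrite !ffunE F2_addxx. Qed.

Lemma vopp A : - A = A.
Proof. by apply/ffunP => x; rewrite !ffunE F2_opp. Qed.

Lemma vbetaDl A B C : vbeta (A + B) C = vbeta A C + vbeta B C.
Proof.
rewrite /vbeta -big_split; apply: eq_bigr => x _; rewrite -big_split.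
by apply: eq_bigr => y _; rewrite ffunE ?mulrDl ?mulrDr ?mulrDr.
Qed.

Lemma vbetaDr A B C : vbeta A (B + C) = vbeta A B + vbeta A C.
Proof.
rewrite /vbeta -big_split; apply: eq_bigr => x _; rewrite -big_split.
by apply: eq_bigr => y _; rewrite ffunE ?mulrDl ?mulrDr ?mulrDr.
Qed.

Lemma vbeta0l A : vbeta 0 A = 0.
Proof. by rewrite /vbeta big1 // => x _; rewrite big1 // => y _; rewrite ffunE mul0r mulr0. Qed.

Lemma vbeta0r A : vbeta A 0 = 0.
Proof. by rewrite /vbeta big1 // => x _; rewrite big1 // => y _; rewrite ffunE !mulr0. Qed.

Lemma vdotC A B : vdot A B = vdot B A.
Proof. by apply: eq_bigr => x _; rewrite mulrC. Qed.

Lemma vdotDl A B C : vdot (A + B) C = vdot A C + vdot B C.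
Proof. by rewrite /vdot -big_split; apply: eq_bigr => x _; rewrite ffunE mulrDl. Qed.

Lemma vdotDr A B C : vdot A (B + C) = vdot A B + vdot A C.
Proof. by rewrite vdotC vdotDl !(vdotC A). Qed.

Lemma vwtD A B : vwt (A + B) = vwt A + vwt B.
Proof. by rewrite /vwt -big_split; apply: eq_bigr => x _; rewrite ffunE. Qed.

Lemma vwt_act A s : vwt (vact A s) = vwt A.
Proof.
rewrite /vwt (reindex_inj (@perm_inj _ s)).
by apply: eq_bigr => x _; rewrite ffunE permK.
Qed.

Lemma vdot_act A B s : vdot (vact A s) (vact B s) = vdot A B.
Proof.
rewrite /vdot (reindex_inj (@perm_inj _ s)).
by apply: eq_bigr => x _; rewrite !ffunE permK.
Qed.

(** Off the diagonal each pair is counted exactly once on the left. This is the sign for exchanging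
    e_A and e_B. *)
Lemma vbetaC A B : vbeta A B + vbeta B A = vwt A * vwt B + vdot A B.
Proof.
have -> : vbeta B A = \sum_(x < N) \sum_(y < N) (x < y)%N%:R * (A x * B y).
  by rewrite /vbeta exchange_big; apply: eq_bigr => x _; apply: eq_bigr => y _; ring.
have -> : vdot A B = \sum_(x < N) \sum_(y < N) (x == y)%N%:R * (A x * B y).
  apply: eq_bigr => x _; rewrite (bigD1 x) //= eqxx mul1r big1 ?addr0 // => y.
  by rewrite eq_sym => /negPf ->; rewrite mul0r.
rewrite /vwt mulr_suml -!big_split; apply: eq_bigr => x _ /=.
rewrite mulr_sumr -!big_split; apply: eq_bigr => y _ /=.
rewrite -(inj_eq val_inj) /=; case: ltngtP => h; rewrite ?mul1r ?mul0r ?addr0 ?add0r //.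
by rewrite F2_addxx.
Qed.

Lemma vinv1 A : vinv 1 A = 0.
Proof.
rewrite /vinv big1 // => x _; rewrite big1 // => y _; rewrite !perm1.
by case: ltngtP => _ /=; rewrite mul0r.
Qed.

Lemma vinv0 s : vinv s 0 = 0.
Proof.
by rewrite /vinv big1 // => x _; rewrite big1 // => y _; rewrite !ffunE mul0r mulr0.
Qed.

(** A pair is inverted by [s * t] when exactly one of the two stages inverts it. The defect [e] is
    symmetric in the pair, so [F2sum_sym0] applies without ordering the summation. *)
Lemma vinvM s t A : vinv (s * t) A = vinv s A + vinv t (vact A s).
Proof.
have -> : vinv t (vact A s) =
    \sum_(x < N) \sum_(y < N) ((s x < s y) && (t (s y) < t (s x)))%N%:R * (A x * A y).
  rewrite /vinv (reindex_inj (@perm_inj _ s)); apply: eq_bigr => x _.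
  rewrite (reindex_inj (@perm_inj _ s)); apply: eq_bigr => y _.
  by rewrite !ffunE !permK.
apply/eqP; rewrite -subr_eq0 F2_opp; apply/eqP.
pose e (x y : 'I_N) : 'F_2 := (((x < y) && ((s * t)%g y < (s * t)%g x))%N%:R
  + (((x < y) && (s y < s x))%N%:R + ((s x < s y) && (t (s y) < t (s x)))%N%:R)) * (A x * A y).
transitivity (\sum_x \sum_y e x y).
  rewrite /vinv -!big_split; apply: eq_bigr => x _; rewrite -!big_split.
  by apply: eq_bigr => y _; rewrite /e /=; ring.
apply: F2sum_sym0 => [x y|x]; last by rewrite /e !ltnn /=; ring.
have [->//|ne] := eqVneq x y.
have ne1 : s x != s y by rewrite (inj_eq perm_inj).
have ne2 : t (s x) != t (s y) by rewrite !(inj_eq perm_inj).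
rewrite /e !permM [A y * _]mulrC; congr (_ * _); move: ne ne1 ne2; rewrite -!(inj_eq val_inj) /=.
by case: (ltngtP x y) => // _ _; case: (ltngtP (s x) (s y)) => // _ _;
  case: (ltngtP (t (s x)) (t (s y))) => // _ _ /=; rewrite ?addr0 ?add0r ?F2_addxx.
Qed.

(** [vinv s] is quadratic; its polar form is the change of [vbeta] under [s], because [s] acts on
    monomials by algebra automorphisms. *)
Lemma vinvD s A B :
  vinv s (A + B) = vinv s A + vinv s B + vbeta (vact A s) (vact B s) + vbeta A B.
Proof.
have -> : vbeta (vact A s) (vact B s) = \sum_(x < N) \sum_(y < N) (s y < s x)%N%:R * (A x * B y).
  rewrite /vbeta (reindex_inj (@perm_inj _ s)); apply: eq_bigr => x _.
  rewrite (reindex_inj (@perm_inj _ s)); apply: eq_bigr => y _.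
  by rewrite !ffunE !permK.
have swap : \sum_(x < N) \sum_(y < N) ((x < y) && (s y < s x))%N%:R * (B x * A y)
    = \sum_(x < N) \sum_(y < N) ((y < x) && (s x < s y))%N%:R * (A x * B y) :> 'F_2.
  by rewrite exchange_big; apply: eq_bigr => x _; apply: eq_bigr => y _; ring.
transitivity (vinv s A + vinv s B
  + \sum_(x < N) \sum_(y < N) ((x < y) && (s y < s x))%N%:R * (A x * B y)
  + \sum_(x < N) \sum_(y < N) ((x < y) && (s y < s x))%N%:R * (B x * A y)).
  rewrite /vinv -!big_split; apply: eq_bigr => x _; rewrite -!big_split.
  by apply: eq_bigr => y _; rewrite !ffunE /=; ring.
rewrite swap -!addrA; congr (_ + (_ + _)).
rewrite /vbeta -!big_split; apply: eq_bigr => x _; rewrite -!big_split.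
apply: eq_bigr => y _ /=; rewrite -!mulrDl.
have [->|ne] := eqVneq x y; first by rewrite !ltnn.
have ne1 : s x != s y by rewrite (inj_eq perm_inj).
congr (_ * _); move: ne ne1; rewrite -!(inj_eq val_inj) /=.
by case: (ltngtP x y) => // _ _; case: (ltngtP (s x) (s y)) => // _ _ /=; rewrite ?addr0 ?add0r ?F2_addxx.
Qed.

End CliffordSigns.

(** The permuted points sit in increasing order among the generators, and the other generators are
    fixed. Keeping the order makes the inversion signs agree, see [vinv_push]. *)
Record perm_emb (n N : nat) := PermEmb {
  pe : 'S_n -> 'S_N;
  pt : 'I_n -> 'I_N;
  peM : {morph pe : s t / (s * t)%g};
  pt_lt : forall x y, (pt x < pt y)%N = (x < y)%N;
  pe_pt : forall s x, pe s (pt x) = pt (s x);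
  pe_out : forall s y, y \notin codom pt -> pe s y = y }.

Lemma porbit_step (T : finType) (t : {perm T}) z a : (t z \in porbit t a) = (z \in porbit t a).
Proof. by have := porbit_perm t 1 z; rewrite expg1 porbit_sym => ->; rewrite porbit_sym. Qed.

Lemma imset_porbit (T : finType) (t : {perm T}) a : [set t x | x in porbit t a] = porbit t a.
Proof.
apply/setP => y; apply/imsetP/idP => [[z hz ->]|hy]; first by rewrite porbit_step.
by exists (t^-1%g y); rewrite ?permKV // -porbit_step permKV.
Qed.

Section VDelta.
Variable N : nat.
Notation V := {ffun 'I_N -> 'F_2}.
Implicit Types (A B : V) (s : 'S_N).

Definition vdelta x : V := [ffun y => (y == x)%:R].
Definition vset (C : {set 'I_N}) : V := [ffun y => (y \in C)%:R].

Lemma vact_delta x s : vact (vdelta x) s = vdelta (s x).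
Proof. by apply/ffunP => y; rewrite !ffunE (canF_eq (permKV s)). Qed.

Lemma vwt_delta x : vwt (vdelta x) = 1.
Proof.
rewrite /vwt (bigD1 x) //= big1 ?addr0 => [|y /negPf ne]; rewrite ffunE ?eqxx //.
by rewrite ne.
Qed.

Lemma vdot_delta x A : vdot (vdelta x) A = A x.
Proof.
rewrite /vdot (bigD1 x) //= big1 ?addr0 => [|y /negPf ne]; rewrite ffunE ?eqxx ?mul1r //.
by rewrite ne mul0r.
Qed.

Lemma vinv_delta x s : vinv s (vdelta x) = 0.
Proof.
rewrite /vinv big1 // => y _; rewrite big1 // => z _; rewrite !ffunE.
have [->|_] := eqVneq y x; last by rewrite mul0r mulr0.
have [->|_] := eqVneq z x; last by rewrite mulr0 mulr0.
by rewrite ltnn mul0r.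
Qed.

Lemma vact_set (C : {set 'I_N}) s : vact (vset C) s = vset [set s x | x in C].
Proof.
apply/ffunP => y; rewrite !ffunE; congr (_ : bool)%:R.
apply/idP/imsetP => [h|[x hx ->]]; last by rewrite permK.
by exists (s^-1%g y); rewrite ?permKV.
Qed.

Lemma vwt_set (C : {set 'I_N}) : vwt (vset C) = #|C|%:R.
Proof.
rewrite /vwt -sum1_card natr_sum [RHS]big_mkcond; apply: eq_bigr => x _.
by rewrite ffunE; case: (x \in C).
Qed.

(** On vectors fixed by [s] the polar form cancels, so there [vinv s] is linear. *)
Lemma vinv_stableD s A B : vact A s = A -> vact B s = B ->
  vinv s (A + B) = vinv s A + vinv s B.
Proof. by move=> hA hB; rewrite vinvD hA hB -addrA F2_addxx addr0. Qed.

End VDelta.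

(* (d, A, s) stands for (-1)^d e_A s, where e_A is the increasing product of the
   anticommuting generators e_x with A x = 1. *)
Definition cliff (n N : nat) (h : perm_emb n N) : Type := ('F_2 * {ffun 'I_N -> 'F_2} * 'S_n)%type.

HB.instance Definition _ n N (h : perm_emb n N) := Finite.on (cliff h).

Lemma pt_inj n N (h : perm_emb n N) : injective (pt h).
Proof.
move=> x y e; apply: val_inj; apply/eqP; rewrite eqn_leq leqNgt -(pt_lt h) e ltnn /=.
by rewrite leqNgt -(pt_lt h) e ltnn.
Qed.

Section CliffGroup.
Variables (n N : nat) (h : perm_emb n N).

Lemma perm_emb_inj : injective (pe h).
Proof.
move=> s t e; apply/permP => x; apply: (pt_inj (h := h)).
by rewrite -!pe_pt e.
Qed.

Lemma pe1 : pe h 1 = 1%g.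
Proof. by apply: (mulgI (pe h 1)); rewrite -peM !mulg1. Qed.

Lemma peV s : pe h s^-1 = (pe h s)^-1%g.
Proof. by apply: (mulgI (pe h s)); rewrite mulgV -peM mulgV pe1. Qed.

(** The monomial of [A] is moved through [t], which costs [vinv], and then merged with that of [B],
    which costs [vbeta]. *)
Definition cliff_mul (g k : cliff h) : cliff h :=
  let: (d, A, s) := g in let: (d', B, t) := k in
  (d + d' + vinv (pe h t) A + vbeta (vact A (pe h t)) B, vact A (pe h t) + B, (s * t)%g).

Definition cliff_one : cliff h := (0, 0, 1%g).

Definition cliff_inv (g : cliff h) : cliff h :=
  let: (d, A, s) := g in let B := vact A (pe h s^-1) in
  (d + vinv (pe h s) B + vbeta A A, B, s^-1%g).

Lemma cliff_mulA : associative cliff_mul.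
Proof.
move=> [[d A] s] [[d' B] t] [[d'' C] u]; rewrite /cliff_mul.
congr (_, _, _); last by rewrite mulgA.
  rewrite peM vactM vinvM !vinvD vactD !vbetaDl !vbetaDr.
  by apply: (F2_eq (z := - vbeta (vact A (pe h t)) B)); ring.
by rewrite peM vactM vactD addrA.
Qed.

Lemma cliff_mul1 : left_id cliff_one cliff_mul.
Proof.
by move=> [[d A] s]; rewrite /cliff_mul /= !add0r vact0 vinv0 vbeta0l !addr0 add0r mul1g.
Qed.

Lemma cliff_mulV : left_inverse cliff_one cliff_inv cliff_mul.
Proof.
move=> [[d A] s]; rewrite /cliff_mul /cliff_inv -vactM -peM mulVg pe1 vact1.
rewrite vaddxx; congr (_, _, _).
by apply: (F2_eq (z := d + vinv (pe h s) (vact A (pe h s^-1)) + vbeta A A)); ring.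
Qed.

HB.instance Definition _ := Finite_isGroup.Build (cliff h) cliff_mulA cliff_mul1 cliff_mulV.

Definition cl (d : 'F_2) (A : {ffun 'I_N -> 'F_2}) (s : 'S_n) : cliff h := (d, A, s).

Lemma clM d A s d' B t : (cl d A s * cl d' B t)%g
  = cl (d + d' + vinv (pe h t) A + vbeta (vact A (pe h t)) B) (vact A (pe h t) + B) (s * t)%g.
Proof. by []. Qed.

Lemma clP (g : cliff h) : exists d A s, g = cl d A s.
Proof. by case: g => [[d A] s]; exists d, A, s. Qed.

Definition cz : cliff h := cl 1 0 1.
Definition cV (A : {ffun 'I_N -> 'F_2}) : cliff h := cl 0 A 1.
Definition cX (x : 'I_N) : cliff h := cV (vdelta x).
Definition ciota (s : 'S_n) : cliff h := cl 0 0 s.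

Lemma czM d A s : (cz * cl d A s)%g = cl (1 + d) A s.
Proof. by rewrite clM vact0 vinv0 vbeta0l !addr0 add0r mul1g. Qed.

Lemma Mcz d A s : (cl d A s * cz)%g = cl (1 + d) A s.
Proof. by rewrite clM pe1 vact1 vinv1 vbeta0r !addr0 mulg1 addrC. Qed.

Lemma cz_central g : (cz * g = g * cz)%g.
Proof. by have [d [A [s ->]]] := clP g; rewrite czM Mcz. Qed.

Lemma czz : (cz * cz = 1)%g.
Proof. by rewrite czM F2_addxx. Qed.

Lemma ciotaM : {morph ciota : s t / (s * t)%g}.
Proof. by move=> s t; rewrite clM vact0 vinv0 vbeta0l !addr0. Qed.

Lemma ciota_cV s A : (ciota s * cV A)%g = cl 0 A s.
Proof. by rewrite clM pe1 vact1 vinv1 vbeta0l !addr0 add0r mulg1. Qed.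

Lemma cV_stable B d A s : vact B (pe h s) = B ->
  (cV B * cl d A s)%g
  = (cl (vinv (pe h s) B + vwt B * vwt A + vdot B A + d) A s * cV B)%g.
Proof.
move=> hB; rewrite !clM pe1 vact1 vinv1 hB mulg1 mul1g [B + A]addrC; congr cl.
have -> : vinv (pe h s) B + vwt B * vwt A + vdot B A + d
  = vinv (pe h s) B + d + (vbeta B A + vbeta A B) by rewrite vbetaC; ring.
by apply: (F2_eq (z := - vbeta A B)); ring.
Qed.

Lemma clJ d A s : ((cl d A 1) ^ ciota s = cl (d + vinv (pe h s) A) (vact A (pe h s)) 1)%g.
Proof.
apply: (mulgI (ciota s)); rewrite -conjgC !clM !vact0 !vinv0 !vbeta0l !vbeta0r.
by rewrite mulg1 mul1g !addr0 !add0r.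
Qed.

Lemma cXJ x s : (cX x ^ ciota s = cX (pe h s x))%g.
Proof. by rewrite clJ vinv_delta addr0 vact_delta. Qed.

Definition prodX (J : seq 'I_N) : cliff h := (\prod_(x <- J) cX x)%g.

Lemma prodX_cons x J : prodX (x :: J) = (cX x * prodX J)%g.
Proof. exact: big_cons. Qed.

Lemma prodX_rcons x J : prodX (rcons J x) = (prodX J * cX x)%g.
Proof. by rewrite /prodX -cats1 big_cat big_seq1. Qed.

Lemma prodXJ J s : (prodX J ^ ciota s = prodX (map (pe h s) J))%g.
Proof.
elim: J => [|x J IH]; first by rewrite /prodX !big_nil conj1g.
by rewrite /= !prodX_cons conjMg IH cXJ.
Qed.

Lemma prodXE J : exists d, prodX J = cl d (\sum_(x <- J) vdelta x) 1.
Proof.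
elim: J => [|x J [d e]]; first by exists 0; rewrite /prodX !big_nil.
eexists; rewrite prodX_cons e clM pe1 vact1 mulg1 big_cons; reflexivity.
Qed.

Lemma cX_comm x d A : (cX x * cl d A 1 = cl (vwt A + A x + d) A 1 * cX x)%g.
Proof. by rewrite cV_stable ?pe1 ?vact1 // vinv1 vwt_delta vdot_delta add0r mul1r. Qed.

(** Multiply the generators of a cycle in cyclic order: [s] rotates this product, and bringing the
    first generator back to the front costs one sign for each of the others. Thus the sign is found
    in the group, without counting inversions. *)
Lemma vinv_porbit_pe s x :
  vinv (pe h s) (vset (porbit (pe h s) x)) = #|porbit (pe h s) x|%:R + 1.
Proof.
set t := pe h s; set C := porbit t x; set m := #|C|.
have m_gt0 : (0 < m)%N by apply/card_gt0P; exists x; apply: porbit_id.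
have um : uniq (traject t x m) by apply: uniq_traject_porbit.
have sumE : \sum_(y <- traject t x m) vdelta y = vset C.
  apply/ffunP => y; rewrite sum_ffunE ffunE [y \in C]porbit_traject -/m.
  rewrite big_uniq //=; have [hy|hy] := boolP (y \in traject t x m).
    rewrite (bigD1 y) //= big1 ?addr0 ?ffunE ?eqxx // => z /andP[_].
    by rewrite ffunE eq_sym => /negPf ->.
  rewrite big1 // => z hz; rewrite ffunE; case: eqP => // e; by rewrite e hz in hy.
have [d dE] := prodXE (traject t x m); rewrite sumE in dE.
have rotE : map t (traject t x m) = rcons (behead (traject t x m)) x.
  have -> : map t (traject t x m) = traject t (t x) m.
    by elim: (m) (x) => //= k IH z; rewrite IH.
  have [m' em] : exists m', m = m'.+1 by exists m.-1; rewrite prednK.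
  by rewrite em trajectSr -iterSr; congr (rcons _ _); rewrite -em iter_porbit.
have trE : traject t x m = x :: behead (traject t x m) by rewrite -(prednK m_gt0).
have := prodXJ (traject t x m) s; rewrite dE clJ -/t rotE => e.
have : (cX x * prodX (rcons (behead (traject t x m)) x) = prodX (traject t x m) * cX x)%g.
  by rewrite prodX_rcons mulgA -prodX_cons -trE.
rewrite -e dE cX_comm => /mulIg; case=> e2 _.
have aE : vact (vset C) t = vset C by rewrite vact_set imset_porbit.
move: e2; rewrite aE vwt_set ffunE porbit_id => e2.
have -> : vinv t (vset C)
  = (#|C|%:R + true%:R + (d + vinv t (vset C))) - d - (#|C|%:R + true%:R) by ring.
by rewrite e2 subrr sub0r F2_opp.
Qed.
End CliffGroup.

Definition perm_emb_id n : perm_emb n n.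
Proof.
apply: (@PermEmb n n id id) => // s y; case/codomP; by exists y.
Defined.

Lemma vinv_porbit N (t : 'S_N) x : vinv t (vset (porbit t x)) = #|porbit t x|%:R + 1.
Proof. exact: (vinv_porbit_pe (perm_emb_id N)). Qed.


(** * Vanishing of class functions that change sign under the central involution *)

Section Spin.
Variables (n N : nat) (h : perm_emb n N).
Notation V := {ffun 'I_N -> 'F_2}.
Notation cl := (@cl n N h).

Lemma vact_fix (A : V) (t : 'S_N) : (forall x, A x != 0 -> t x = x) -> vact A t = A.
Proof.
move=> fx; apply/ffunP => x; rewrite ffunE.
have [Ax|Ax] := eqVneq (A x) 0; last by rewrite -{1}(fx x Ax) permK.
have [->|By] := eqVneq (A (t^-1%g x)) 0; first by rewrite Ax.
by have := fx _ By; rewrite permKV => e; move: By; rewrite -e Ax eqxx.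
Qed.

Lemma vinv_fix (A : V) (t : 'S_N) : (forall x, A x != 0 -> t x = x) -> vinv t A = 0.
Proof.
move=> fx; rewrite /vinv big1 // => x _; rewrite big1 // => y _.
have [->|Ax] := eqVneq (A x) 0; first by rewrite mul0r mulr0.
have [->|Ay] := eqVneq (A y) 0; first by rewrite !mulr0.
by rewrite !fx //; case: ltngtP => _ /=; rewrite mul0r.
Qed.

Variable W : cliff h -> algC.
Hypothesis WJ : forall g k, W (g ^ k)%g = W g.
Hypothesis Wz : forall g, W (cz h * g)%g = - W g.

Lemma WzE d A s : W (cl d A s) = F2sg d * W (cl 0 A s).
Proof.
case: (F2_cases d) => ->; first by rewrite F2sg0 mul1r.
by rewrite F2sg1 mulN1r -Wz czM addr0.
Qed.

Lemma spin_conj_opp g k : (k * g = cz h * (g * k))%g -> W g = 0.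
Proof.
move=> e; apply/eqP; have := WJ g k^-1%g.
by rewrite conjgE invgK mulgA e -!mulgA mulgV mulg1 Wz => /eqP; rewrite eq_sym -addr_eq0 -mulr2n mulrn_eq0.
Qed.

Lemma spin_stable0 B d A s : vact B (pe h s) = B ->
  vinv (pe h s) B + vwt B * vwt A + vdot B A = 1 -> W (cl d A s) = 0.
Proof.
move=> hB e; apply: (@spin_conj_opp _ (cV h B)); rewrite cV_stable // e.
by rewrite mulgA czM.
Qed.

(** If [B] meets [A] evenly, e_B conjugates the element to its negative. Otherwise the parts of [A]
    inside and outside [B] both have odd size. Splitting [s] along the support of [B] writes the
    element as a product of two odd factors on disjoint points; these anticommute, yet their
    products in the two orders are conjugate. *)
Lemma spin_split0 B d A s : vact B (pe h s) = B -> vinv (pe h s) B = 1 ->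
  vwt A = 0 -> W (cl d A s) = 0.
Proof.
move=> hB iB wA; case: (F2_cases (vdot B A)) => dBA.
  by apply: spin_stable0 hB _; rewrite iB wA dBA mulr0 !addr0.
pose SB := [set x | B (pt h x) != 0].
have sSB : s \in 'N(SB | 'P)%g.
  apply/astabsP => x; rewrite !inE /= apermE -pe_pt.
  by have := congr1 (fun f : V => f (pe h s (pt h x))) hB; rewrite ffunE permK => ->.
pose sB := restr_perm SB s; pose sB' := (sB^-1 * s)%g.
have sB_in x : x \in SB -> sB x = s x by apply: restr_permE.
have sB_out x : x \notin SB -> sB x = x by apply: out_perm; apply: restr_perm_on.
have pB x : B x != 0 -> pe h sB x = pe h s x.
  have [/codomP[y ->]|nx] := boolP (x \in codom (pt h)).
    by move=> By; rewrite !pe_pt sB_in // inE.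
  by rewrite !pe_out.
have pnB x : B x = 0 -> pe h sB x = x.
  have [/codomP[y ->]|nx] := boolP (x \in codom (pt h)).
    by move=> By; rewrite !pe_pt sB_out // inE By eqxx.
  by rewrite !pe_out.
have Bs x : B (pe h s x) = B x.
  by have := congr1 (fun f : V => f (pe h s x)) hB; rewrite ffunE permK => ->.
have pB' x : B x != 0 -> pe h sB' x = x.
  move=> Bx; rewrite peM permM peV.
  have : pe h s (pe h s^-1 x) = x by rewrite peV permKV.
  move=> e; have : pe h sB (pe h s^-1 x) = x by rewrite pB // -Bs e.
  by move=> e'; rewrite -[in X in pe h s X]e' permK e.
pose A1 : V := [ffun x => A x * B x]; pose A2 := A + A1.
have wA1 : vwt A1 = 1.
  by rewrite -dBA vdotC; apply: eq_bigr => x _; rewrite ffunE.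
have wA2 : vwt A2 = 1 by rewrite vwtD wA wA1 add0r.
have dA : vdot A1 A2 = 0.
  rewrite /vdot big1 // => x _; rewrite !ffunE.
  by case: (F2_cases (B x)) => ->; rewrite ?mulr0 ?mul0r // !mulr1 F2_addxx mulr0.
have f1 x : A1 x != 0 -> pe h sB' x = x.
  by rewrite ffunE => ne; apply: pB'; apply: contraNneq ne => ->; rewrite mulr0.
have f2 x : A2 x != 0 -> pe h sB x = x.
  rewrite !ffunE => ne; apply: pnB; case: (F2_cases (B x)) => // e.
  by rewrite e mulr1 F2_addxx eqxx in ne.
have ssB : (sB * sB' = s)%g by rewrite mulgA mulgV mul1g.
have ssB' : (sB' * sB = s)%g.
  apply: (@perm_emb_inj _ _ h); rewrite peM; apply/permP => x; rewrite permM.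
  have [Bx|Bx] := eqVneq (B x) 0; last by rewrite pB' // pB.
  have -> : pe h sB' x = pe h s x by rewrite peM permM peV -{1}(pnB x Bx) permK.
  by rewrite pnB // Bs.
have A12 : A1 + A2 = A by rewrite addrC -addrA vaddxx addr0.
have yv : (cl 0 A1 sB * cl 0 A2 sB')%g = cl (vbeta A1 A2) A s.
  by rewrite clM vinv_fix // vact_fix // ssB A12 !addr0 add0r.
have vy : (cl 0 A2 sB' * cl 0 A1 sB)%g = cl (1 + vbeta A1 A2) A s.
  rewrite clM vinv_fix // vact_fix // ssB' [A2 + _]addrC A12 !addr0 add0r.
  have := vbetaC A1 A2; rewrite wA1 wA2 dA mulr1 addr0 => <-.
  by rewrite addrAC F2_addxx add0r.
rewrite WzE; suff : W (cl (vbeta A1 A2) A s) = 0.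
  rewrite WzE => /eqP; rewrite mulf_eq0 signr_eq0 /= => /eqP ->; exact: mulr0.
rewrite -yv; apply: (@spin_conj_opp _ (cl 0 A1 sB)^-1%g).
by apply: (mulIg (cl 0 A1 sB)); rewrite mulKg vy -!mulgA mulVg mulg1 yv czM.
Qed.
End Spin.

(** * Forms as sums over integer matrices *)

Definition ffcons (T : Type) m (t : T) (f : {ffun 'I_m -> T}) : {ffun 'I_m.+1 -> T} :=
  [ffun i => if unlift ord0 i is Some j then f j else t].

Lemma ffcons0 (T : Type) m (t : T) (f : {ffun 'I_m -> T}) : ffcons t f ord0 = t.
Proof. by rewrite ffunE unlift_none. Qed.

Lemma ffconsS (T : Type) m (t : T) (f : {ffun 'I_m -> T}) j : ffcons t f (lift ord0 j) = f j.
Proof. by rewrite ffunE liftK. Qed.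

Lemma big_ffun_ordS (R : nmodType) (T : finType) m (F : {ffun 'I_m.+1 -> T} -> R) :
  \sum_f F f = \sum_t \sum_f F (ffcons t f).
Proof.
rewrite pair_big (reindex (fun p : T * {ffun 'I_m -> T} => ffcons p.1 p.2)) //=.
exists (fun f : {ffun 'I_m.+1 -> T} => (f ord0, [ffun j => f (lift ord0 j)])) => [[t f] _|f _] /=.
  by rewrite ffcons0; congr pair; apply/ffunP => j; rewrite ffunE ffconsS.
apply/ffunP => i; case: (unliftP ord0 i) => [j|] ->; first by rewrite ffconsS ffunE.
by rewrite ffcons0.
Qed.

Lemma codom_ordS (T : Type) m (f : 'I_m.+1 -> T) :
  codom f = f ord0 :: codom (fun j => f (lift ord0 j)).
Proof. by rewrite !codomE enum_ordSl /= -map_comp. Qed.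

Lemma codom_ord0 (T : Type) (f : 'I_0 -> T) : codom f = [::].
Proof. by apply: size0nil; rewrite size_codom card_ord. Qed.

Lemma subw_codom m (z l : 'I_m -> nat) :
  subw (codom z) (codom l) = codom (fun j => z j - l j)%N.
Proof.
elim: m z l => [|m IH] z l; first by rewrite !codom_ord0.
by rewrite !codom_ordS /= IH.
Qed.

Lemma sumn_codom m (l : 'I_m -> nat) : sumn (codom l) = (\sum_j l j)%N.
Proof. by rewrite sumnE big_map enumT. Qed.

Lemma kapw_codom (R : comNzRingType) (kap : nat -> R) m (l : 'I_m -> nat) :
  kapw kap (codom l) = \prod_j kap (l j).
Proof. by rewrite /kapw big_map enumT. Qed.

Lemma big_box_ffun (R : nmodType) D m (z : 'I_m -> nat) (F : seq nat -> R) :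
  (forall j, z j < D)%N ->
  \sum_(l <- box (codom z)) F l
  = \sum_(l : {ffun 'I_m -> 'I_D} | [forall j, (l j <= z j)%N]) F (codom (fun j => l j : nat)).
Proof.
elim: m z F => [|m IH] z F hz.
  rewrite codom_ord0 box_nil (big_pred1 [ffun j => False_rect _ (notF (valP j))]).
    by rewrite codom_ord0.
  by move=> l; apply/forallP/eqP => [_|_ []//]; apply/ffunP => -[].
rewrite codom_ordS box_cons [RHS]big_mkcond big_ffun_ordS.
under eq_bigr => i _ do rewrite (IH _ (fun l => F (val i :: l)) (fun j => hz _)).
transitivity (\sum_(t < D | (t < (z ord0).+1)%N)
   \sum_(l : {ffun 'I_m -> 'I_D} | [forall j, (l j <= z (lift ord0 j))%N])
      F ((t : nat) :: codom (fun j => l j : nat))).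
  by rewrite (big_ord_widen _ (fun i : nat => \sum_(l : {ffun 'I_m -> 'I_D} | [forall j, (l j <= z (lift ord0 j))%N])
      F (i :: codom (fun j => l j : nat))) (hz ord0)).
rewrite big_mkcond; apply: eq_bigr => t _.
case: ifP => ht; last first.
  rewrite big1 // => f _; case: ifP => // /forallP/(_ ord0).
  by rewrite ffcons0 -ltnS ht.
rewrite big_mkcond; apply: eq_bigr => f _.
have -> : [forall j, (ffcons t f j <= z j)%N] = [forall j, (f j <= z (lift ord0 j))%N].
  apply/forallP/forallP => h j; first by have := h (lift ord0 j); rewrite ffconsS.
  by case: (unliftP ord0 j) => [j'|] ->; rewrite ?ffconsS ?ffcons0.
case: ifP => // _; rewrite codom_ordS ffcons0; congr (F (_ :: _)).
by apply: eq_codom => j; rewrite ffconsS.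
Qed.

Section Matrices.
Variables (R : comNzRingType) (kap : nat -> R) (D : nat).

(** The bound [D] on the entries only keeps the type of matrices finite. *)
Definition mat_sum b m (nu : 'I_b -> nat) (z : 'I_m -> nat) : R :=
  \sum_(M : {ffun 'I_b -> {ffun 'I_m -> 'I_D}} |
      [forall i, (\sum_j M i j == nu i)%N] && [forall j, (\sum_i M i j == z j)%N])
    \prod_i \prod_j kap (M i j).

Lemma mat_sumE b m (nu : 'I_b -> nat) (z : 'I_m -> nat) : (forall j, z j < D)%N ->
  mat_sum nu z = wform kap (codom nu) (codom z).
Proof.
elim: b nu z => [|b IH] nu z hz; rewrite /mat_sum.
  rewrite codom_ord0 /= sumn_codom (eq_bigl (fun _ => (\sum_j z j == 0)%N)); last first.
    move=> M; apply/andP/eqP => [[_ /forallP h]|h].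
      by rewrite big1 // => j _; have := h j; rewrite big_ord0 => /eqP.
    split; apply/forallP => -[] //= j hj; rewrite big_ord0 eq_sym.
    by move/eqP: h; rewrite sum_nat_eq0 => /forallP/(_ (Ordinal hj)).
  case: eqP => _; last by rewrite big_pred0.
  have -> : true%:R = \sum_(M : {ffun 'I_0 -> {ffun 'I_m -> 'I_D}}) 1 :> R.
    by rewrite sumr_const card_ffun card_ord expn0.
  by apply: eq_bigr => M _; rewrite big_ord0.
rewrite codom_ordS [RHS]/= [LHS]big_mkcond big_ffun_ordS [RHS]big_mkcond (big_box_ffun _ hz).
rewrite [RHS]big_mkcond; apply: eq_bigr => l _; rewrite sumn_codom.
case: (boolP [forall j, (l j <= z j)%N]) => hl; last first.
  rewrite big1 // => M _; case: ifP => // /andP[_ /forallP h]; case/negP: hl.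
  apply/forallP => j; have /eqP <- := h j; rewrite big_ord_recl ffcons0; exact: leq_addr.
case: ifP => hr; last first.
  rewrite big1 // => M _; case: ifP => // /andP[/forallP/(_ ord0)].
  by rewrite ffcons0 hr.
rewrite kapw_codom subw_codom -IH; last by move=> j; apply: leq_ltn_trans (hz j); apply: leq_subr.
rewrite /mat_sum mulr_sumr [RHS]big_mkcond; apply: eq_bigr => M _.
have -> : [forall i, (\sum_j ffcons l M i j == nu i)%N]
        = [forall i, (\sum_j M i j == nu (lift ord0 i))%N].
  apply/forallP/forallP => h i; first by have := h (lift ord0 i); rewrite ffconsS.
  by case: (unliftP ord0 i) => [i'|] ->; rewrite ?ffconsS ?ffcons0.
have -> : [forall j, (\sum_i ffcons l M i j == z j)%N]
        = [forall j, (\sum_i M i j == z j - l j)%N].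
  apply: eq_forallb => j; rewrite big_ord_recl ffcons0.
  rewrite (eq_bigr (fun i => M i j : nat)) => [|i _]; last by rewrite ffconsS.
  move/forallP: hl => /(_ j); move: (\sum_(i < b) _)%N => S hj.
  by apply/eqP/eqP; lia.
case: ifP => // _; rewrite big_ord_recl ffcons0; congr (_ * _).
by apply: eq_bigr => i _; rewrite ffconsS.
Qed.

End Matrices.

(** * Colourings and permutation characters *)

Section Colourings.
Variables (n : nat) (K : finType).
Implicit Types (f g : {ffun 'I_n -> K}) (s t : 'S_n).

Definition cstab f : {set 'S_n} := [set t : 'S_n | [forall x, f (t x) == f x]].
Definition cnt f (k : K) : nat := #|[set x | f x == k]|.
Definition content f : {ffun K -> 'I_n.+1} := [ffun k => inord (cnt f k)].

Lemma cstabP f s : reflect (forall x, f (s x) = f x) (s \in cstab f).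
Proof. by rewrite inE; apply: (iffP forallP) => h x; apply/eqP. Qed.

Lemma cnt_le f k : (cnt f k < n.+1)%N.
Proof. by rewrite ltnS -[X in (_ <= X)%N](card_ord n) max_card. Qed.

Lemma contentE f k : content f k = cnt f k :> nat.
Proof. by rewrite ffunE inordK // cnt_le. Qed.

Lemma sum_cnt f : (\sum_k cnt f k = n)%N.
Proof.
rewrite -[RHS]card_ord -sum1_card (partition_big f xpredT) //=.
by apply: eq_bigr => k _; rewrite /cnt -sum1dep_card.
Qed.

Lemma cnt_transport f g : (forall k, cnt f k = cnt g k) ->
  exists p : 'S_n, forall x, f x = g (p x).
Proof.
move=> e; apply: perm_eq_perm; apply/allP => k _ /=; apply/eqP; rewrite !count_map.
have c (u : {ffun 'I_n -> K}) : count (fun x => u x == k) (Finite.enum 'I_n) = cnt u k.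
  by rewrite /cnt cardsE cardE -size_filter.
exact: etrans (c f) (etrans (e k) (esym (c g))).
Qed.

Lemma cnt_perm f (p : 'S_n) k : cnt [ffun x => f (p x)] k = cnt f k.
Proof.
rewrite /cnt -[RHS](card_imset _ (@perm_inj _ p^-1)); apply: eq_card => x.
rewrite !inE ffunE; apply/idP/imsetP => [h|[y + ->]]; last by rewrite inE permKV.
by exists (p x); rewrite ?inE // permK.
Qed.

Lemma card_fibre f g (y0 : 'S_n) : (forall x, g (y0 x) = f x) ->
  #|[set y : 'S_n | [forall x, g (y x) == f x]]| = #|cstab f|.
Proof.
move=> h0; rewrite -[RHS](card_imset _ (mulIg y0)); apply: eq_card => y.
rewrite inE; apply/forallP/imsetP => [h|[t /cstabP ht ->] x]; last by rewrite permM h0 ht.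
exists (y * y0^-1)%g; last by rewrite mulgKV.
by apply/cstabP => x; rewrite permM -h0 permKV (eqP (h x)).
Qed.

(** Permuting [g] reaches every colouring with the same content, each as often as its stabilizer has
    elements. *)
Lemma sum_cstab g : \sum_(f | [forall k, cnt f k == cnt g k]) #|cstab f| = n`!.
Proof.
rewrite -[RHS]card_Sn -sum1_card.
rewrite (partition_big (fun y : 'S_n => [ffun x => g (y x)]) (fun f => [forall k, cnt f k == cnt g k])) /=.
  apply: eq_bigr => f /forallP h; have [y0 e] := cnt_transport (fun k => eqP (h k)).
  rewrite -(card_fibre (g := g) (f := f) (fun x => esym (e x))) -sum1dep_card.
  apply: eq_bigl => y; rewrite ?inE /=.
  apply/forallP/eqP => [e'|<- x]; last by rewrite ffunE.
  by apply/ffunP => x; rewrite ffunE (eqP (e' x)).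
by move=> y _; apply/forallP => k; rewrite cnt_perm.
Qed.

Lemma cnt_exists (w : K -> nat) : (\sum_k w k = n)%N -> exists g, forall k, cnt g k = w k.
Proof.
move=> sw; pose z := [seq w k | k <- enum K].
have sz : sumn z = n by rewrite sumnE big_map big_enum.
have lt (x : 'I_n) : (reshape_index z x < #|K|)%N.
  have := @reshape_indexP z x; rewrite size_map -cardE; apply.
  by rewrite sz.
exists [ffun x => enum_val (Ordinal (lt x))] => k.
have := card_reshape_index sz (enum_rank k).
rewrite (nth_map k) -?cardE ?ltn_ord // nth_enum_rank => <-.
apply: eq_card => x; rewrite !inE ffunE; apply/eqP/eqP => [<-|e]; first by rewrite enum_valK.
by rewrite -[RHS]enum_rankK; congr enum_val; apply: val_inj.
Qed.

(** Weighted by its stabilizer, each content has the same total weight n!, so a sum over colourings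
    becomes a sum over contents. *)
Lemma sum_content (R : comNzRingType) (F : {ffun K -> 'I_n.+1} -> R) :
  \sum_f F (content f) * #|cstab f|%:R
  = n`!%:R * \sum_(w : {ffun K -> 'I_n.+1} | (\sum_k w k == n)%N) F w.
Proof.
rewrite (partition_big content (fun w => (\sum_k w k == n)%N)) /=; last first.
  by move=> f _; under eq_bigr do rewrite contentE; rewrite sum_cnt.
rewrite mulr_sumr; apply: eq_bigr => w /eqP sw; have [g eg] := cnt_exists sw.
transitivity (\sum_(f | content f == w) F w * #|cstab f|%:R); first by apply: eq_bigr => f /eqP ->.
rewrite -mulr_sumr -natr_sum mulrC; congr (_%:R * _).
rewrite -(sum_cstab g); apply: eq_bigl => f.
apply/eqP/forallP => [e k|h]; first by rewrite eg -e contentE.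
by apply/ffunP => k; apply: val_inj; rewrite /= contentE (eqP (h k)) eg.
Qed.

End Colourings.

Definition vstab n (B : {ffun 'I_n -> 'F_2}) (s : 'S_n) : bool := vact B s == B.

Lemma vstabP n (B : {ffun 'I_n -> 'F_2}) (s : 'S_n) :
  reflect (forall x, B (s x) = B x) (vstab B s).
Proof.
apply: (iffP eqP) => [e x|h]; last by apply/ffunP => x; rewrite ffunE -[in RHS](permKV s x) h.
by have := congr1 (fun f : {ffun 'I_n -> 'F_2} => f (s x)) e; rewrite ffunE permK => ->.
Qed.

(* Character of S_n on the Clifford algebra on n generators. *)
Definition kappa n (s : 'S_n) : algC := \sum_(B | vstab B s) F2sg (vinv s B).

(** * The Clifford character on Young subgroups *)

Section KappaStab.
Variables (n : nat) (K : finType) (p : {ffun 'I_n -> K}).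
Notation V := {ffun 'I_n -> 'F_2}.
Implicit Types (B : V) (T : {set K}).

Let inj B := [forall x, forall y, (B x != 0) && (B y != 0) && (p x == p y) ==> (x == y)].
Let pB B : {ffun 'I_n -> K * 'F_2} := [ffun x => (p x, B x)].

Let injP B : reflect (forall x y, B x != 0 -> B y != 0 -> p x = p y -> x = y) (inj B).
Proof.
apply: (iffP forallP) => [h x y Bx By e|h x].
  by have /forallP/(_ y) := h x; rewrite Bx By e eqxx => /eqP.
by apply/forallP => y; apply/implyP => /andP[/andP[Bx By] /eqP e]; apply/eqP; apply: h.
Qed.

Lemma vinv_tperm (B : V) x y : x != y -> B x != 0 -> B y != 0 -> vinv (tperm x y) B = 1.
Proof.
move=> ne Bx By; pose C : V := vdelta x + vdelta y.
have {}Bx : B x = 1 by case: (F2_cases (B x)) Bx => -> //.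
have {}By : B y = 1 by case: (F2_cases (B y)) By => -> //.
have fixD z : (B + C) z != 0 -> tperm x y z = z.
  rewrite !ffunE; have [->|nx] := eqVneq z x.
    by rewrite Bx (negPf ne) addr0 F2_addxx eqxx.
  have [->|ny _] := eqVneq z y; first by rewrite By add0r F2_addxx eqxx.
  by rewrite tpermD // eq_sym.
have -> : B = (B + C) + C by rewrite -addrA vaddxx addr0.
have sC : vact C (tperm x y) = C by rewrite vactD !vact_delta tpermL tpermR addrC.
rewrite (vinv_stableD (vact_fix fixD) sC) (vinv_fix fixD) add0r /C vinvD !vinv_delta !vact_delta tpermL tpermR.
rewrite !add0r vbetaC !vwt_delta vdot_delta ffunE eq_sym (negPf ne) mulr1 addr0 //.
Qed.

(** If [B] contains two points of one colour, their transposition has sign -1 on [B] and cancels the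
    sum. Otherwise the permutations concerned fix [B] pointwise and every sign is 1. *)
Lemma sum_sg_stab B :
  \sum_(s in cstab p | vstab B s) F2sg (vinv s B) = if inj B then #|cstab (pB B)|%:R else 0.
Proof.
case: (boolP (inj B)) => [/injP iB|].
  rewrite -sum1_card natr_sum; apply: eq_big => s; last first.
    move=> /andP[/cstabP ps /vstabP Bs]; rewrite vinv_fix ?F2sg0 // => x Bx.
    by apply: iB; rewrite ?Bs ?ps.
  apply/andP/cstabP => [[/cstabP ps /vstabP Bs] x|h]; first by rewrite !ffunE ps Bs.
  by split; [apply/cstabP => x | apply/vstabP => x]; have := h x; rewrite !ffunE => -[].
rewrite negb_forall => /existsP[x]; rewrite negb_forall => /existsP[y].
rewrite negb_imply => /andP[/andP[/andP[Bx By] /eqP e] ne].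
set S := \sum_(s in _ | _) _.
have Bt : vact B (tperm x y) = B.
  apply/eqP/vstabP => z; case: tpermP => // ->.
    by case: (F2_cases (B x)) Bx => -> //; case: (F2_cases (B y)) By => -> //.
  by case: (F2_cases (B x)) Bx => -> //; case: (F2_cases (B y)) By => -> //.
suff: S = - S by move/eqP; rewrite -addr_eq0 -mulr2n mulrn_eq0 /= => /eqP.
rewrite {1}/S (reindex_inj (mulgI (tperm x y))) -sumrN /=.
apply: eq_big => [s|s _]; last by rewrite vinvM Bt vinv_tperm // F2sgD F2sg1 mulN1r.
congr (_ && _); last by rewrite /vstab vactM Bt.
apply/cstabP/cstabP => h z; have := h (tperm x y z); rewrite ?permM ?tpermK => ->;
  by case: tpermP => // ->.
Qed.

Let NE : {set K} := [set k | cnt p k != 0%N].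
Let im B : {set K} := [set p x | x in [set x | B x != 0]].

Let im_inj_cnt B k e : inj B ->
  cnt (pB B) (k, e) = if e == 1 then (k \in im B) : nat else (cnt p k - (k \in im B))%N.
Proof.
move=> /injP iB.
have c1 : #|[set x | (B x != 0) && (p x == k)]| = (k \in im B).
  case: imsetP => [[x]|no]; last first.
    apply/eqP; rewrite cards_eq0; apply/eqP/setP => x; rewrite !inE; apply/negP.
    by move=> /andP[Bx /eqP e']; apply: no; exists x; rewrite ?inE.
  rewrite inE => Bx ->; apply/eqP/cards1P; exists x; apply/setP => y; rewrite !inE.
  apply/andP/eqP => [[By /eqP e']|->]; last by rewrite Bx eqxx.
  exact: iB.
have -> : cnt p k = (#|[set x | (B x != 0%R) && (p x == k)]| + #|[set x | (B x == 0%R) && (p x == k)]|)%N.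
  rewrite /cnt -(cardsID [set x | B x != 0]).
  by congr (_ + _)%N; apply: eq_card => x; rewrite !inE ?negbK andbC.
rewrite c1 addKn; case: (F2_cases e) => -> /=.
  by apply: eq_card => x; rewrite !inE ffunE xpair_eqE andbC.
rewrite -c1; apply: eq_card => x; rewrite !inE ffunE xpair_eqE andbC.
by case: (F2_cases (B x)) => ->.
Qed.

(** Up to the stabilizer of [p], such a [B] is determined by the set [T] of colours it meets, which
    can be any set of colours in use; by orbit counting each [T] contributes [#|cstab p|]. *)
Lemma sum_cstab_inj : (\sum_(B | inj B) #|cstab (pB B)| = #|cstab p| * 2 ^ #|NE|)%N.
Proof.
rewrite (partition_big im (fun T => T \in powerset NE)) /=; last first.
  move=> B _; rewrite inE; apply/subsetP => k /imsetP[x _ ->].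
  by rewrite inE -lt0n; apply/card_gt0P; exists x; rewrite inE.
rewrite (eq_bigr (fun=> #|cstab p|)); last first.
  move=> T; rewrite inE => /subsetP sT.
  have [B0 iB0 imB0] : exists2 B0, inj B0 & im B0 = T.
    have pk k : k \in T -> exists x, p x = k.
      by move=> /sT; rewrite inE -lt0n => /card_gt0P[x]; rewrite inE => /eqP; exists x.
    pose r k := [pick x | p x == k].
    pose B0 : V := [ffun x => ((p x \in T) && (r (p x) == Some x))%:R].
    have B0P x : B0 x != 0 -> p x \in T /\ r (p x) = Some x.
      rewrite ffunE; case: (boolP ((p x \in T) && _)) => [/andP[h /eqP h']|_]; first by [].
      by rewrite mulr0n eqxx.
    exists B0.
      apply/injP => x y /B0P[_ e1] /B0P[_ e2] e.
      by move: e1; rewrite e e2 => -[].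
    apply/setP => k; apply/imsetP/idP => [[x]|kT].
      by rewrite inE => /B0P[h _] ->.
    have [x rx ex] : exists2 x, r k = Some x & p x = k.
      have [x0 e0] := pk k kT; rewrite /r.
      by case: pickP => [x /eqP ex|/(_ x0)]; [exists x | rewrite e0 eqxx].
    by exists x; rewrite // inE ffunE ex kT rx eqxx.
have c0 B : inj B -> im B = T -> exists y : 'S_n, forall x, (pB B) x = (pB B0) (y x).
  move=> iB imB; apply: cnt_transport => -[k e].
  by rewrite !im_inj_cnt // imB imB0.
rewrite -[RHS]sum1_card (partition_big (fun y : 'S_n => [ffun x => B0 (y x)])
   (fun B => inj B && (im B == T))) /=.
  apply: eq_bigr => B /andP[iB /eqP imB]; have [y0 e0] := c0 B iB imB.
  rewrite -(card_fibre (g := pB B0) (f := pB B) (fun x => esym (e0 x))) -sum1dep_card.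
  apply: eq_bigl => y; apply/forallP/andP => [h|[/cstabP h /eqP <-] x]; last by rewrite !ffunE h.
  split; first by apply/cstabP => x; have := eqP (h x); rewrite !ffunE => -[].
  by apply/eqP/ffunP => x; have := eqP (h x); rewrite !ffunE => -[].
move=> y /cstabP py; apply/andP; split.
  apply/injP => x x'; rewrite !ffunE => Bx Bx' e; apply: (@perm_inj _ y).
  by move/injP: iB0; apply=> //; rewrite !py.
rewrite -imB0; apply/eqP/setP => k; apply/imsetP/imsetP => -[x]; rewrite inE.
  by rewrite ffunE => Bx ->; exists (y x); rewrite ?inE ?py.
by move=> Bx ->; exists (y^-1%g x); rewrite ?inE ?ffunE ?permKV // -[RHS]py permKV.
rewrite sum_nat_const card_powerset mulnC //.
Qed.

(** A nonempty colour class contributes 1 + 1: its part of [B] is either empty or a single point. *)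
Lemma sum_kappa_stab :
  \sum_(s in cstab p) kappa s = #|cstab p|%:R * \prod_k kap2 _ (cnt p k).
Proof.
rewrite /kappa (exchange_big_dep xpredT) //=.
transitivity (\sum_(B | inj B) (#|cstab (pB B)|%:R : algC)).
  by rewrite [RHS]big_mkcond; apply: eq_bigr => B _; rewrite -sum_sg_stab.
rewrite -natr_sum sum_cstab_inj natrM natrX; congr (_ * _).
rewrite -prodr_const [LHS]big_mkcond; apply: eq_bigr => k _.
by rewrite inE /kap2; case: eqP.
Qed.

End KappaStab.

Section PermChar.
Variable n : nat.
Implicit Types (z nu : seq nat) (s t : 'S_n).

Definition wcol (K : finType) (w : K -> nat) (f : {ffun 'I_n -> K}) : bool :=
  [forall k, cnt f k == w k].

Definition kpi (K : finType) (w : K -> nat) s : nat :=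
  #|[set f : {ffun 'I_n -> K} | wcol w f && (s \in cstab f)]|.

(* The permutation character of S_n on the cosets of the Young subgroup S_z. *)
Definition npi z s : nat := kpi (fun i : 'I_(size z) => nth 0%N z i) s.

Lemma kpiE (R : pzRingType) (K : finType) (w : K -> nat) s :
  (kpi w s)%:R = \sum_(f : {ffun 'I_n -> K} | wcol w f) (s \in cstab f)%:R :> R.
Proof.
rewrite /kpi -sum1_card natr_sum big_mkcond [RHS]big_mkcond; apply: eq_bigr => f _.
by rewrite inE; case: (wcol w f); case: (s \in _).
Qed.

Lemma cnt_fst (K1 K2 : finType) (p : {ffun 'I_n -> K1 * K2}) i :
  cnt [ffun x => (p x).1] i = (\sum_j cnt p (i, j))%N.
Proof.
rewrite /cnt -sum1dep_card (partition_big (fun x => (p x).2) xpredT) //=.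
apply: eq_bigr => j _; rewrite -sum1dep_card; apply: eq_bigl => x.
by rewrite ffunE; case: (p x) => a b; rewrite xpair_eqE.
Qed.

Lemma cnt_snd (K1 K2 : finType) (p : {ffun 'I_n -> K1 * K2}) j :
  cnt [ffun x => (p x).2] j = (\sum_i cnt p (i, j))%N.
Proof.
rewrite /cnt -sum1dep_card (partition_big (fun x => (p x).1) xpredT) //=.
apply: eq_bigr => i _; rewrite -sum1dep_card; apply: eq_bigl => x.
by rewrite ffunE; case: (p x) => a b; rewrite xpair_eqE andbC.
Qed.

(** Two colourings fixed by [s] amount to one colouring by pairs of colours fixed by [s]. *)
Lemma sum_kpi2 (R : comNzRingType) (kg : 'S_n -> R) (K1 K2 : finType)
    (w1 : K1 -> nat) (w2 : K2 -> nat) :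
  \sum_s kg s * (kpi w1 s)%:R * (kpi w2 s)%:R
  = \sum_(p : {ffun 'I_n -> K1 * K2} |
       [forall i, (\sum_j cnt p (i, j) == w1 i)%N] && [forall j, (\sum_i cnt p (i, j) == w2 j)%N])
      \sum_(s in cstab p) kg s.
Proof.
rewrite (exchange_big_dep xpredT) //=; apply: eq_bigr => s _.
transitivity (\sum_(f : {ffun 'I_n -> K1} | wcol w1 f) \sum_(g : {ffun 'I_n -> K2} | wcol w2 g)
    kg s * ((s \in cstab f)%:R * (s \in cstab g)%:R)).
  rewrite -mulrA !kpiE mulr_suml mulr_sumr; apply: eq_bigr => f _.
  by rewrite !mulr_sumr.
rewrite pair_big /=.
rewrite (reindex (fun p : {ffun 'I_n -> K1 * K2} => ([ffun x => (p x).1], [ffun x => (p x).2]))) /=; last first.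
  exists (fun q : {ffun 'I_n -> K1} * {ffun 'I_n -> K2} => [ffun x => (q.1 x, q.2 x)]).
    by move=> p _; apply/ffunP => x; rewrite !ffunE -surjective_pairing.
  by move=> [f g] _; congr (_, _); apply/ffunP => x; rewrite !ffunE.
rewrite big_mkcond [RHS]big_mkcond; apply: eq_bigr => p _.
have -> : wcol w1 [ffun x => (p x).1] = [forall i, (\sum_j cnt p (i, j) == w1 i)%N].
  by apply: eq_forallb => i; rewrite cnt_fst.
have -> : wcol w2 [ffun x => (p x).2] = [forall j, (\sum_i cnt p (i, j) == w2 j)%N].
  by apply: eq_forallb => i; rewrite cnt_snd.
case: (_ && _) => //=.
have -> : (s \in cstab p) = (s \in cstab [ffun x => (p x).1]) && (s \in cstab [ffun x => (p x).2]).
  apply/cstabP/andP => [h|[/cstabP h1 /cstabP h2] x].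
    by split; apply/cstabP => x; rewrite !ffunE h.
  by have := h1 x; have := h2 x; rewrite !ffunE; case: (p x) (p (s x)) => a b [c d] /= -> ->.
by do 2 case: (s \in _); rewrite ?mulr1 ?mulr0.
Qed.

(** The content of a colouring by pairs is an integer matrix whose margins are the two given
    contents; this is why Gram matrices of permutation characters are values of [wform]. *)
Lemma npi_gram (R : comNzRingType) (kg : 'S_n -> R) (kap : nat -> R) nu z :
  (forall (K : finType) (p : {ffun 'I_n -> K}),
     \sum_(s in cstab p) kg s = #|cstab p|%:R * \prod_k kap (cnt p k)) ->
  sumn nu = n -> sumn z = n ->
  \sum_s kg s * (npi nu s)%:R * (npi z s)%:R = n`!%:R * wform kap nu z.
Proof.
move=> hk snu sz; rewrite /npi sum_kpi2.
set b := size nu; set m := size z; pose K := ('I_b * 'I_m)%type.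
pose Q (w : K -> nat) := [forall i, (\sum_j w (i, j) == nth 0 nu i)%N]
   && [forall j, (\sum_i w (i, j) == nth 0 z j)%N].
pose F (w : {ffun K -> 'I_n.+1}) : R := if Q (fun k => w k) then \prod_k kap (w k) else 0.
transitivity (\sum_(p : {ffun 'I_n -> K}) F (content p) * #|cstab p|%:R).
  rewrite big_mkcond; apply: eq_bigr => p _; rewrite hk /F.
  have -> : Q (fun k => content p k) = Q (cnt p).
    by congr (_ && _); apply: eq_forallb => i; congr (_ == _); apply: eq_bigr => j _; rewrite contentE.
  rewrite -/(Q (cnt p)); case: ifP => _; last by rewrite mul0r.
  by rewrite mulrC; congr (_ * _); apply: eq_bigr => k _; rewrite contentE.
rewrite sum_content; congr (_ * _).
have nthE (y : seq nat) : codom (fun i : 'I_(size y) => nth 0%N y i) = y.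
  apply: (@eq_from_nth _ 0%N); first by rewrite size_codom card_ord.
  move=> i; rewrite size_codom card_ord => hi.
  by rewrite (nth_map (Ordinal hi)) -?enumT ?size_enum_ord // nth_enum_ord.
rewrite -[in RHS](nthE nu) -[in RHS](nthE z) -(mat_sumE kap (D := n.+1)); last first.
  move=> j; rewrite ltnS -sz sumnE (big_nth 0%N) big_mkord (bigD1 j) //=; exact: leq_addr.
rewrite /mat_sum (reindex (fun M : {ffun 'I_b -> {ffun 'I_m -> 'I_n.+1}} => [ffun k => M k.1 k.2])) /=; last first.
  exists (fun w : {ffun K -> 'I_n.+1} => [ffun i => [ffun j => w (i, j)]]).
    by move=> M _; apply/ffunP => i; apply/ffunP => j; rewrite !ffunE.
  by move=> w _; apply/ffunP => -[i j]; rewrite !ffunE.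
rewrite big_mkcond [RHS]big_mkcond; apply: eq_bigr => M _; rewrite /F.
have -> : Q (fun k => [ffun k => M k.1 k.2] k) = [forall i, (\sum_j M i j == nth 0 nu i)%N]
   && [forall j, (\sum_i M i j == nth 0 z j)%N].
  by congr (_ && _); apply: eq_forallb => i; congr (_ == _); apply: eq_bigr => j _; rewrite ffunE.
case: (boolP (_ && _)) => [/andP[/forallP h _]|_]; last by rewrite if_same.
rewrite ifT.
  rewrite pair_big /=; apply: eq_bigr => -[i j] _; by rewrite ffunE.
apply/eqP; transitivity (\sum_i \sum_j (M i j : nat))%N.
  by rewrite pair_big /=; apply: eq_bigr => -[i j] _; rewrite ffunE.
rewrite (eq_bigr (fun i : 'I_b => nth 0%N nu i)) => [|i _]; last exact/eqP.
by rewrite -[RHS]snu sumnE (big_nth 0%N) big_mkord.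
Qed.

Lemma npi_kappa nu z : sumn nu = n -> sumn z = n ->
  \sum_s kappa s * (npi nu s)%:R * (npi z s)%:R = n`!%:R * wform (kap2 _) nu z.
Proof. by apply: npi_gram => K p; apply: sum_kappa_stab. Qed.

Lemma npi_plain nu z : sumn nu = n -> sumn z = n ->
  \sum_s (npi nu s)%:R * (npi z s)%:R = n`!%:R * wform (fun=> 1) nu z :> algC.
Proof.
move=> h1 h2; rewrite -(@npi_gram algC (fun=> 1)) //; first by apply: eq_bigr => s _; rewrite mul1r.
by move=> K p; rewrite sumr_const prodr_const expr1n mulr1.
Qed.

End PermChar.

Lemma F2_natr m : m%:R = (odd m)%:R :> 'F_2.
Proof. by elim: m => // m IH; rewrite -natr1 IH /=; case: (odd m) => /=; rewrite ?F2_addxx ?add0r. Qed.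

Section NpiProps.
Variable n : nat.
Implicit Types (z nu w : seq nat) (s t : 'S_n).

Lemma kpi_inj (K K' : finType) (g : K -> K') (w : K -> nat) (w' : K' -> nat) s :
  injective g -> (forall i, w' (g i) = w i) -> (forall j, j \notin codom g -> w' j = 0%N) ->
  kpi w s = kpi w' s.
Proof.
move=> ig wg w0.
pose G (f : {ffun 'I_n -> K}) : {ffun 'I_n -> K'} := [ffun x => g (f x)].
have iG : injective G.
  by move=> f f' e; apply/ffunP => x; apply: ig; have := congr1 (fun u : {ffun 'I_n -> K'} => u x) e; rewrite !ffunE.
have cG f i : cnt (G f) (g i) = cnt f i.
  by apply: eq_card => x; rewrite !inE ffunE (inj_eq ig).
have cG0 f j : j \notin codom g -> cnt (G f) j = 0%N.
  move=> nj; apply/eqP; rewrite cards_eq0; apply/eqP/setP => x; rewrite !inE ffunE.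
  by apply: contraNF nj => /eqP <-; apply: codom_f.
have sG f : (s \in cstab (G f)) = (s \in cstab f).
  apply/cstabP/cstabP => h x; have := h x; rewrite ?ffunE; first exact: ig.
  by move=> ->.
rewrite /kpi -(card_imset _ iG); apply: eq_card => f'; rewrite inE.
apply/imsetP/andP => [[f + ->]|[/forallP c sf]].
  rewrite inE sG => /andP[/forallP c ->]; split=> //.
  apply/forallP => j; have [/codomP[i ->]|nj] := boolP (j \in codom g); first by rewrite cG wg.
  by rewrite cG0 // w0.
have cf x : f' x \in codom g.
  apply: contraT => nx; have := eqP (c (f' x)); rewrite w0 // => /eqP.
  by rewrite cards_eq0 => /eqP/setP/(_ x); rewrite !inE eqxx.
have eG : f' = G [ffun x => iinv (cf x)] by apply/ffunP => x; rewrite !ffunE f_iinv.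
exists [ffun x => iinv (cf x)] => //; rewrite inE -sG -eG sf andbT.
by apply/forallP => i; rewrite -cG -eG (eqP (c _)) wg.
Qed.

Lemma npi0 w s : npi (0%N :: w) s = npi w s.
Proof.
apply/esym/(kpi_inj (g := lift ord0)) => [|i|j]; [exact: lift_inj | by [] |].
by case: (unliftP ord0 j) => [i|] -> //; rewrite codom_f.
Qed.

Lemma npi_perm z z' s : perm_eq z z' -> npi z s = npi z' s.
Proof.
case/(perm_iotaP 0%N) => Is Isp ez.
have sIs : size Is = size z by rewrite ez size_map.
have uIs : uniq Is by rewrite (perm_uniq Isp) iota_uniq.
have ezn m : (m < size z)%N -> nth 0%N z m = nth 0%N z' (nth 0%N Is m).
  by move=> hm; rewrite {1}ez (nth_map 0%N) ?sIs.
have lt (i : 'I_(size z)) : (nth 0%N Is i < size z')%N.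
  have : nth 0%N Is i \in Is by rewrite mem_nth ?sIs.
  by rewrite (perm_mem Isp) mem_iota.
apply: (kpi_inj (g := fun i => Ordinal (lt i))) => [i j [e]|i|j].
- by apply/val_inj/eqP; rewrite -(nth_uniq 0%N _ _ uIs) ?sIs ?e; rewrite ?ltn_ord /=.
- by rewrite /= ezn.
move=> nj; case/negP: nj; have jI : (j : nat) \in Is by rewrite (perm_mem Isp) mem_iota add0n /=.
have lt' : (index (j : nat) Is < size z)%N by rewrite -sIs index_mem.
apply/codomP; exists (Ordinal lt'); apply: val_inj => /=; by rewrite nth_index.
Qed.

Lemma npi_sum z s : sumn z != n -> npi z s = 0%N.
Proof.
move=> ne; apply/eqP; rewrite cards_eq0; apply/eqP/setP => f; rewrite !inE.
apply: contraNF ne => /andP[/forallP c _]; rewrite -[X in _ == X](sum_cnt f).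
rewrite (eq_bigr (fun i : 'I_(size z) => nth 0%N z i)) => [|i _]; last exact/eqP.
by rewrite sumnE (big_nth 0%N) big_mkord.
Qed.

(** Equivalent to all cycles of [s] having odd length, by [vinv_porbit] and additivity. The
    condition on signs is the form in which it arises and is used. *)
Definition allpos s : bool := [forall B : {ffun 'I_n -> 'F_2}, vstab B s ==> (vinv s B == 0)].

Lemma allposP s : reflect (forall B, vact B s = B -> vinv s B = 0) (allpos s).
Proof.
apply: (iffP forallP) => [h B hB|h B]; first by have := h B; rewrite /vstab hB eqxx => /eqP.
by apply/implyP => /eqP hB; rewrite h.
Qed.

Definition ninv s : nat := #|[set B : {ffun 'I_n -> 'F_2} | vstab B s]|.

(** Translation by a stable vector of sign -1 reverses the sign of every term. *)
Lemma kappaE s : kappa s = if allpos s then (ninv s)%:R else 0.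
Proof.
rewrite /kappa; case: (boolP (allpos s)) => [/allposP h|].
  rewrite (eq_bigr (fun=> 1)) => [|B /eqP hB]; last by rewrite h.
  by rewrite sumr_const /ninv cardsE.
rewrite negb_forall => /existsP[B0]; rewrite negb_imply => /andP[/eqP s0 v0].
have {}v0 : vinv s B0 = 1 by case: (F2_cases (vinv s B0)) v0 => -> //; rewrite eqxx.
set S := \sum_(B | _) _.
suff: S = - S by move/eqP; rewrite -addr_eq0 -mulr2n mulrn_eq0 /= => /eqP.
rewrite {1}/S (reindex_inj (addrI B0)) -sumrN /=.
apply: eq_big => [B|B]; first by rewrite /vstab vactD s0 (inj_eq (addrI B0)).
rewrite /vstab vactD s0 (inj_eq (addrI B0)) => /eqP hB.
by rewrite vinv_stableD // v0 F2sgD F2sg1 mulN1r.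
Qed.

Lemma ninv_gt0 s : (0 < ninv s)%N.
Proof. by apply/card_gt0P; exists 0; rewrite inE /vstab vact0. Qed.

Lemma odd_porbit s x : allpos s -> odd #|porbit s x|.
Proof.
move/allposP/(_ (vset (porbit s x))); rewrite vact_set imset_porbit vinv_porbit => /(_ erefl).
rewrite -[RHS](F2_addxx 1) => /addIr e.
by move: e; rewrite F2_natr; case: (odd _).
Qed.

(** Sign-reversing involution: exchange the first two colours along one cycle of [s] that carries
    them. The cycle has odd length, so the parity of the number of points of colour [c0] changes. *)
Lemma npi_rel m w s : allpos s -> (0 < m)%N ->
  \sum_(i < m.+1) (-1) ^+ i * (npi (val i :: (m - i)%N :: w) s)%:R = 0 :> algC.
Proof.
move=> ps m_gt0; pose K := 'I_(size w).+2.
pose c0 : K := ord0; pose c1 : K := lift ord0 ord0.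
pose A (f : {ffun 'I_n -> K}) := [&& (cnt f c0 + cnt f c1 == m)%N,
  [forall i : 'I_(size w), cnt f (lift ord0 (lift ord0 i)) == nth 0%N w i] & s \in cstab f].
transitivity (\sum_(f | A f) (-1) ^+ cnt f c0 : algC).
  rewrite [RHS](partition_big (fun f => inord (cnt f c0) : 'I_m.+1) xpredT) //=.
  apply: eq_bigr => i _; rewrite /npi /kpi -sum1_card natr_sum mulr_sumr.
  apply: eq_big => [f|f].
    rewrite inE /A; apply/andP/andP => [[/forallP h sf]|[/and3P[/eqP h1 /forallP h2 sf] /eqP e]].
      have e0 : cnt f c0 = i := eqP (h ord0).
      have e1 : cnt f c1 = (m - i)%N := eqP (h c1).
      rewrite e0 e1 sf subnKC ?eqxx; last by rewrite -ltnS.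
      rewrite inord_val eqxx; split=> //; rewrite /= andbT.
      by apply/forallP => j; have := h (lift ord0 (lift ord0 j)).
    have e0 : cnt f c0 = i by rewrite -e inordK // ltnS; lia.
    split=> //; apply/forallP => j; case: (unliftP ord0 j) => [j'|] ->; last by rewrite /= -/c0 e0.
    case: (unliftP ord0 j') => [j''|] ->; first exact: h2.
    change (cnt f c1 == (m - i)%N); by rewrite -(addKn (cnt f c0) (cnt f c1)) h1 e0.
  rewrite inE => /andP[/forallP/(_ ord0)/eqP e0 _].
  by rewrite mulr1; congr (_ ^+ _); rewrite /= in e0 *.
pose M (f : {ffun 'I_n -> K}) := [set x | (f x == c0) || (f x == c1)].
(* The chosen cycle depends only on [M f], which the exchange preserves; hence [tau] is an
   involution. *)
pose C f := if [pick x in M f] is Some x then porbit s x else set0.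
have c01 : c0 != c1 by [].
pose tau (f : {ffun 'I_n -> K}) : {ffun 'I_n -> K} :=
  [ffun x => if x \in C f then tperm c0 c1 (f x) else f x].
have Mtau f : M (tau f) = M f.
  apply/setP => x; rewrite !inE ffunE; case: ifP => // _.
  by case: tpermP => [->|->|/eqP h1 /eqP h2]; rewrite ?eqxx ?orbT // (negPf h1) (negPf h2).
have Ctau f : C (tau f) = C f by rewrite /C Mtau.
have tauK f : tau (tau f) = f.
  by apply/ffunP => x; rewrite ffunE Ctau ffunE; case: (x \in C f); rewrite ?tpermK.
have Cs f x : (s x \in C f) = (x \in C f).
  by rewrite /C; case: pickP => [y _|_]; rewrite ?inE ?porbit_step.
have CM f : s \in cstab f -> C f \subset M f.
  move/cstabP => sf; rewrite /C; case: pickP => [y hy|_]; last exact: sub0set.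
  apply/subsetP => _ /porbitP[i ->].
  have e : f ((s ^+ i)%g y) = f y by elim: i => [|i IH]; rewrite ?perm1 // expgSr permM sf.
  by move: hy; rewrite !inE e.
have tcnt f k : (forall x, (tau f x == k) = (if x \in C f then f x == tperm c0 c1 k else f x == k)).
  by move=> x; rewrite ffunE; case: ifP => // _; apply/eqP/eqP => [<-|->]; rewrite tpermK.
have cntC f k : cnt (tau f) k = (#|[set x in C f | f x == tperm c0 c1 k]| + #|[set x | (x \notin C f) && (f x == k)]|)%N.
  rewrite /cnt -[LHS](cardsID (C f)); congr (_ + _)%N; apply: eq_card => x; rewrite !inE tcnt.
    by case: (x \in C f); rewrite ?andbT ?andbF.
  by case: (x \in C f).
have cntC' f k : cnt f k = (#|[set x in C f | f x == k]| + #|[set x | (x \notin C f) && (f x == k)]|)%N.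
  rewrite /cnt -[LHS](cardsID (C f)); congr (_ + _)%N; apply: eq_card => x; rewrite !inE.
    by rewrite andbC.
  by [].
have Atau f : A f -> A (tau f).
  case/and3P=> /eqP h1 /forallP h2 sf; apply/and3P; split.
  - move: h1; rewrite !cntC !(cntC' f) tpermL tpermR => <-; by rewrite addnACA [X in (X + _)%N == _]addnC -addnACA.
  - apply/forallP => i; rewrite -(eqP (h2 i)) cntC cntC' tpermD //.
  - apply/cstabP => x; move/cstabP: (sf) => sf'; by rewrite !ffunE Cs sf'.
have par f : A f -> (-1) ^+ cnt (tau f) c0 = - (-1) ^+ cnt f c0 :> algC.
  case/and3P=> /eqP h1 /forallP h2 sf.
  have oC : odd #|C f|.
    rewrite /C; case: pickP => [y _|/= no]; first exact: odd_porbit.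
    have : (0 < cnt f c0 + cnt f c1)%N by rewrite h1.
    rewrite addn_gt0 => /orP[] /card_gt0P[x]; rewrite inE => hx; have := no x; by rewrite inE hx ?orbT.
  have eC : (#|C f| = #|[set x in C f | f x == c0]| + #|[set x in C f | f x == c1]|)%N.
    rewrite -(cardsID [set x | f x == c0] (C f)); congr (_ + _)%N; apply: eq_card => x; rewrite !inE //.
    case: (boolP (x \in C f)) => [/(subsetP (CM f sf))|]; last by rewrite andbF.
    by rewrite inE andbT => /orP[]/eqP ->; rewrite eqxx ?(negPf c01) // eq_sym (negPf c01).
  rewrite cntC cntC' tpermL !exprD -mulNr; congr (_ * _).
  move: oC; rewrite eC oddD -[LHS]signr_odd -[in RHS]signr_odd.
  by do 2 case: (odd _); rewrite //= ?expr0 ?expr1 ?opprK.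
set S := \sum_(f | A f) _.
suff: S = - S by move/eqP; rewrite -addr_eq0 -mulr2n mulrn_eq0 /= => /eqP.
rewrite {1}/S (reindex_inj (can_inj tauK)) -sumrN /=.
apply: eq_big => [f|f hf]; last by rewrite -par ?tauK // -(tauK f); apply: Atau.
by apply/idP/idP => [/Atau|/Atau //]; rewrite tauK.
Qed.

End NpiProps.

Lemma nfact_neq0 (n : nat) : n`!%:R != 0 :> algC.
Proof. by rewrite pnatr_eq0 -lt0n fact_gt0. Qed.

Lemma wform_sum (R : comNzRingType) (kap : nat -> R) nu z :
  sumn nu != sumn z -> wform kap nu z = 0.
Proof.
elim: nu z => [|r w IH] z /= ne; first by rewrite eq_sym (negPf ne).
rewrite big1_seq // => l /andP[/eqP e hl]; rewrite IH ?mulr0 //.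
by have := sumn_subw hl; move: ne; rewrite e; lia.
Qed.

Lemma kappa_allpos n (s : 'S_n) : kappa s != 0 -> allpos s.
Proof. by rewrite kappaE; case: ifP => //; rewrite eqxx. Qed.

Lemma qlike_npi n (F : 'S_n -> algC) : (forall s, F s != 0 -> allpos s) ->
  qlike (fun z => \sum_s F s * (npi z s)%:R).
Proof.
move=> hF; split=> [u v uv|w|m w m_gt0].
- by apply: eq_bigr => s _; rewrite (npi_perm s uv).
- by apply: eq_bigr => s _; rewrite npi0.
under eq_bigr do rewrite mulr_sumr.
rewrite exchange_big big1 //= => s _.
have [->|/hF ps] := eqVneq (F s) 0.
  by rewrite big1 // => i _; rewrite mul0r mulr0.
under eq_bigr do rewrite mulrCA.
by rewrite -mulr_sumr npi_rel // mulr0.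
Qed.

Lemma qlikeZ (R : comNzRingType) (c : R) phi : qlike phi -> qlike (fun z => c * phi z).
Proof.
move=> q; split=> [u v uv|w|m w m_gt0].
- by rewrite (qlike_perm q uv).
- by rewrite (qlike0 q).
under eq_bigr do rewrite mulrCA.
by rewrite -mulr_sumr (qlike_rel q) // mulr0.
Qed.

(** The relations are inherited from permutation characters: by [npi_kappa] the form is a sum over
    permutations weighted by [kappa], whose support satisfies [allpos]. *)
Lemma qlike_wform nu : qlike (wform (kap2 algC) nu).
Proof.
pose n := sumn nu.
pose phi z := n`!%:R^-1 * \sum_(s : 'S_n) kappa s * (npi nu s)%:R * (npi z s)%:R.
have q : qlike phi.
  apply: qlikeZ; apply: qlike_npi => s ne; apply: kappa_allpos.
  by apply: contraNneq ne => ->; rewrite mul0r.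
have e z : wform (kap2 algC) nu z = phi z.
  have [h|h] := eqVneq (sumn z) n; last first.
    rewrite wform_sum 1?eq_sym // /phi big1 ?mulr0 // => s _.
    by rewrite (npi_sum s h) mulr0.
  by rewrite /phi npi_kappa // mulKf ?nfact_neq0.
case: q => q1 q2 q3; split=> [u v uv|w|m w m_gt0]; rewrite ?e; first exact: q1.
  exact: q2.
by under eq_bigr do rewrite e; apply: q3.
Qed.

Lemma raise_real mu (phi : seq nat -> algC) : (forall z, phi z \is Num.real) ->
  raise (kap2 algC) mu phi \is Num.real.
Proof.
elim: mu phi => [|a mu IH] phi h; first exact: h.
apply: IH => z; apply: rpred_sum => l _; rewrite !rpredM ?rpredX ?rpredN ?rpred1 //.
by apply: rpred_prod => i _; rewrite /kap2; case: ifP => _; rewrite ?rpred1 ?realn.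
Qed.

(* Cauchy-Schwarz against the virtual permutation character attached to mu,
   whose norm weighted by kappa is 2 ^+ size mu. *)
Lemma bounded_norm n (F : 'S_n -> algC) mu :
  (forall s, F s != 0 -> allpos s) -> strict_part mu -> sumn mu = n ->
  bounded mu (fun z => n`!%:R^-1 * \sum_s F s * (npi z s)%:R) ->
  `|n`!%:R^-1 * \sum_s F s * (npi mu s)%:R| ^+ 2
  <= 2 ^+ size mu * (n`!%:R^-1 * \sum_s `|F s| ^+ 2 / (ninv s)%:R).
Proof.
move=> hF smu nmu bmu; set phi := fun z => _ in bmu.
pose xi (s : 'S_n) : algC := raise (kap2 algC) mu (fun z => (npi z s)%:R).
have xir s : xi s \is Num.real by apply: raise_real => z; apply: realn.
have Exi (c : 'S_n -> algC) : raise (kap2 algC) mu (fun z => n`!%:R^-1 * \sum_s c s * (npi z s)%:R)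
    = n`!%:R^-1 * \sum_s c s * xi s.
  by rewrite raiseZ raise_sum.
have e1 : n`!%:R^-1 * \sum_s F s * xi s = phi mu.
  by rewrite -Exi raise_bounded.
have e2 : n`!%:R^-1 * \sum_s kappa s * xi s * xi s = 2 ^+ size mu.
  rewrite -Exi -(raise_form_norm qlike_wform smu); apply: eq_raise => z hz.
  transitivity (n`!%:R^-1 * \sum_s (kappa s * (npi z s)%:R) * xi s).
    by congr (_ * _); apply: eq_bigr => s _; rewrite mulrAC.
  rewrite -Exi; apply: eq_raise => nu hnu.
  rewrite -[RHS](mulKf (nfact_neq0 n)) -npi_kappa ?hz ?hnu //.
  by congr (_ * _); apply: eq_bigr => s _; rewrite mulrAC.
rewrite -/(phi mu); set A := n`!%:R^-1 * _; set c : algC := 2 ^+ size mu in e2 *.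
have c0 : 0 < c by rewrite exprn_gt0 ?ltr0n.
(* Coefficient of the orthogonal projection onto [xi] for the inner product weighted by [kappa]; the
   nonnegative sum below is the squared norm of the remainder. *)
pose lam := phi mu / c.
have : 0 <= n`!%:R^-1 * \sum_s (if allpos s then (ninv s)%:R * `|F s / (ninv s)%:R - lam * xi s| ^+ 2 else 0).
  apply: mulr_ge0; first by rewrite invr_ge0 ler0n.
  by apply: sumr_ge0 => s _; case: ifP => // _; rewrite mulr_ge0 ?ler0n ?exprn_ge0.
have expand s : (if allpos s then (ninv s)%:R * `|F s / (ninv s)%:R - lam * xi s| ^+ 2 else 0)
   = `|F s| ^+ 2 / (ninv s)%:R - lam^* * (F s * xi s) - lam * (F s * xi s)^* + `|lam| ^+ 2 * (kappa s * xi s * xi s).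
  have v0 : (ninv s)%:R != 0 :> algC by rewrite pnatr_eq0 -lt0n ninv_gt0.
  rewrite kappaE; case: ifP => ps; last first.
    have -> : F s = 0 by apply/eqP; apply: contraFT ps => /hF.
    by rewrite normr0 expr0n /= !mul0r conjC0 !mulr0 !subr0 addr0.
  rewrite !normCK !rmorphB !rmorphM /= (conj_Creal (xir s)) fmorphV /= conjC_nat.
  field; apply/and3P; split=> //; last exact: nfact_neq0.
  by have := conjC_eq0 c; rewrite (gt_eqF c0) => /negbT.
rewrite (eq_bigr _ (fun s _ => expand s)) !big_split /= !sumrN -!mulr_sumr.
rewrite !mulrDr !mulrN -/A [_ * (lam^* * _)]mulrCA e1 [_ * (`|lam| ^+ 2 * _)]mulrCA e2.
rewrite [_ * (lam * _)]mulrCA.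
have -> : n`!%:R^-1 * (\sum_s (F s * xi s)^*) = (phi mu)^*.
  by rewrite -e1 rmorphM rmorph_sum /= fmorphV /= rmorph_nat.
have -> : lam^* * phi mu = `|phi mu| ^+ 2 / c.
  by rewrite /lam rmorphM fmorphV /= (conj_Creal (gtr0_real c0)) normCK; ring.
have -> : lam * (phi mu)^* = `|phi mu| ^+ 2 / c by rewrite /lam normCK; ring.
have -> : `|lam| ^+ 2 * c = `|phi mu| ^+ 2 / c.
  rewrite /lam normf_div exprMn exprVn (gtr0_norm c0); field.
  by rewrite gt_eqF.
rewrite subrK subr_ge0 ler_pdivrMr // mulrC //.
Qed.

Lemma card_cstab_transport n (K : finType) (f g : {ffun 'I_n -> K}) (p : 'S_n) :
  (forall x, f x = g (p x)) -> #|cstab f| = #|cstab g|.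
Proof.
move=> h; have h' x : f ((p^-1)%g x) = g x by rewrite h permKV.
rewrite -(card_fibre (fun x => esym (h x))) -(card_fibre h') -(card_imset _ invg_inj).
apply: eq_card => y; rewrite inE; apply/imsetP/forallP => [[t + ->] x|e].
  by rewrite inE => /forallP e; rewrite -{2}(permKV t x) eq_sym.
exists (y^-1)%g; rewrite ?invgK // inE; apply/forallP => x.
by rewrite -{2}(permKV y x) eq_sym.
Qed.

(** * Permutation characters as induced characters *)

Section IndTriv.
Variables (n : nat) (z : seq nat).
Hypothesis sum_z : sumn z = n.

Definition block (x : 'I_n) : 'I_(size z) := insubd (Ordinal (reshape_indexP
  (eq_ind_r (fun m => (x < m)%N) (ltn_ord x) sum_z))) (reshape_index z x).

Lemma blockE x : block x = reshape_index z x :> nat.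
Proof.
by rewrite /block val_insubd reshape_indexP // sum_z.
Qed.

Definition base_col : {ffun 'I_n -> 'I_(size z)} := [ffun x => block x].

Lemma cnt_base i : cnt base_col i = nth 0%N z i.
Proof.
rewrite -(card_reshape_index sum_z); apply: eq_card => x.
by rewrite !inE ffunE -(inj_eq val_inj) /= blockE.
Qed.

Lemma young_cstab : young_subgroup n z = cstab base_col :> {set 'S_n}.
Proof.
apply/setP => s; apply/fiber_stabP/cstabP => h x; last by rewrite -!blockE -[block (s x)](ffunE block) h ffunE.
by apply: val_inj; rewrite /= !ffunE /= !blockE h.
Qed.

Lemma ind_trivE (s : 'S_n) : ind_triv n z s = (npi z s)%:R.
Proof.
rewrite /ind_triv cfIndE ?subsetT //.
transitivity (#|young_subgroup n z|%:R^-1 *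
   #|[set y : 'S_n | [forall x, base_col (y (s x)) == base_col (y x)]]|%:R : algC).
  congr (_ * _); rewrite -sum1_card natr_sum [RHS]big_mkcond /=.
  apply: eq_big => [y|y _]; first by rewrite inE.
  have -> : (y \in [set y : 'S_n | [forall x, base_col (y (s x)) == base_col (y x)]])
      = ((s ^ y)%g \in cstab base_col); last first.
    by rewrite cfun1E -young_cstab; case: (_ \in _).
  rewrite inE; apply/forallP/cstabP => [h x|h x].
    by rewrite /conjg !permM (eqP (h _)) permKV.
  by have := h (y x); rewrite /conjg !permM permK => ->; exact: eqxx.
apply: (canLR (mulKf _)) => [|]; first by rewrite pnatr_eq0 -lt0n cardG_gt0.
rewrite -natrM; congr _%:R.
rewrite -[LHS]sum1_card (partition_big (fun y : 'S_n => [ffun x => base_col (y x)])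
  (fun f => wcol (fun i : 'I_(size z) => nth 0%N z i) f && (s \in cstab f))) /=; last first.
  move=> y; rewrite inE => /forallP h; apply/andP; split.
    by apply/forallP => k; rewrite cnt_perm cnt_base.
  by apply/cstabP => x; rewrite [LHS]ffunE [RHS]ffunE (eqP (h x)).
rewrite (eq_bigr (fun=> #|young_subgroup n z|)) => [|f /andP[/forallP c sf]].
  rewrite sum_nat_const mulnC; congr (_ * _)%N; apply: eq_card => f.
  by rewrite [RHS]inE.
have [y0 e0] : exists p : 'S_n, forall x, f x = base_col (p x).
  by apply: cnt_transport => k; rewrite cnt_base (eqP (c k)).
rewrite young_cstab -(card_cstab_transport e0) -(card_fibre (fun x => esym (e0 x))).
rewrite -sum1_card; apply: eq_bigl => y; rewrite !inE.
apply/andP/forallP => [[_ /eqP <-] x|h]; first by rewrite [X in _ == X]ffunE.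
have e : [ffun x => base_col (y x)] = f by apply/ffunP => x; rewrite [LHS]ffunE (eqP (h x)).
split; last by rewrite e.
apply/forallP => x; move/cstabP: sf => sf.
by rewrite (eqP (h (s x))) (eqP (h x)) sf.
Qed.
End IndTriv.

Definition perm_emb_lift n : perm_emb n n.+1.
Proof.
apply: (@PermEmb n n.+1 (lift_perm ord0 ord0) (lift ord0)) => [s t|x y|s x|s y].
- by rewrite lift_permM.
- by [].
- by rewrite lift_perm_lift.
- by case: (unliftP ord0 y) => [x|] -> //; rewrite ?codom_f // lift_perm_id.
Defined.

(** * Coboundaries and stable vectors of a permutation *)

Section CoboundaryCount.
Variable N : nat.
Notation V := {ffun 'I_N -> 'F_2}.
Variable t : 'S_N.
Implicit Types A B C : V.

(** Up to sign, conjugating a permutation by e_B attaches the monomial of this vector to it, see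
    [W_cob]. *)
Definition vcob B : V := B + vact B t.

Lemma vcobD A B : vcob (A + B) = vcob A + vcob B.
Proof. by rewrite /vcob vactD addrACA. Qed.

Lemma vcob_eq0 B : (vcob B == 0) = vstab B t.
Proof. by rewrite /vcob /vstab addrC -[B in _ + B]vopp subr_eq0. Qed.

Lemma vwt_cob B : vwt (vcob B) = 0.
Proof. by rewrite vwtD vwt_act F2_addxx. Qed.

Lemma card_vcob_fibre A : (exists B, vcob B = A) -> #|[set B | vcob B == A]| = ninv t.
Proof.
case=> B0 e0; rewrite /ninv -[RHS](card_imset _ (addrI B0)); apply: eq_card => B.
rewrite inE; apply/eqP/imsetP => [e|[C]]; last first.
  by rewrite inE -vcob_eq0 => /eqP h ->; rewrite vcobD h addr0.
exists (B0 + B); last by rewrite addrA vaddxx add0r.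
by rewrite inE -vcob_eq0 vcobD e e0 vaddxx.
Qed.

Lemma sum_vcob (R : pzRingType) (f : V -> R) :
  \sum_B f (vcob B) = (ninv t)%:R * \sum_(A in [set vcob B | B : V]) f A.
Proof.
rewrite (partition_big vcob (mem [set vcob B | B : V])) /=; last by move=> B _; apply: imset_f.
rewrite mulr_sumr; apply: eq_bigr => A /imsetP[B0 _ e].
rewrite -(@card_vcob_fibre A); last by exists B0.
rewrite -sum1dep_card natr_sum mulr_suml; apply: eq_bigr => B /eqP ->.
by rewrite mul1r.
Qed.

Lemma card_F2vec : #|{: V}| = (2 ^ N)%N.
Proof. by rewrite card_ffun !card_ord. Qed.

Lemma card_im_vcob : (ninv t * #|[set vcob B | B : V]| = 2 ^ N)%N.
Proof.
have := sum_vcob (fun=> 1 : int); rewrite !sumr_const -natrM card_F2vec.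
by move/eqP; rewrite eqr_nat => /eqP.
Qed.

Definition vperp : {set V} := [set A | [forall B, vstab B t ==> (vdot B A == 0)]].

Lemma vperpP A : reflect (forall B, vact B t = B -> vdot B A = 0) (A \in vperp).
Proof.
rewrite inE; apply: (iffP forallP) => [h B hB|h B]; first by have := h B; rewrite /vstab hB eqxx => /eqP.
by apply/implyP => /eqP hB; rewrite h.
Qed.

Lemma sum_sg_vdot B : \sum_A F2sg (vdot B A) = if B == 0 then (2 ^ N)%:R else 0.
Proof.
have [->|nz] := eqVneq B 0.
  rewrite (eq_bigr (fun=> 1)); first by rewrite sumr_const card_F2vec.
  by move=> A _; rewrite /vdot big1 // => x _; rewrite ffunE mul0r.
have [x Bx] : exists x, B x = 1.
  have : [exists x, B x != 0].
    apply: contraNT nz; rewrite negb_exists => /forallP h; apply/eqP/ffunP => x.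
    by rewrite ffunE; apply/eqP; have := h x; rewrite negbK.
  by case/existsP => x; case: (F2_cases (B x)) => e; rewrite e ?eqxx // => _; exists x.
set S := \sum_A _.
suff: S = - S by move/eqP; rewrite -addr_eq0 -mulr2n mulrn_eq0 /= => /eqP.
rewrite {1}/S (reindex_inj (addrI (vdelta x))) -sumrN; apply: eq_bigr => A _.
by rewrite vdotDr vdotC vdot_delta Bx F2sgD F2sg1 mulN1r.
Qed.

Lemma sum_sg_stable A :
  \sum_(B | vstab B t) F2sg (vdot B A) = if A \in vperp then (ninv t)%:R else 0.
Proof.
case: (boolP (A \in vperp)) => [/vperpP h|].
  rewrite (eq_bigr (fun=> 1)) => [|B /eqP hB]; last by rewrite h.
  by rewrite sumr_const /ninv cardsE.
rewrite inE negb_forall => /existsP[B0]; rewrite negb_imply => /andP[/eqP s0 v0].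
have {}v0 : vdot B0 A = 1 by case: (F2_cases (vdot B0 A)) v0 => -> //; rewrite eqxx.
set S := \sum_(B | _) _.
suff: S = - S by move/eqP; rewrite -addr_eq0 -mulr2n mulrn_eq0 /= => /eqP.
rewrite {1}/S (reindex_inj (addrI B0)) -sumrN /=.
apply: eq_big => [B|B _]; first by rewrite /vstab vactD s0 (inj_eq (addrI B0)).
by rewrite vdotDl v0 F2sgD F2sg1 mulN1r.
Qed.

(** Invariance of [vdot] gives one inclusion. Equality follows by counting, since both sides have
    index [ninv t]: the image because of its kernel, the annihilator by a double sum of signs. *)
Lemma im_vcobE : [set vcob B | B : V] = vperp.
Proof.
apply/eqP; rewrite eqEcard; apply/andP; split.
  apply/subsetP => _ /imsetP[C _ ->]; apply/vperpP => B hB.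
  by rewrite /vcob vdotDr -[X in vdot X (vact C t)]hB vdot_act F2_addxx.
have : (ninv t * #|vperp| = 2 ^ N)%N.
  apply/eqP; rewrite -(eqr_nat algC); apply/eqP.
  transitivity (\sum_A \sum_(B | vstab B t) F2sg (vdot B A)).
    rewrite (eq_bigr _ (fun A _ => sum_sg_stable A)) -big_mkcond sumr_const /=.
    by rewrite natrM mulr_natr.
  rewrite exchange_big /= (eq_bigr _ (fun B _ => sum_sg_vdot B)) -big_mkcondr /=.
  rewrite (big_pred1 (0 : V)) // => B /=; have [->|_] := eqVneq B 0; last by rewrite andbF.
  by rewrite /vstab vact0 eqxx.
move=> e; have := card_im_vcob; rewrite -e => /eqP.
by rewrite eqn_pmul2l ?ninv_gt0 // => /eqP ->.
Qed.

End CoboundaryCount.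

Section Push.
Variables (n N : nat) (h : perm_emb n N).
Implicit Types (B : {ffun 'I_n -> 'F_2}) (A : {ffun 'I_N -> 'F_2}) (s : 'S_n).

Definition vpush B : {ffun 'I_N -> 'F_2} := [ffun y => \sum_x (pt h x == y)%:R * B x].
Definition vpull A : {ffun 'I_n -> 'F_2} := [ffun x => A (pt h x)].

Lemma vpush_pt B x : vpush B (pt h x) = B x.
Proof.
rewrite ffunE (bigD1 x) //= eqxx mul1r big1 ?addr0 // => y ne.
by rewrite (inj_eq (pt_inj (h := h))) (negPf ne) mul0r.
Qed.

Lemma vpush_out B y : y \notin codom (pt h) -> vpush B y = 0.
Proof.
move=> ny; rewrite ffunE big1 // => x _; case: eqP => [e|_]; last by rewrite mul0r.
by rewrite -e codom_f in ny.
Qed.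

Lemma vpushK : cancel vpush vpull.
Proof. by move=> B; apply/ffunP => x; rewrite ffunE vpush_pt. Qed.

Lemma pt_cases y : (exists x, y = pt h x) \/ y \notin codom (pt h).
Proof. by case: (boolP (y \in codom (pt h))) => [/codomP|]; [left | right]. Qed.

Lemma vact_push B s : vact (vpush B) (pe h s) = vpush (vact B s).
Proof.
apply/ffunP => y; rewrite [LHS]ffunE -peV; case: (pt_cases y) => [[x ->]|ny].
  by rewrite pe_pt !vpush_pt ffunE.
by rewrite pe_out // !vpush_out.
Qed.

Lemma vinv_push B s : vinv (pe h s) (vpush B) = vinv s B.
Proof.
have E (f : 'I_N -> 'F_2) : (forall y, y \notin codom (pt h) -> f y = 0) ->
    \sum_y f y = \sum_x f (pt h x).
  move=> f0; rewrite (bigID (fun y => y \in codom (pt h))) /= [X in _ + X]big1 ?addr0 //.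
  rewrite -(big_imset f (A := 'I_n) (h := pt h)) /=; last by move=> x y _ _; apply: pt_inj.
  by apply: eq_bigl => y; apply/codomP/imsetP => [[x ->]|[x _ ->]]; exists x.
rewrite /vinv E; last by move=> y ny; rewrite big1 // => z _; rewrite vpush_out // mul0r mulr0.
apply: eq_bigr => x _; rewrite E; last by move=> y ny; rewrite (vpush_out _ ny) !mulr0.
by apply: eq_bigr => y _; rewrite !pe_pt !vpush_pt !pt_lt.
Qed.

Lemma allpos_pe s : allpos (pe h s) -> allpos s.
Proof.
move/allposP => H; apply/allposP => B hB; rewrite -vinv_push; apply: H.
by rewrite vact_push hB.
Qed.

Definition vext : {set {ffun 'I_N -> 'F_2}} := [set A | vpull A == 0].

Lemma vpullD A C : vpull (A + C) = vpull A + vpull C.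
Proof. by apply/ffunP => y; rewrite !ffunE. Qed.

Lemma vact_ext A s : A \in vext -> vact A (pe h s) = A.
Proof.
rewrite inE => /eqP e; apply: vact_fix => y; case: (pt_cases y) => [[x ->]|ny _]; last exact: pe_out.
by have := congr1 (fun f : {ffun 'I_n -> 'F_2} => f x) e; rewrite !ffunE => ->; rewrite eqxx.
Qed.

Lemma ninv_pe s : ninv (pe h s) = (#|vext| * ninv s)%N.
Proof.
rewrite /ninv -cardsX.
pose f (p : {ffun 'I_N -> 'F_2} * {ffun 'I_n -> 'F_2}) := p.1 + vpush p.2.
have pf p : p.1 \in vext -> vpull (f p) = p.2.
  by rewrite inE /f vpullD vpushK => /eqP ->; rewrite add0r.
rewrite -(card_in_imset (f := f)); last first.
  move=> [A B] [A' B'] /setXP[/= hA _] /setXP[/= hA' _] e.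
  have eB : B = B' by rewrite -[B]/((A, B).2) -pf // e pf.
  by move: e; rewrite /f /= eB => /addIr ->.
apply: eq_card => A; rewrite inE; apply/eqP/imsetP => [hA|[[C B] /setXP[/= hC] + ->]].
  exists (A + vpush (vpull A), vpull A); last by rewrite /f /= -addrA vaddxx addr0.
  apply/setXP; split=> /=; first by rewrite inE vpullD vpushK vaddxx.
  rewrite inE; apply/vstabP => x; rewrite !ffunE -pe_pt.
  by have := congr1 (fun f : {ffun 'I_N -> 'F_2} => f (pe h s (pt h x))) hA; rewrite ffunE permK => ->.
by rewrite inE => /eqP hB; rewrite /f /= vactD vact_ext // vact_push hB.
Qed.

Lemma card_vext : (#|vext| * 2 ^ n = 2 ^ N)%N.
Proof.
have := ninv_pe 1; have id1 m : ninv (1 : 'S_m) = (2 ^ m)%N.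
  rewrite -card_F2vec -cardsT; apply: eq_card => B; rewrite !inE.
  by rewrite /vstab vact1 eqxx.
by rewrite pe1 !id1.
Qed.

End Push.

(** * Spin characters *)

Section MkClassFun.
Variables (gT : finGroupType) (f : gT -> algC).
Hypothesis fJ : forall x y, f (x ^ y)%g = f x.

Lemma mkcf_subproof : is_class_fun <<[set: gT]>>%g (finfun f).
Proof.
apply: intro_class_fun => [x y _ _|x]; first exact: fJ.
by rewrite /= genGid inE.
Qed.

Definition mkcf : 'CF([set: gT]) := Cfun 0 mkcf_subproof.

Lemma mkcfE x : mkcf x = f x.
Proof. by rewrite cfunE. Qed.
End MkClassFun.

Section FullDot.
Variable gT : finGroupType.
Implicit Types f g : 'CF([set: gT]).

Lemma cfdotTE f g : '[f, g] = #|gT|%:R^-1 * \sum_x f x * (g x)^*.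
Proof.
rewrite cfdotE cardsT; congr (_ * _); apply: eq_bigl => x; by rewrite inE.
Qed.
End FullDot.

Section CliffSums.
Variables (n N : nat) (h : perm_emb n N).

Lemma card_cliff : #|{: cliff h}| = (2 * 2 ^ N * n`!)%N.
Proof.
rewrite /cliff !card_prod -card_Sn; congr (_ * _ * _)%N; first by rewrite card_ord.
by rewrite card_ffun !card_ord.
Qed.

Lemma sum_cliff (R : nmodType) (f : cliff h -> R) :
  \sum_g f g = \sum_(s : 'S_n) \sum_A (f (cl h 0 A s) + f (cl h 1 A s)).
Proof.
transitivity (\sum_(p : 'F_2 * {ffun 'I_N -> 'F_2}) \sum_(s : 'S_n) f (p, s)).
  by rewrite pair_bigA; apply: eq_bigr => -[p s].
transitivity (\sum_(d : 'F_2) \sum_(A : {ffun 'I_N -> 'F_2}) \sum_(s : 'S_n) f (d, A, s)).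
  by rewrite [RHS]pair_bigA; apply: eq_bigr => -[d A].
rewrite big_ord_recl big_ord1 -big_split [RHS]exchange_big; apply: eq_bigr => A _ /=.
rewrite -big_split; apply: eq_bigr => s _.
by congr (f _ + f _); congr (_, _, _); apply: val_inj.
Qed.

Definition vdeg (g : cliff h) : 'F_2 := vwt g.1.2.

Lemma vdegM g k : vdeg (g * k)%g = vdeg g + vdeg k.
Proof. by case: g => [[d A] s]; case: k => [[d' B] t]; rewrite /vdeg /= vwtD vwt_act. Qed.

Lemma vdegJ g k : vdeg (g ^ k)%g = vdeg g.
Proof.
have : vdeg (k * g ^ k)%g = vdeg (g * k)%g by rewrite -conjgC.
by rewrite !vdegM addrC => /addIr.
Qed.

Definition sgdeg_mx (g : cliff h) : 'M[algC]_1 := (F2sg (vdeg g))%:M.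

Lemma sgdeg_repr : mx_repr [set: cliff h] sgdeg_mx.
Proof.
split=> [|g k _ _]; first by rewrite /sgdeg_mx /vdeg /= /vwt big1 // => x _; rewrite ffunE.
by rewrite /sgdeg_mx vdegM F2sgD scalar_mxM.
Qed.

Definition sgdeg : 'CF([set: cliff h]) := cfRepr (MxRepresentation sgdeg_repr).

Lemma sgdegE g : sgdeg g = F2sg (vdeg g).
Proof. by rewrite cfunE inE mulr1n /= mxtrace_scalar. Qed.

Lemma sgdeg_lin : sgdeg \is a linear_char.
Proof.
rewrite qualifE /= cfRepr_char /= sgdegE /vdeg /= /vwt big1 ?eqxx // => x _.
by rewrite ffunE.
Qed.

Lemma ciotaJ s t : (ciota h s ^ ciota h t = ciota h (s ^ t))%g.
Proof.
by apply: (mulgI (ciota h t)); rewrite -conjgC -!ciotaM -conjgC.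
Qed.

Definition prS (g : cliff h) : 'S_n := g.2.

Lemma prSM : {morph prS : g k / (g * k)%g}.
Proof. by case=> [[d A] s] [[d' B] t]. Qed.

Section Pull.
Variables (d : nat) (rG : mx_representation algC (Symn n) d).

Lemma pullS_repr : mx_repr [set: cliff h] (fun g => rG (prS g)).
Proof.
by split=> [|g k _ _]; [exact: repr_mx1 | rewrite prSM repr_mxM ?inE].
Qed.
End Pull.

Section PullG.
Variables (d : nat) (rG : mx_representation algC [set: cliff h] d).

Lemma pullG_repr : mx_repr (Symn n) (fun s => rG (ciota h s)).
Proof.
by split=> [|s t _ _]; [exact: repr_mx1 | rewrite ciotaM repr_mxM ?inE].
Qed.
End PullG.

Definition infl (j : Iirr (Symn n)) : 'CF([set: cliff h]) :=
  cfRepr (MxRepresentation (pullS_repr 'Chi_j)).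

Lemma inflE j g : infl j g = 'chi_j (prS g).
Proof. by rewrite -[in RHS]irrRepr !cfunE !inE. Qed.
End CliffSums.

Section SpinIrr.
Variables (n N : nat) (h : perm_emb n N) (i0 : Iirr [set: cliff h]).
Notation V := {ffun 'I_N -> 'F_2}.
Notation cl := (cl h).
Notation W := 'chi_i0.
Hypothesis Wz : forall g, W (cz h * g)%g = - W g.
Variable g1 : cliff h.
Hypothesis g1_odd : vdeg g1 = 1.
Hypothesis Wg1 : W g1 != 0.

Lemma WJ g k : W (g ^ k)%g = W g.
Proof. by rewrite cfunJ ?inE. Qed.

Lemma W_sq d A s : `|W (cl d A s)| ^+ 2 = `|W (cl 0 A s)| ^+ 2.
Proof.
by rewrite (WzE Wz); case: (F2_cases d) => ->; rewrite ?F2sg0 ?F2sg1 ?mul1r ?mulN1r ?normrN.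
Qed.

Lemma sum_cliff_sq (c : cliff h -> algC) : (forall d A s, c (cl d A s) = c (cl 0 A s)) ->
  \sum_g c g * `|W g| ^+ 2 = 2 * \sum_(s : 'S_n) \sum_A c (cl 0 A s) * `|W (cl 0 A s)| ^+ 2.
Proof.
move=> hc; rewrite sum_cliff mulr_sumr; apply: eq_bigr => s _; rewrite mulr_sumr.
by apply: eq_bigr => A _; rewrite W_sq hc -mulr2n mulr_natl.
Qed.

(** The odd element [g1] distinguishes [W] from its product with the sign of the degree, so the two
    irreducible characters are orthogonal. Consequently odd and even elements carry half of the norm
    each. *)
Lemma W_assoc_neq : '['chi_i0, 'chi_i0 * sgdeg h] = 0.
Proof.
have /irrP[j ej] : 'chi_i0 * sgdeg h \in irr [set: cliff h].
  by rewrite mulrC mul_lin_irr ?sgdeg_lin ?mem_irr.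
rewrite ej cfdot_irr; case: eqP => // e; case/eqP: Wg1.
have : W g1 = - W g1.
  by rewrite -[RHS]mulN1r -F2sg1 -g1_odd -sgdegE mulrC {1}e -ej cfunE.
by move/eqP; rewrite -addr_eq0 -mulr2n mulrn_eq0 /= => /eqP.
Qed.

Lemma sum_W_sq : \sum_g `|W g| ^+ 2 = #|{: cliff h}|%:R.
Proof.
have G0 : #|{: cliff h}|%:R != 0 :> algC.
  by rewrite pnatr_eq0 -lt0n; apply/card_gt0P; exists 1%g.
have := cfnorm_irr i0; rewrite cfdotTE => /(canRL (mulVKf G0)); rewrite mulr1 => <-.
by apply: eq_bigr => g _; rewrite normCK.
Qed.

Lemma sum_W_sgsq : \sum_g F2sg (vdeg g) * `|W g| ^+ 2 = 0.
Proof.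
have G0 : #|{: cliff h}|%:R != 0 :> algC.
  by rewrite pnatr_eq0 -lt0n; apply/card_gt0P; exists 1%g.
have := W_assoc_neq; rewrite cfdotTE => /(canRL (mulVKf G0)); rewrite mulr0 => e; rewrite -[RHS]e.
apply: eq_bigr => g _; rewrite cfunE sgdegE rmorphM /= normCK.
have -> : (F2sg (vdeg g))^* = F2sg (vdeg g) by rewrite /F2sg rmorph_sign.
by rewrite [RHS]mulrA mulrC.
Qed.

Lemma sum_W_odd : 2 * (\sum_(g | vdeg g == 1) `|W g| ^+ 2) = #|{: cliff h}|%:R.
Proof.
rewrite -sum_W_sq -[RHS]subr0 -[X in _ = _ - X]sum_W_sgsq -sumrB [in LHS]big_mkcond mulr_sumr.
apply: eq_bigr => g _; case: (F2_cases (vdeg g)) => ->; rewrite ?F2sg0 ?F2sg1 ?eqxx.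
  by rewrite mul1r subrr mulr0.
by rewrite mulN1r opprK -mulr2n mulr_natl.
Qed.

Lemma sum_W_even : 2 * (\sum_(g | vdeg g == 0) `|W g| ^+ 2) = #|{: cliff h}|%:R.
Proof.
rewrite -sum_W_sq -[RHS]addr0 -[X in _ = _ + X]sum_W_sgsq -big_split [in LHS]big_mkcond mulr_sumr.
apply: eq_bigr => g _ /=; case: (F2_cases (vdeg g)) => ->; rewrite ?F2sg0 ?F2sg1 ?eqxx.
  by rewrite mul1r -mulr2n mulr_natl.
by rewrite mulN1r subrr mulr0.
Qed.

Lemma sum_W_evenE :
  4 * (\sum_(s : 'S_n) \sum_(A : V | vwt A == 0) `|W (cl 0 A s)| ^+ 2) = #|{: cliff h}|%:R.
Proof.
rewrite -sum_W_even.
have -> : \sum_(g : cliff h | vdeg g == 0) `|W g| ^+ 2 = \sum_g (vdeg g == 0)%:R * `|W g| ^+ 2.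
  by rewrite big_mkcond; apply: eq_bigr => g _; case: ifP; rewrite ?mul1r ?mul0r.
rewrite sum_cliff_sq // mulrA -natrM; congr (_ * _); apply: eq_bigr => s _.
rewrite [LHS]big_mkcond; apply: eq_bigr => A _; rewrite /vdeg /=.
by case: ifP; rewrite ?mul1r ?mul0r.
Qed.

Definition Wres (s : 'S_n) : algC := W (ciota h s).

Lemma Wres_neq0 s : Wres s != 0 -> allpos (pe h s).
Proof.
apply: contraNT; rewrite negb_forall => /existsP[B]; rewrite negb_imply => /andP[/eqP sB vB].
apply/eqP; apply: (spin_stable0 (W := fun g => W g) WJ Wz 0 sB).
have -> : vwt (0 : V) = 0 by rewrite /vwt big1 // => x _; rewrite ffunE.
have -> : vdot B (0 : V) = 0 by rewrite /vdot big1 // => x _; rewrite ffunE mulr0.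
by rewrite mulr0 !addr0; case: (F2_cases (vinv (pe h s) B)) vB => -> //; rewrite eqxx.
Qed.

Lemma W_cob s B : `|W (cl 0 (vcob (pe h s) B) s)| = `|Wres s|.
Proof.
have [d e] : exists d, (ciota h s ^ cV h B)%g = cl d (vcob (pe h s) B) s.
  exists (vbeta (vact B (pe h s)) (vcob (pe h s) B) + vinv (pe h s) B).
  apply: (mulgI (cV h B)); rewrite -conjgC ciota_cV clM mul1g add0r; congr (_, _, _).
    by rewrite -[_ + _ + vinv _ _]addrA F2_addxx addr0 F2_addxx.
  by rewrite /vcob addrCA vaddxx addr0.
rewrite /Wres -(WJ (ciota h s) (cV h B)) e (WzE Wz d).
by case: (F2_cases d) => ->; rewrite ?F2sg0 ?F2sg1 ?mul1r ?mulN1r ?normrN.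
Qed.

(** Up to sign, every element over [s] whose vector is a coboundary is conjugate to [s], and each
    such vector comes from [ninv] different [B]. *)
Lemma sum_W_even_fibre s : (2 ^ N)%:R * `|Wres s| ^+ 2
  = (ninv (pe h s))%:R * \sum_(A in [set vcob (pe h s) B | B : V]) `|W (cl 0 A s)| ^+ 2.
Proof.
rewrite -(sum_vcob (pe h s) (fun A => `|W (cl 0 A s)| ^+ 2)).
rewrite (eq_bigr (fun=> `|Wres s| ^+ 2)); last by move=> B _; rewrite W_cob.
by rewrite sumr_const card_F2vec mulr_natl.
Qed.

(** Coboundaries have even weight, so the elements of [sum_W_even_fibre] are among the even ones,
    whose share of the norm is one half. *)
Lemma Wres_norm :
  2 * (n`!%:R^-1 * \sum_s `|Wres s| ^+ 2 / (ninv s)%:R) <= #|vext h|%:R.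
Proof.
have le s : `|Wres s| ^+ 2 / (ninv s)%:R * (2 ^ N)%:R
    <= #|vext h|%:R * \sum_(A : V | vwt A == 0) `|W (cl 0 A s)| ^+ 2.
  rewrite mulrAC [_ * (2 ^ N)%:R]mulrC sum_W_even_fibre ninv_pe natrM.
  have m0 : (ninv s)%:R != 0 :> algC by rewrite pnatr_eq0 -lt0n ninv_gt0.
  rewrite [_ * (ninv s)%:R * _]mulrAC mulfK //.
  rewrite ler_wpM2l ?ler0n // [leRHS]big_mkcond [leLHS]big_mkcond; apply: ler_sum => A _.
  case: imsetP => [[B _ ->]|_]; first by rewrite vwt_cob eqxx.
  by case: ifP => _ //; rewrite exprn_ge0.
have N0 : (0 : algC) < (2 ^ N)%:R by rewrite ltr0n expn_gt0.
have n0 : (0 : algC) < n`!%:R by rewrite ltr0n fact_gt0.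
have := ler_sum (index_enum _) (P := xpredT) (fun s _ => le s).
rewrite -mulr_suml -mulr_sumr.
have := sum_W_evenE; rewrite card_cliff !natrM.
set T := \sum_(s : 'S_n) _; set S := \sum_(s : 'S_n) _ => eT leS.
have {}eT : 2 * T = (2 ^ N)%:R * n`!%:R.
  have two0 : (2 : algC) != 0 by rewrite pnatr_eq0.
  by apply: (mulfI two0); rewrite mulrA (_ : 2 * 2 = 4) ?eT ?mulrA // -natrM.
rewrite -(ler_pM2r N0).
have -> : 2 * (n`!%:R^-1 * S) * (2 ^ N)%:R = 2 / n`!%:R * (S * (2 ^ N)%:R) by ring.
apply: le_trans (ler_wpM2l _ leS) _; first by rewrite divr_ge0 ?ler0n.
have -> : 2 / n`!%:R * (#|vext h|%:R * T) = #|vext h|%:R * (2 * T) / n`!%:R by ring.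
by rewrite eT mulrA mulfK ?gt_eqF.
Qed.

End SpinIrr.

(** * A character of the symmetric group from the even degree part *)

Section Theta.
Variables (n N : nat) (h : perm_emb n N) (i0 : Iirr [set: cliff h]).
Notation V := {ffun 'I_N -> 'F_2}.
Notation cl := (cl h).
Notation W := 'chi_i0.
Hypothesis Wz : forall g, W (cz h * g)%g = - W g.
Variable g1 : cliff h.
Hypothesis g1_odd : vdeg g1 = 1.
Hypothesis Wg1 : W g1 != 0.

Lemma vdeg_cl d A s : vdeg (cl d A s) = vwt A. Proof. by []. Qed.

(* The two associate spin characters W and W * sgdeg agree in even degree and cancel
   in odd degree, so this is the part of |W|^2 + W^* (W * sgdeg) seen by S_n. *)
Definition theta_fun (s : 'S_n) : algC :=
  (2 ^ N)%:R^-1 * \sum_(g : cliff h | (prS g == s) && (vdeg g == 0)) `|W g| ^+ 2.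

Lemma prSJ (g k : cliff h) : prS (g ^ k)%g = (prS g ^ prS k)%g.
Proof. by apply: (mulgI (prS k)); rewrite -conjgC -!prSM -conjgC. Qed.

Lemma theta_funJ x y : theta_fun (x ^ y)%g = theta_fun x.
Proof.
rewrite /theta_fun; congr (_ * _).
rewrite (reindex_inj (conjg_inj (ciota h y))) /=; apply: eq_big => g.
  by rewrite vdegJ prSJ (inj_eq (conjg_inj _)).
by rewrite WJ.
Qed.

Definition theta : 'CF(Symn n) := mkcf theta_funJ.

Lemma thetaE s : theta s = 2 / (2 ^ N)%:R * \sum_(A : V | vwt A == 0) `|W (cl 0 A s)| ^+ 2.
Proof.
rewrite mkcfE /theta_fun [2 / _]mulrC -mulrA; congr (_ * _).
rewrite big_mkcond sum_cliff (bigD1 s) //= [X in _ + X]big1 ?addr0 => [|t nts]; last first.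
  by rewrite big1 // => A _; rewrite (negbTE nts) addr0.
rewrite mulr_sumr [RHS]big_mkcond; apply: eq_bigr => A _.
rewrite !vdeg_cl eqxx /=; case: ifP => _; last by rewrite addr0.
by rewrite (W_sq Wz 1) -mulr2n mulr_natl.
Qed.

(** The scalar product of [cfdot_theta] taken over the odd elements instead. By [theta_pm] it is the
    difference of two multiplicities whose sum is the multiplicity in [theta]. *)
Definition thetaO (j : Iirr (Symn n)) : algC :=
  2 / #|{: cliff h}|%:R * \sum_(g : cliff h | vdeg g == 1) `|W g| ^+ 2 * ('chi_j (prS g))^*.

Lemma cfdot_theta j : '[theta, 'chi_j]
  = 2 / #|{: cliff h}|%:R * \sum_(g : cliff h | vdeg g == 0) `|W g| ^+ 2 * ('chi_j (prS g))^*.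
Proof.
rewrite cfdotTE card_Sn card_cliff !natrM.
have -> : 2 / (2 * (2 ^ N)%:R * n`!%:R) = (n`!)%:R^-1 / (2 ^ N)%:R :> algC.
  have n0 : (n`!)%:R != 0 :> algC by rewrite pnatr_eq0 -lt0n fact_gt0.
  have N0 : (2 ^ N)%:R != 0 :> algC by rewrite pnatr_eq0 -lt0n expn_gt0.
  by field; rewrite n0 N0.
rewrite -mulrA; congr (_ * _); rewrite mulr_sumr (partition_big (@prS _ _ h) xpredT) //=.
apply: eq_bigr => s _; rewrite mkcfE /theta_fun -mulrA mulr_suml mulr_sumr.
by apply: eq_big => [g|g /andP[/eqP-> _]]; first rewrite andbC.
Qed.

Lemma theta_pm j :
  '[theta, 'chi_j] = '[W^*%CF * (W + W * sgdeg h), infl h j]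
  /\ thetaO j = '[W^*%CF * W, infl h j] - '[W^*%CF * (W * sgdeg h), infl h j].
Proof.
have dotE f : '[W^*%CF * (W * f), infl h j]
    = #|{: cliff h}|%:R^-1 * \sum_g (`|W g| ^+ 2 * ('chi_j (prS g))^*) * f g.
  rewrite cfdotTE; congr (_ * _); apply: eq_bigr => g _.
  by rewrite inflE !cfunE normCK; ring.
have dotE1 : '[W^*%CF * W, infl h j]
    = #|{: cliff h}|%:R^-1 * \sum_g (`|W g| ^+ 2 * ('chi_j (prS g))^*).
  by rewrite cfdotTE; congr (_ * _); apply: eq_bigr => g _; rewrite inflE !cfunE normCK; ring.
split.
  rewrite mulrDr cfdotDl dotE dotE1 cfdot_theta -mulrDr -big_split.
  rewrite [2 / _]mulrC -mulrA; congr (_ * _); rewrite mulr_sumr [LHS]big_mkcond; apply: eq_bigr => g _ /=; rewrite sgdegE.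
  by case: (F2_cases (vdeg g)) => ->; rewrite ?F2sg0 ?F2sg1 /=; ring.
rewrite dotE dotE1 /thetaO -mulrBr -sumrB.
rewrite [2 / _]mulrC -mulrA; congr (_ * _); rewrite mulr_sumr [LHS]big_mkcond; apply: eq_bigr => g _ /=; rewrite sgdegE.
by case: (F2_cases (vdeg g)) => ->; rewrite ?F2sg0 ?F2sg1 /=; ring.
Qed.

Lemma infl_char j : infl h j \is a character.
Proof. exact: cfRepr_char. Qed.

Lemma theta_nat j : '[theta, 'chi_j] \in Num.nat.
Proof.
rewrite (theta_pm j).1 Cnat_cfdot_char ?infl_char // rpredM ?cfConjC_char ?irr_char //.
by rewrite rpredD ?irr_char // rpredM ?irr_char // lin_charW // sgdeg_lin.
Qed.

Lemma theta_char : theta \is a character.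
Proof.
rewrite [theta]cfun_sum_cfdot rpred_sum // => j _.
by have /natrP[m ->] := theta_nat j; rewrite scaler_nat rpredMn ?irr_char.
Qed.

Lemma theta_triv : '[theta, 'chi_0] = 1.
Proof.
rewrite cfdot_theta mulrAC (eq_bigr (fun g => `|W g| ^+ 2)).
  rewrite (sum_W_even g1_odd Wg1) mulfV // pnatr_eq0 -lt0n.
  by apply/card_gt0P; exists 1%g.
by move=> g _; rewrite irr0 cfun1E inE rmorph1 mulr1.
Qed.

(** Under the support hypothesis [thetaO j] is the conjugate of ['chi_j c]. It is also a difference
    of two natural numbers; if their sum, the multiplicity in [theta], were 0, the difference would
    be 0 too. *)
Lemma theta_supp (c : 'S_n) j :
  (forall g : cliff h, vdeg g = 1 -> W g != 0 -> exists t, prS g = (c ^ t)%g) ->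
  'chi_j c != 0 -> '[theta, 'chi_j] != 0.
Proof.
move=> supp; apply: contra_neq => t0.
have [Tp Tm] := theta_pm j; move: Tp; rewrite t0 mulrDr cfdotDl.
set a := '[_, _]; set b := '[_, _] => /esym/eqP.
have Na : 0 <= a by rewrite natr_ge0 // Cnat_cfdot_char ?infl_char // rpredM ?cfConjC_char ?irr_char.
have Nb : 0 <= b.
  rewrite natr_ge0 // Cnat_cfdot_char ?infl_char // rpredM ?cfConjC_char ?irr_char //.
  by rewrite rpredM ?irr_char // lin_charW // sgdeg_lin.
rewrite paddr_eq0 // => /andP[/eqP a0 /eqP b0].
move: Tm; rewrite -/a -/b a0 b0 subrr /thetaO (eq_bigr (fun g => `|W g| ^+ 2 * ('chi_j c)^*)).
  rewrite -mulr_suml mulrA [2 / _ * _]mulrAC (sum_W_odd g1_odd Wg1) mulfV ?mul1r; last first.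
    by rewrite pnatr_eq0 -lt0n; apply/card_gt0P; exists 1%g.
  by move/eqP; rewrite conjC_eq0 => /eqP.
move=> g /eqP dg; have [->|nz] := eqVneq (W g) 0; first by rewrite normr0 expr0n !mul0r.
by have [t ->] := supp g dg nz; rewrite cfunJ ?inE.
Qed.

Lemma allpos_peE s : allpos (pe h s) = allpos s.
Proof.
apply/idP/idP; first exact: allpos_pe.
move/allposP => H; apply/allposP => B hB.
have vE : B + vpush h (vpull h B) \in vext h by rewrite inE vpullD vpushK vaddxx.
have hp : vact (vpull h B) s = vpull h B.
  apply/eqP/vstabP => x; rewrite !ffunE -pe_pt.
  by have := congr1 (fun f : V => f (pe h s (pt h x))) hB; rewrite ffunE permK => ->.
have -> : B = (B + vpush h (vpull h B)) + vpush h (vpull h B) by rewrite -addrA vaddxx addr0.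
rewrite vinv_stableD; [|by rewrite vact_ext|by rewrite vact_push hp]. rewrite vinv_push H ?addr0 //.
apply: vinv_fix => y; case: (pt_cases h y) => [[x ->]|ny _]; last exact: pe_out.
by move: vE; rewrite inE => /eqP/ffunP/(_ x); rewrite !ffunE => ->; rewrite eqxx.
Qed.

Lemma theta_allpos s : theta s != 0 -> allpos s.
Proof.
apply: contraNT; rewrite negb_forall => /existsP[B]; rewrite negb_imply => /andP[/eqP sB vB].
rewrite thetaE big1 ?mulr0 // => A /eqP wA.
suff -> : W (cl 0 A s) = 0 by rewrite normr0 expr0n.
apply: (spin_split0 (W := fun g => W g) (@WJ _ _ _ i0) Wz 0 (B := vpush h B)) => //.
  by rewrite vact_push sB.
by rewrite vinv_push; case: (F2_cases (vinv s B)) vB => -> //; rewrite eqxx.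
Qed.

(** If [allpos s] holds, [spin_stable0] kills the even elements over [s] whose vector is not
    orthogonal to the stable vectors. By [im_vcobE] the surviving vectors are coboundaries, where
    the modulus of W is that of [Wres i0 s]. *)
Lemma kappa_theta s : kappa s * theta s = 2 / #|vext h|%:R * `|Wres i0 s| ^+ 2.
Proof.
rewrite kappaE; case: (boolP (allpos s)) => [pos|npos]; last first.
  rewrite mul0r; have [->|/(Wres_neq0 Wz)] := eqVneq (Wres i0 s) 0.
    by rewrite normr0 expr0n mulr0.
  by rewrite allpos_peE (negbTE npos).
have N0 : (2 ^ N)%:R != 0 :> algC by rewrite pnatr_eq0 -lt0n expn_gt0.
have v0 : #|vext h|%:R != 0 :> algC.
  by have := card_vext h; rewrite pnatr_eq0; case: #|_| => //; rewrite mul0n => /esym/eqP; rewrite expn_eq0.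
have := sum_W_even_fibre Wz s; rewrite ninv_pe natrM => e.
rewrite thetaE; set S := \sum_(A | _) _.
have -> : S = \sum_(A in [set vcob (pe h s) B | B : V]) `|W (cl 0 A s)| ^+ 2.
  rewrite /S big_mkcond [RHS]big_mkcond; apply: eq_bigr => A _.
  case: imsetP => [[B _ ->]|nim]; first by rewrite vwt_cob eqxx.
  case: ifP => // /eqP wA; have : A \notin vperp (pe h s).
    by rewrite -im_vcobE; apply/imsetP.
  rewrite inE negb_forall => /existsP[B]; rewrite negb_imply => /andP[/eqP sB dB].
  suff -> : W (cl 0 A s) = 0 by rewrite normr0 expr0n.
  apply: (spin_stable0 (W := fun g => W g) (@WJ _ _ _ i0) Wz 0 sB).
  have /allposP -> // : allpos (pe h s) by rewrite allpos_peE.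
  by rewrite wA mulr0 !add0r; case: (F2_cases (vdot B A)) dB => -> //; rewrite eqxx.
move: e; set S' := \sum_(A in _) _ => e.
apply: (mulfI N0); apply: (mulfI v0).
transitivity (2 * (#|vext h|%:R * (ninv s)%:R * S')); first by field.
by rewrite -e; field.
Qed.

End Theta.

(** * Cycles and their centralizers *)

Section PermOrbits.
Variable T : finType.
Implicit Types (c y u s : {perm T}) (x z : T).

Lemma fibre_cycle_exists (f : T -> nat) :
  exists c : {perm T}, forall x z, (z \in porbit c x) = (f z == f x).
Proof.
pose p x := enum [pred z | f z == f x].
have pE x z : f z = f x -> p z = p x by move=> e; rewrite /p e.
have mem_p x z : (z \in p x) = (f z == f x) by rewrite mem_enum inE.
have nextp x : next (p x) x \in p x by rewrite mem_next mem_p.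
have fn x : f (next (p x) x) = f x by apply/eqP; rewrite -mem_p.
have inj : injective (fun x => next (p x) x).
  move=> x z /= e; have exz : f x = f z by rewrite -fn e fn.
  have up : uniq (p z) by rewrite enum_uniq.
  have e' : next (p z) x = next (p z) z by rewrite -e (pE z x exz).
  by rewrite -(prev_next up x) e' prev_next.
exists (perm inj) => x z; apply/idP/idP.
  case/porbitP => i ->; elim: i => [|i /eqP IH]; first by rewrite perm1.
  by rewrite expgSr permM permE fn IH.
move=> e; have cyc : fcycle (perm inj) (p x).
  have := cycle_next (enum_uniq [pred z | f z == f x]); rewrite -/(p x).
  apply: sub_in_cycle (allss _) => a b ha _ /=; rewrite permE.
  by rewrite (pE x a) //; apply/eqP; rewrite -mem_p.
have : z \in p x by rewrite mem_p.
have := fconnect_cycle cyc (_ : x \in p x); rewrite mem_p eqxx => /(_ isT) <-.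
by case/connectP => q /fpathP[m ->] ->; rewrite last_traject -permX mem_porbit.
Qed.

Lemma expg_porbit_eq c x i j :
  ((c ^+ i)%g x == (c ^+ j)%g x) = (i == j %[mod #|porbit c x|]).
Proof.
set m := #|porbit c x|; have m0 : (0 < m)%N by apply/card_gt0P; exists x; exact: porbit_id.
have redu k : (c ^+ k)%g x = nth x (traject c x m) (k %% m).
  rewrite nth_traject ?ltn_mod // permX {1}(divn_eq k m) addnC iterD; congr iter.
  elim: (k %/ m)%N => [|q IH] //; by rewrite mulSn addnC iterD iter_porbit IH.
by rewrite !redu nth_uniq ?size_traject ?ltn_mod ?uniq_traject_porbit.
Qed.

(** [a] and [a'] select base points in the common orbits. [u] sends a power of [c] applied to the
    first to the same power of [y] applied to the second, which is well defined because the orbit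
    lengths agree. *)
Lemma conj_build c y (a a' : T -> T) :
    (forall x, porbit c x = porbit y x) ->
    (forall x, a x \in porbit c x) -> (forall x, a' x \in porbit c x) ->
    (forall x z, z \in porbit c x -> a z = a x) -> (forall x z, z \in porbit c x -> a' z = a' x) ->
  exists u, [/\ (c ^ u)%g = y, forall x, u x \in porbit c x & forall x, u (a x) = a' x].
Proof.
move=> cy ax a'x aE a'E.
have ex x : exists i, x == (c ^+ i)%g (a x).
  have : x \in porbit c (a x) by rewrite porbit_sym ax.
  by case/porbitP => i {1}->; exists i.
pose t x := xchoose (ex x); have tE x : x = (c ^+ t x)%g (a x) := eqP (xchooseP (ex x)).
pose w x := (y ^+ t x)%g (a' x).
have pa x : porbit c (a x) = porbit c x by apply/eqP; rewrite eq_porbit_mem ax.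
have pa' x : porbit y (a' x) = porbit c x by rewrite -cy; apply/eqP; rewrite eq_porbit_mem a'x.
have wE x i : x = (c ^+ i)%g (a x) -> w x = (y ^+ i)%g (a' x).
  move=> e; apply/eqP; rewrite expg_porbit_eq pa' -(pa x) -expg_porbit_eq -tE.
  by rewrite -e.
have wo x : w x \in porbit c x by rewrite -pa' mem_porbit.
have winj : injective w.
  move=> x z e; have xz : z \in porbit c x.
    by rewrite porbit_sym; have := wo z; rewrite -e -!eq_porbit_mem => /eqP <-; rewrite eq_porbit_mem porbit_sym.
  move: e; rewrite /w (a'E _ _ xz) => /eqP; rewrite expg_porbit_eq pa' -(pa x) -expg_porbit_eq.
  by rewrite -tE -(aE _ _ xz) -tE => /eqP.
exists (perm winj); split=> [|x|x].
- apply/permP => z; rewrite -[z](permKV (perm winj)); move: (_ z) => {z}x.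
  rewrite -permM -conjgC permM !permE (wE (c x) (t x).+1).
    have cx : c x \in porbit c x by apply: (mem_porbit _ 1).
    by rewrite (a'E _ _ cx) expgSr permM.
  have cx : c x \in porbit c x by apply: (mem_porbit _ 1).
  by rewrite (aE _ _ cx) expgSr permM -tE.
- by rewrite permE.
rewrite permE (wE _ 0%N); first by rewrite (a'E _ _ (ax x)) perm1.
by rewrite (aE _ _ (ax x)) perm1.
Qed.

Lemma porbit_cent c s x : commute c s -> porbit c (s x) = [set s z | z in porbit c x].
Proof.
move=> cs; have E i : (c ^+ i)%g (s x) = s ((c ^+ i)%g x).
  by rewrite -!permM (commuteX i (commute_sym cs)).
apply/setP => z; apply/porbitP/imsetP => [[i ->]|[_ /porbitP[i ->] ->]].
  by exists ((c ^+ i)%g x); rewrite ?mem_porbit.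
by exists i; rewrite E.
Qed.

Lemma porbit_conj c u x : porbit (c ^ u)%g (u x) = [set u z | z in porbit c x].
Proof.
have E i : ((c ^ u) ^+ i)%g (u x) = u ((c ^+ i)%g x).
  by rewrite -conjXg -!permM -conjgC.
apply/setP => z; apply/porbitP/imsetP => [[i ->]|[_ /porbitP[i ->] ->]].
  by exists ((c ^+ i)%g x); rewrite ?mem_porbit.
by exists i; rewrite E.
Qed.
End PermOrbits.

Section Choices.
Variables (T : finType) (f : T -> nat).

(** Applied to the block labels, this lists the ordered systems of representatives; a list suits the
    expansion of a product of sums in [fam_prod_young]. *)
Fixpoint choices (r : seq nat) : seq (seq T) :=
  if r is i :: r' then [seq x :: L | x <- enum [pred x | f x == i], L <- choices r']
  else [:: [::]].

Lemma mem_choices r L : (L \in choices r) = (map f L == r).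
Proof.
elim: r L => [|i r IH] L; first by rewrite inE; case: L.
apply/allpairsP/eqP => [[[x L'] /= [+ + ->]]|].
  by rewrite mem_enum inE IH => /eqP /= -> /eqP ->.
case: L => //= x L [e1 e2]; exists (x, L); split=> //=; first by rewrite mem_enum inE e1.
by rewrite IH e2.
Qed.

Lemma choices_uniq r : uniq (choices r).
Proof.
elim: r => //= i r IH; apply: allpairs_uniq; rewrite ?enum_uniq //.
by move=> [x L] [x' L'] _ _ /= [-> ->].
Qed.

Lemma size_choices r : size (choices r) = (\prod_(i <- r) #|[set x | f x == i]|)%N.
Proof.
elim: r => [|i r IH] /=; first by rewrite big_nil.
by rewrite size_allpairs IH big_cons -cardE cardsE.
Qed.
End Choices.

Lemma uniq_map_inj (T U : eqType) (f : T -> U) (s : seq T) :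
  uniq (map f s) -> {in s &, injective f}.
Proof.
elim: s => //= a s IH /andP[na /IH inj] x y; rewrite !inE => /predU1P[->|xs] /predU1P[->|ys] // e.
- by rewrite e map_f in na.
- by rewrite -e map_f in na.
exact: inj.
Qed.

Section DeltaSum.
Variable N : nat.
Implicit Types (R : seq 'I_N) (A : {ffun 'I_N -> 'F_2}).

Lemma delta_sumE R x : (\sum_(y <- R) vdelta y) x = (count_mem x R)%:R.
Proof.
elim: R => [|y R IH]; first by rewrite big_nil ffunE.
by rewrite big_cons ffunE IH ffunE /= natrD eq_sym.
Qed.

Lemma vwt_delta_sum R : vwt (\sum_(y <- R) vdelta y) = (size R)%:R.
Proof.
elim: R => [|y R IH]; first by rewrite big_nil /vwt big1 // => x _; rewrite ffunE.
by rewrite big_cons vwtD IH vwt_delta /= -natr1 addrC.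
Qed.

Lemma vdot_delta_sum R A : vdot A (\sum_(y <- R) vdelta y) = \sum_(y <- R) A y.
Proof.
elim: R => [|y R IH]; first by rewrite !big_nil /vdot big1 // => x _; rewrite ffunE mulr0.
by rewrite !big_cons vdotDr IH [vdot A _]vdotC vdot_delta.
Qed.
End DeltaSum.

Section CycleElements.
Variables (n N : nat) (h : perm_emb n N).
Notation V := {ffun 'I_N -> 'F_2}.
Notation cl := (cl h).
Notation cX := (cX h).
Implicit Types (c s : 'S_n) (J R : seq 'I_N).

Lemma cXX x : (cX x * cX x = 1)%g.
Proof.
rewrite /cX clM pe1 vact1 vinv1 vaddxx mulg1 !add0r.
congr (_, _, _); rewrite /vbeta big1 // => y _; rewrite big1 // => z zy.
rewrite !ffunE; case: (eqVneq y x) zy => [->|_]; case: (eqVneq z x) => [->|_];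
  by rewrite ?ltnn ?mul0r ?mulr0.
Qed.

Lemma cX_prodX x R : x \notin R -> ~~ odd (size R) -> (cX x * prodX h R = prodX h R * cX x)%g.
Proof.
move=> xR ev; have [d ->] := prodXE h R; rewrite cX_comm vwt_delta_sum delta_sumE.
by rewrite (count_memPn xR) addr0 F2_natr (negbTE ev) add0r.
Qed.

(* A permutation times one generator from each cycle; by [moved_same_orbits] the
   choice of the generators does not matter up to conjugation if there are oddly many. *)
Definition gel c J : cliff h := (ciota h c * prodX h J)%g.

Lemma gelJ c J s : (gel c J ^ ciota h s = gel (c ^ s) (map (pe h s) J))%g.
Proof. by rewrite /gel conjMg ciotaJ prodXJ. Qed.

Lemma prS_gel c J : prS (gel c J) = c.
Proof. by rewrite prSM; have [d ->] := prodXE h J; rewrite /prS /= mulg1. Qed.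

Lemma gelE c J : exists d, gel c J = cl d (\sum_(x <- J) vdelta x) c.
Proof.
have [d e] := prodXE h J; exists d; rewrite /gel e /ciota clM pe1 vact0 vinv0 vbeta0l.
by rewrite !addr0 !add0r mulg1.
Qed.

Lemma vdeg_gel c J : vdeg (gel c J) = (size J)%:R.
Proof. by have [d ->] := gelE c J; rewrite /vdeg /= vwt_delta_sum. Qed.

Section Move.
Variable c : 'S_n.
Notation orb j := (porbit (pe h c) j).

Definition moved J J' := exists2 k : cliff h, prS k = 1%g & (gel c J ^ k = gel c J')%g.

Lemma moved_refl J : moved J J.
Proof. by exists 1%g => //; rewrite conjg1. Qed.

Lemma moved_trans J2 J1 J3 : moved J1 J2 -> moved J2 J3 -> moved J1 J3.
Proof.
move=> [k k1 e] [k' k1' e']; exists (k * k')%g; first by rewrite prSM k1 k1' mulg1.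
by rewrite conjgM e e'.
Qed.

Lemma moved_rcons x R : x \notin R -> ~~ odd (size R) -> moved (x :: R) (rcons R x).
Proof.
move=> xR ev; exists 1%g => //; rewrite conjg1 /gel.
by rewrite prodX_cons prodX_rcons cX_prodX.
Qed.

(** Conjugate by the generator at [x]: it commutes with the even product over [R], and passing
    through [c] turns it into the generator at the next point of the cycle. *)
Lemma moved_step x R : x \notin R -> ~~ odd (size R) -> moved (x :: R) (pe h c x :: R).
Proof.
move=> xR ev; exists (cX x) => //; apply: (mulgI (cX x)); rewrite -conjgC.
rewrite /gel !prodX_cons !mulgA -[(ciota h c * cX x * prodX h R * cX x)%g]mulgA -cX_prodX //.
have -> : (cX x * ciota h c = ciota h c * cX (pe h c x))%g by rewrite -cXJ -conjgC.
by rewrite !mulgA -!(mulgA (ciota h c) (cX _) (cX _)) !cXX !mulg1.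
Qed.

Lemma moved_orb x y R : y \in orb x -> (forall z, z \in R -> z \notin orb x) -> ~~ odd (size R) ->
  moved (x :: R) (rcons R y).
Proof.
move=> yx dis ev; have nR z : z \in orb x -> z \notin R.
  by move=> zx; apply/negP => /dis; rewrite zx.
apply: (@moved_trans (y :: R)); last by apply: moved_rcons => //; apply: nR.
case/porbitP: yx => i ->; elim: i => [|i IH]; first by rewrite perm1; apply: moved_refl.
apply: (moved_trans IH); rewrite expgSr permM; apply: moved_step => //.
by apply: nR; apply: mem_porbit.
Qed.

(** The generators are replaced one at a time: the front one is carried around its cycle and sent to
    the back. The number of remaining generators is even, so no sign arises. *)
Lemma moved_same_orbits J J' : map (fun j => orb j) J = map (fun j => orb j) J' ->
  uniq (map (fun j => orb j) J) -> odd (size J) -> moved J J'.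
Proof.
(* Rotated form for the induction: [J2] is still to be replaced, [J1] has been replaced already. *)
move=> e u od; suff H J2 J2' J1 : map (fun j => orb j) J2 = map (fun j => orb j) J2' ->
   uniq (map (fun j => orb j) (J2 ++ J1)) -> odd (size (J2 ++ J1)) -> moved (J2 ++ J1) (J1 ++ J2').
  by have := H J J' [::] e; rewrite cats0 => /(_ u od).
elim: J2 J2' J1 {e u od J J'} => [|x J2 IH] [|y J2'] J1 //=; first by rewrite cats0 => *; apply: moved_refl.
move=> [exy e] /andP[nx u] ev; apply: (@moved_trans (rcons (J2 ++ J1) y)).
  apply: moved_orb => //; first by rewrite exy porbit_id.
  move=> z zR; apply: contra nx => zx; apply/mapP; exists z => //.
  by apply/eqP; rewrite eq_sym eq_porbit_mem.
rewrite rcons_cat -cat_rcons; apply: IH => //.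
  rewrite -rcons_cat map_rcons rcons_uniq u andbT.
  by rewrite -exy nx.
by rewrite -rcons_cat size_rcons.
Qed.

(** The left side is additive on stable vectors, so one cycle suffices. For a cycle of length m it
    equals (m - 1) + m + 1, the last term coming from the single chosen point on the cycle. *)
Lemma stable_parity J A :
    (forall x, exists2 j, j \in J & x \in orb j) -> uniq (map (fun j => orb j) J) -> odd (size J) ->
    vact A (pe h c) = A ->
  vinv (pe h c) A + vwt A * vwt (\sum_(x <- J) vdelta x) + vdot A (\sum_(x <- J) vdelta x) = 0.
Proof.
move=> cov u od hA; rewrite vwt_delta_sum F2_natr od mulr1 vdot_delta_sum.
have stO x : vact (vset (orb x)) (pe h c) = vset (orb x) by rewrite vact_set imset_porbit.
have Ast x y : y \in orb x -> A y = A x.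
  case/porbitP => i ->; elim: i => [|i IH]; first by rewrite perm1.
  by rewrite expgSr permM -IH -{1}hA ffunE permK.
have uJ : uniq J := map_uniq u.
have only x j j' : j \in J -> j' \in J -> x \in orb j -> x \in orb j' -> j' = j.
  move=> jJ j'J; rewrite -!eq_porbit_mem => /eqP e1 /eqP e2.
  by apply: (uniq_map_inj u); rewrite // -e1 -e2.
pose F B := vinv (pe h c) B + vwt B + \sum_(x <- J) B x.
have Fo j : j \in J -> F (vset (orb j)) = 0.
  move=> jJ; rewrite /F vinv_porbit vwt_set (bigD1_seq j) //= big1_seq ?addr0 => [|x].
    by rewrite ffunE porbit_id -[RHS](F2_addxx (#|orb j|%:R + 1)) /=; ring.
  case/andP=> nxj xJ; rewrite ffunE; case: (boolP (x \in orb j)) => // xj.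
  by rewrite (only x j x) ?eqxx ?porbit_id in nxj.
have -> : A = \sum_(j <- [seq j <- J | A j != 0]) vset (orb j).
  apply/ffunP => x; have [j jJ xj] := cov x.
  rewrite (Ast _ _ xj) big_filter big_mkcond (bigD1_seq j) //= !ffunE.
  rewrite sum_ffunE big1_seq ?addr0 => [|j' /andP[nj' j'J]].
    by case: eqVneq => [->|nz]; rewrite ffunE ?xj //; case: (F2_cases (A j)) nz => -> //; rewrite eqxx.
  case: ifP; rewrite ffunE // => _; case: (boolP (x \in orb j')) => // xj'.
  by rewrite (only x j j') ?eqxx in nj'.
rewrite -/(F _); have : {subset [seq j <- J | A j != 0] <= J} by move=> j; rewrite mem_filter => /andP[].
elim: [seq j <- J | A j != 0] => [|j s IH] sub.
  rewrite big_nil /F vinv0 add0r /vwt !big1 ?addr0 // => x _; by rewrite ffunE.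
have st (s' : seq 'I_N) : vact (\sum_(j <- s') vset (orb j)) (pe h c) = \sum_(j <- s') vset (orb j).
  by elim: s' => [|j' s' IH']; rewrite ?big_nil ?vact0 // big_cons vactD IH' stO.
rewrite big_cons; have := IH (fun x xs => sub x (mem_behead (s := j :: s) xs)).
have := Fo j (sub j (mem_head _ _)); rewrite /F vinv_stableD // vwtD => e1 e2.
rewrite (eq_bigr (fun x => vset (orb j) x + (\sum_(j <- s) vset (orb j)) x)); last by move=> x _; rewrite ffunE.
have := congr2 +%R e1 e2; rewrite addr0 big_split /= => e3; rewrite -[RHS]e3. by rewrite [X in X + _ = _]addrACA [LHS]addrACA.
Qed.
End Move.
End CycleElements.

Section CycleCentralizer.
Variables (n N : nat) (h : perm_emb n N) (mu : seq nat).
Notation V := {ffun 'I_N -> 'F_2}.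
Notation f := (fun x : 'I_n => reshape_index mu x).
Hypothesis sum_mu : sumn mu = n.
Hypothesis uniq_mu : uniq mu.
Variables (c : 'S_n) (L : seq 'I_n).
Hypothesis cE : forall x z, (z \in porbit c x) = (f z == f x).
Hypothesis LE : map f L = iota 0 (size mu).

Definition extra : seq 'I_N := enum [pred y | y \notin codom (pt h)].
Definition basis_pts (L' : seq 'I_n) : seq 'I_N := map (pt h) L' ++ extra.
Notation J := (basis_pts L).
Notation g := (gel h c J).
Notation orb y := (porbit (pe h c) y).
Hypothesis oddJ : odd (size J).

Lemma lt_f (x : 'I_n) : (f x < size mu)%N.
Proof. by rewrite reshape_indexP // sum_mu. Qed.

Lemma card_orb x : #|porbit c x| = nth 0%N mu (f x).
Proof.
by rewrite -(card_reshape_index sum_mu); apply: eq_card => z; rewrite inE cE.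
Qed.

Lemma orb_pt x z : (pt h z \in orb (pt h x)) = (f z == f x).
Proof.
have E i : ((pe h c) ^+ i)%g (pt h x) = pt h ((c ^+ i)%g x).
  by elim: i => [|i IH]; rewrite ?perm1 // !expgSr !permM IH pe_pt.
rewrite -cE; apply/porbitP/porbitP => -[i e]; exists i; first by apply: (@pt_inj _ _ h); rewrite e E.
by rewrite e E.
Qed.

Lemma orb_out y z : y \notin codom (pt h) -> (z \in orb y) = (z == y).
Proof.
move=> ny; have E i : ((pe h c) ^+ i)%g y = y.
  by elim: i => [|i IH]; rewrite ?perm1 // !expgSr !permM IH pe_out.
by apply/porbitP/eqP => [[i ->]|->]; [rewrite E | exists 0%N; rewrite perm1].
Qed.

Lemma mem_extra y : (y \in extra) = (y \notin codom (pt h)).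
Proof. by rewrite mem_enum inE. Qed.

Lemma J_cover y : exists2 j, j \in J & y \in orb j.
Proof.
case: (pt_cases h y) => [[x ->]|ny].
  have : f x \in map f L by rewrite LE mem_iota add0n lt_f.
  case/mapP => l lL e; exists (pt h l); last by rewrite orb_pt e.
  by rewrite mem_cat map_f.
by exists y; rewrite ?porbit_id // mem_cat mem_extra ny orbT.
Qed.

Lemma uniq_orb L' : map f L' = iota 0 (size mu) -> uniq (map (fun j => orb j) (basis_pts L')).
Proof.
move=> e; have uL : uniq (map f L') by rewrite e iota_uniq.
rewrite map_inj_in_uniq.
  rewrite cat_uniq map_inj_uniq ?(map_uniq uL) ?enum_uniq ?andbT /=; last exact: pt_inj.
  by apply/hasPn => y; rewrite mem_extra; apply: contra => /mapP[x _ ->]; apply: codom_f.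
move=> y z; rewrite !mem_cat !mem_extra => hy hz /= e'.
have : z \in orb y by rewrite e' porbit_id.
case: (boolP (y \in codom (pt h))) hy => [cy|ny _]; last by rewrite orb_out // => /eqP.
rewrite orbF => /mapP[x xL ex]; case: (boolP (z \in codom (pt h))) hz => [cz|nz _]; last first.
  by move=> _; have : y \in orb z; [rewrite -e' porbit_id | rewrite orb_out // => /eqP].
rewrite orbF => /mapP[x' x'L ->]; rewrite ex orb_pt => /eqP ef.
by congr (pt h _); apply: (uniq_map_inj uL).
Qed.

Lemma cent_f s x : commute c s -> f (s x) = f x.
Proof.
move=> cs; apply/eqP; rewrite -(nth_uniq 0%N _ _ uniq_mu) ?lt_f // -!card_orb porbit_cent //.
by rewrite card_imset //; apply: perm_inj.
Qed.

Lemma cliff_vecM (a b : cliff h) : (a * b)%g.1.2 = vact a.1.2 (pe h (prS b)) + b.1.2.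
Proof. by case: a b => [[d A] s] [[d' A'] t]. Qed.

Lemma g_commutes k : prS k = 1%g -> vact k.1.2 (pe h c) = k.1.2 -> (k * g = g * k)%g.
Proof.
case: k => [[d A] s]; rewrite /prS /= => -> hA.
have [d0 eg] := gelE h c J.
have cVg : (cV h A * g = g * cV h A)%g.
  by rewrite eg cV_stable // stable_parity ?add0r //; [exact: J_cover | exact: uniq_orb].
case: (F2_cases d) => ->; first exact: cVg.
have -> : ((1, A, 1%g) : cliff h) = (cz h * cV h A)%g by rewrite /cV czM addr0.
rewrite -mulgA cVg mulgA. by rewrite (cz_central g) mulgA.
Qed.

(** If [k] did this, its permutation part would centralize [c] and, the cycle lengths being
    distinct, preserve every cycle. It moves the chosen generators within their cycles, and
    [moved_same_orbits] undoes this by an element with trivial permutation part. What remains is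
    given by a stable vector up to sign, which commutes with [g]. *)
Lemma g_nonconj k : (g ^ k)%g <> (cz h * g)%g.
Proof.
move=> e; have cs : commute c (prS k).
  have := congr1 (@prS _ _ h) e; rewrite prSJ prSM !prS_gel /prS /= mul1g => ec.
  by rewrite /commute conjgC ec.
pose L1 := map (prS k) L.
have J1E : map (pe h (prS k)) J = basis_pts L1.
  rewrite map_cat /basis_pts -!map_comp; congr (_ ++ _).
    by apply: eq_map => x /=; rewrite pe_pt.
  rewrite -[RHS]map_id; apply/eq_in_map => y; rewrite mem_extra => ny.
  by rewrite pe_out.
have [|||k2 k21 e2] := @moved_same_orbits _ _ h c (map (pe h (prS k)) J) J.
- rewrite -map_comp; apply/eq_in_map => y; rewrite mem_cat mem_extra => /orP[/mapP[x xL ->]|ny] /=.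
    by apply/eqP; rewrite eq_porbit_mem pe_pt orb_pt cent_f.
  by rewrite pe_out.
- rewrite J1E uniq_orb // -LE -map_comp; apply: eq_map => x /=; exact: cent_f.
- by rewrite size_map.
pose k1 := (ciota h (prS k)^-1 * k)%g.
have eJ : (g ^ ciota h (prS k) = gel h c (map (pe h (prS k)) J))%g.
  by rewrite gelJ conjgE cs mulKg.
have ek1 : (gel h c (map (pe h (prS k)) J) ^ k1 = cz h * g)%g.
  rewrite -eJ -conjgM mulgA -ciotaM mulgV.
  by rewrite (_ : ciota h 1 = 1%g) // mul1g.
pose k3 := (k2^-1 * k1)%g.
have e3 : (g ^ k3 = cz h * g)%g by rewrite conjgM -{1}e2 conjgK.
have k31 : prS k3 = 1%g.
  have : prS (k2 * k3)%g = prS k1 by rewrite mulKVg.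
  by rewrite prSM k21 mul1g => ->; rewrite prSM /prS /= mulVg.
have st : vact k3.1.2 (pe h c) = k3.1.2.
  have : (g * k3 = k3 * (cz h * g))%g by rewrite -e3 -conjgC.
  have pz : prS (cz h) = 1%g by [].
  have vz : (cz h).1.2 = 0 by [].
  move/(congr1 (fun q : cliff h => q.1.2)).
  rewrite (cliff_vecM g k3) (cliff_vecM k3 (cz h * g)%g) (cliff_vecM (cz h) g) k31 pe1 vact1 prSM prS_gel.
  rewrite pz vz mul1g vact0 add0r => e4; apply: (@addIr _ g.1.2).
  by rewrite -e4 addrC.
have := g_commutes k31 st; rewrite [RHS]conjgC e3 => /mulgI /esym.
move/(congr1 (fun q => q * g^-1)%g); rewrite mulgK mulgV => /(congr1 (fun q : cliff h => q.1.1)).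
by [].
Qed.

(** A centralizing permutation preserves each cycle and is determined by the images of the base
    points in [L]. *)
Lemma card_cent_c : (#|[set s : 'S_n | (c * s == s * c)%g]| <= \prod_(m <- mu) m)%N.
Proof.
have -> : (\prod_(m <- mu) m = size (choices f (iota 0 (size mu))))%N.
  rewrite size_choices [RHS](_ : _ = \prod_(i < size mu) nth 0 mu i)%N.
    by rewrite (big_nth 0%N) big_mkord.
  rewrite -[X in iota _ X]subn0 big_mkord; apply: eq_bigr => i _.
  exact: card_reshape_index.
rewrite cardE -(size_map (fun s : 'S_n => map s L)); apply: uniq_leq_size.
  rewrite map_inj_in_uniq ?enum_uniq // => s t; rewrite !mem_enum !inE => /eqP cs /eqP ct e.
  apply/permP => x; have : f x \in map f L by rewrite LE mem_iota add0n lt_f.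
  case/mapP => l lL ex; have : x \in porbit c l by rewrite cE ex.
  case/porbitP => i ->; rewrite -!permM -(commuteX i (commute_sym cs)) -(commuteX i (commute_sym ct)).
  by rewrite !permM; congr ((c ^+ i)%g _); move/eq_in_map: e => ->.
move=> _ /mapP[s + ->]; rewrite mem_enum inE => /eqP cs; rewrite mem_choices -LE -map_comp.
by apply/eqP; apply: eq_map => x /=; apply: cent_f.
Qed.

(** Centralizing elements with trivial permutation part consist of a sign and a vector constant on
    cycles, hence determined on [J]. Every other nonempty fibre of the projection to permutations is
    a coset of these. *)
Lemma card_cent_g : (#|'C[g]%g| <= 2 ^ (size J).+1 * \prod_(m <- mu) m)%N.
Proof.
set C := 'C[g]%g; pose K := [set k in C | prS k == 1%g].
have memK t k : (k \in [set k in C | prS k == t]) = (k \in C) && (prS k == t) by rewrite in_set.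
have leK : (#|K| <= 2 ^ (size J).+1)%N.
  pose F (k : cliff h) := (k.1.1, map_tuple (fun j => k.1.2 j) (in_tuple J)).
  have -> : (2 ^ (size J).+1 = #|{: 'F_2 * (size J).-tuple 'F_2}|)%N.
    by rewrite card_prod card_tuple !card_ord expnS.
  rewrite -(card_in_imset (f := F)) ?max_card // => k k'; rewrite !memK.
  have st (q : cliff h) : (q \in C) && (prS q == 1%g) -> vact q.1.2 (pe h c) = q.1.2.
    rewrite /C => /andP[/cent1P cq /eqP q1].
    have := congr1 (fun q : cliff h => q.1.2) cq; rewrite (cliff_vecM g q) (cliff_vecM q g) q1 pe1 vact1 prS_gel.
    by move=> e5; apply: (@addIr _ g.1.2); rewrite [RHS]addrC -e5.
  move=> hk hk'; have sk := st _ hk; have sk' := st _ hk'.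
  case/andP: hk => _ /eqP; case/andP: hk' => _ /eqP.
  move: sk sk'; rewrite /F; case: k k' => [[d A] s] [[d' A'] s']; rewrite /prS /= => sA sA' -> -> [-> e].
  congr (_, _, _); apply/ffunP => y; have [j jJ] := J_cover y.
  have E (B : V) i : vact B (pe h c) = B -> B (((pe h c) ^+ i)%g j) = B j.
    move=> hB; elim: i => [|i IH]; first by rewrite perm1.
    by rewrite expgSr permM -IH -{1}hB ffunE permK.
  by case/porbitP => i ->; rewrite !E //; move/eq_in_map: e => ->.
rewrite -sum1_card (partition_big (@prS _ _ h) (fun s => (c * s == s * c)%g)) /=; last first.
  move=> k /cent1P ck; have := congr1 (@prS _ _ h) ck.
  by rewrite (prSM g k) (prSM k g) prS_gel => ->.
apply: (@leq_trans (\sum_(s : 'S_n | (c * s == s * c)%g) 2 ^ (size J).+1)); last first.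
  rewrite sum_nat_const mulnC leq_mul2l; apply/orP; right; apply: leq_trans card_cent_c.
  by rewrite cardsE.
apply: leq_sum => s _; rewrite sum1dep_card.
case: (set_0Vmem [set k in C | prS k == s]) => [->|[k0 hk0]]; first by rewrite cards0.
apply: leq_trans leK; set S := [set k | _].
rewrite -[#|S|](card_imset (mem S) (mulgI k0^-1%g)); apply: subset_leq_card.
apply/subsetP => k' /imsetP[k hk ek]; rewrite {k'}ek; have {}hk : k \in [set k in C | prS k == s] by [].
move: hk0 hk; rewrite !memK => /andP[C0 /eqP s0] /andP[C1 /eqP s1].
rewrite groupMl ?groupV // C1 /=; apply/eqP; have : prS (k0 * (k0^-1 * k))%g = s by rewrite mulKVg.
by rewrite prSM s0 => e; apply: (mulgI s); rewrite mulg1.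
Qed.

End CycleCentralizer.

(** * Existence and odd support of spin characters *)

Lemma irr_central_mul (gT : finGroupType) (G : {group gT}) (i : Iirr G) z :
  z \in 'Z(G)%g -> exists a : algC, forall x, x \in G -> 'chi_i (z * x)%g = a * 'chi_i x.
Proof.
move=> zZ; have zG : z \in G by case/setIP: zZ.
have : z \in 'Z('chi_i)%CF by move: zZ; rewrite -cap_cfcenter_irr => /bigcapP/(_ i isT).
rewrite -[X in cfcenter X]irrRepr cfcenter_repr inE => /andP[_ /is_scalar_mxP[a ea]].
exists a => x xG; rewrite -!irrRepr !cfunE groupM ?xG // !mulr1n repr_mxM // ea.
by rewrite mul_scalar_mx mxtraceZ.
Qed.

Section SpinExists.
Variables (n N : nat) (h : perm_emb n N).

(** If all irreducible characters took equal values at [g] and [cz h * g], column orthogonality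
    would make the two conjugate. In a character that separates them, the central involution acts by
    -1. *)
Lemma spin_irr_exists (g : cliff h) : (forall k, (g ^ k)%g <> (cz h * g)%g) ->
  exists2 i : Iirr [set: cliff h], (forall x, 'chi_i (cz h * x)%g = - 'chi_i x) & 'chi_i g != 0.
Proof.
move=> nc; case: (pickP [pred i : Iirr [set: cliff h] | 'chi_i (cz h * g)%g != 'chi_i g]) => [i /= ni|all_eq].
  have czZ : cz h \in 'Z([set: cliff h])%g.
    by apply/centerP; split; rewrite ?inE // => x _; apply: cz_central.
  have [a ea] := irr_central_mul i czZ.
  have a2 : a ^+ 2 = 1.
    apply: (mulIf (irr1_neq0 i)); rewrite mul1r expr2 -mulrA -!ea ?inE //.
    by rewrite mulgA czz mul1g.
  have g0 : 'chi_i g != 0 by apply: contraNneq ni => g0; rewrite ea ?inE // g0 mulr0.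
  exists i => // x; rewrite ea ?inE //; suff -> : a = -1 by rewrite mulN1r.
  move/eqP: a2; rewrite sqrf_eq1 => /orP[/eqP a1|/eqP //].
  by case/eqP: ni; rewrite ea ?inE // a1 mul1r.
have := second_orthogonality_relation g (in_setT (cz h * g)%g).
have -> : (g \in (cz h * g)%g ^: [set: cliff h])%g = false.
  apply/imsetP => -[k _ e]; apply: (nc k^-1%g); by rewrite {1}e conjgK.
rewrite (eq_bigr (fun i => 'chi_i g * ('chi_i g)^*)); last first.
  by move=> i _; have /eqP -> := negbFE (all_eq i).
rewrite second_orthogonality_relation ?inE // class_refl mulr1n mulr0n => /eqP.
by rewrite pnatr_eq0 -leqn0 leqNgt cardG_gt0.
Qed.

End SpinExists.

Section SpinSupport.
Variables (n N : nat) (h : perm_emb n N) (i0 : Iirr [set: cliff h]).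
Notation W := 'chi_i0.
Hypothesis Wz : forall g, W (cz h * g)%g = - W g.
Variables (g : cliff h) (m b : nat).
Hypothesis g_odd : vdeg g = 1.
Hypothesis b_gt0 : (0 < b)%N.
Hypothesis m_gt0 : (0 < m)%N.
Hypothesis g_nc : forall k, (g ^ k)%g <> (cz h * g)%g.
Hypothesis cent_g : (#|'C[g]%g| <= 2 ^ b.+1 * m)%N.
Hypothesis Wg : `|W g| ^+ 2 = 2 ^+ b.-1 * m%:R.

(** The classes of [g] and [cz h * g] are disjoint, and the bounds on the centralizer and on [W g]
    make them exhaust the half of the norm lying in odd degree. Another odd element with nonzero
    value would exceed it. *)
Lemma spin_odd_support x : vdeg x = 1 -> W x != 0 -> exists t, prS x = (prS g ^ t)%g.
Proof.
move=> dx Wx; have Wg0 : W g != 0.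
  apply/eqP => e; move/eqP: Wg; rewrite e normr0 expr0n /= eq_sym mulf_eq0 expf_eq0 !pnatr_eq0.
  by rewrite andbF /= -leqn0 leqNgt m_gt0.
pose S := (g ^: [set: cliff h])%g; pose S' := [set (cz h * y)%g | y in S].
have WS y : y \in S -> `|W y| ^+ 2 = `|W g| ^+ 2 /\ vdeg y = 1.
  by case/imsetP => k _ ->; rewrite WJ vdegJ.
have WS' y : y \in S' -> `|W y| ^+ 2 = `|W g| ^+ 2 /\ vdeg y = 1.
  case/imsetP => y' /WS[e1 e2] ->; rewrite Wz normrN e1; split=> //.
  rewrite vdegM e2 [vdeg (cz h)](_ : _ = 0) ?add0r // /vdeg /= /vwt big1 // => z _.
  by rewrite ffunE.
have dis : [disjoint S & S'].
  apply/pred0P => y /=; apply/negP => /andP[/imsetP[k _ ek] /imsetP[y' /imsetP[k' _ ->] e]].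
  case: (@g_nc (k * k'^-1)%g); rewrite conjgM -ek e conjMg conjgK; congr (_ * _)%g.
  by rewrite conjgE cz_central mulKg.
have prS' y : y \in S :|: S' -> exists t, prS y = (prS g ^ t)%g.
  case/setUP => [/imsetP[k _ ->]|/imsetP[y' /imsetP[k _ ->] ->]]; exists (prS k).
    by rewrite prSJ.
  by rewrite prSM prSJ [prS (cz h)](_ : _ = 1%g) ?mul1g.
case: (boolP (x \in S :|: S')) => [/prS'//|nx].
have cS' : #|S'| = #|S| by rewrite card_imset //; apply: mulgI.
have := sum_W_odd g_odd Wg0; rewrite (bigID (mem (S :|: S'))) /=.
have -> : \sum_(y | (vdeg y == 1) && (y \in S :|: S')) `|W y| ^+ 2
    = (#|S| * 2)%:R * `|W g| ^+ 2.
  rewrite (eq_bigl (mem (S :|: S'))) => [|y].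
    rewrite (eq_bigr (fun=> `|W g| ^+ 2)) => [|y /setUP[/WS[]|/WS'[]] //].
    rewrite sumr_const cardsU disjoint_setI0 // cards0 subn0 cS'.
    by rewrite addnn -muln2 mulr_natl.
  apply/andP/idP => [[]//|yS]; split=> //; apply/eqP.
  by case/setUP: yS => [/WS[]|/WS'[]].
have : `|W x| ^+ 2 <= \sum_(y | (vdeg y == 1) && (y \notin S :|: S')) `|W y| ^+ 2.
  rewrite (bigD1 x) /=; last by rewrite dx eqxx nx.
  by rewrite lerDl sumr_ge0 // => y _; rewrite exprn_ge0.
set R' := \sum_(y | _) _ => leR eG.
have x0 : 0 < `|W x| ^+ 2 by rewrite exprn_gt0 // normr_gt0.
have : (#|{: cliff h}|%:R : algC) <= 2 * ((#|S| * 2)%:R * `|W g| ^+ 2).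
  have -> : #|{: cliff h}| = (#|'C[g]%g| * #|S|)%N.
    by rewrite -cardsT -(Lagrange (subsetT 'C[g]%g)) -index_cent1 setTI.
  have -> : 2 * ((#|S| * 2)%:R * `|W g| ^+ 2) = (2 ^ b.+1 * m * #|S|)%:R.
    rewrite Wg -[in RHS](prednK b_gt0) !expnS !natrM natrX; ring.
  by rewrite ler_nat leq_mul2r cent_g orbT.
rewrite -eG mulrDr gerDl pmulr_rle0 ?ltr0n // => R0.
by have := lt_le_trans x0 (le_trans leR R0); rewrite ltxx.
Qed.

End SpinSupport.

Section CycleType.
Variable n : nat.

Lemma mem_cycle_type (mu : seq nat) (c : 'S_n) m : sumn mu = n -> 0%N \notin mu ->
    (forall x z : 'I_n, (z \in porbit c x) = (reshape_index mu z == reshape_index mu x)) ->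
  (m \in mu) = [exists x, #|porbit c x| == m].
Proof.
move=> smu n0 cE; have co x : #|porbit c x| = nth 0%N mu (reshape_index mu x).
  by rewrite -(card_reshape_index smu); apply: eq_card => z; rewrite inE cE.
apply/idP/existsP => [mm|[x /eqP <-]]; last first.
  by rewrite co mem_nth // reshape_indexP // smu.
have m0 : (0 < m)%N by rewrite lt0n; apply: contraNneq n0 => <-.
have : (0 < #|[set x : 'I_n | reshape_index mu x == index m mu]|)%N.
  by rewrite (card_reshape_index smu) nth_index.
case/card_gt0P => x; rewrite inE => /eqP e; exists x.
by rewrite co e nth_index.
Qed.

Lemma strict_cycle_type_eq (mu nu : seq nat) (c d t : 'S_n) :
    strict_part mu -> strict_part nu -> sumn mu = n -> sumn nu = n ->
    (forall x z : 'I_n, (z \in porbit c x) = (reshape_index mu z == reshape_index mu x)) ->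
    (forall x z : 'I_n, (z \in porbit d x) = (reshape_index nu z == reshape_index nu x)) ->
  d = (c ^ t)%g -> mu = nu.
Proof.
move=> /andP[smu mu0] /andP[snu nu0] emu enu cE dE ed.
have tr : transitive gtn by move=> a b e /= h1 h2; apply: ltn_trans h2 h1.
have ir : irreflexive gtn by move=> a /=; rewrite ltnn.
apply: (irr_sorted_eq tr ir smu snu) => m.
rewrite (mem_cycle_type m emu mu0 cE) (mem_cycle_type m enu nu0 dE) ed.
have co x : #|porbit (c ^ t)%g (t x)| = #|porbit c x|.
  by rewrite porbit_conj card_imset //; apply: perm_inj.
apply/existsP/existsP => -[x /eqP <-]; first by exists (t x); rewrite co.
by exists (t^-1%g x); rewrite -co permKV.
Qed.
End CycleType.

(** * Leading term on Young subgroups *)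

Section EmbOrbits.
Variables (n N : nat) (h : perm_emb n N).

Lemma porbit_pt (y : 'S_n) x z : (pt h z \in porbit (pe h y) (pt h x)) = (z \in porbit y x).
Proof.
have E i : ((pe h y) ^+ i)%g (pt h x) = pt h ((y ^+ i)%g x).
  by elim: i => [|i IH]; rewrite ?perm1 // !expgSr !permM IH pe_pt.
apply/porbitP/porbitP => -[i e]; exists i; first by apply: (@pt_inj _ _ h); rewrite e E.
by rewrite e E.
Qed.

Lemma basis_ptsJ (u : 'S_n) L : map (pe h u) (basis_pts h L) = basis_pts h (map u L).
Proof.
rewrite map_cat /basis_pts -!map_comp; congr (_ ++ _).
  by apply: eq_map => x /=; rewrite pe_pt.
rewrite -[RHS]map_id; apply/eq_in_map => y; rewrite mem_extra => ny.
by rewrite pe_out.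
Qed.

Lemma size_extra : (n + size (extra h))%N = N.
Proof.
rewrite -cardE; have := cardC (mem (codom (pt h))).
by rewrite card_codom ?card_ord //; apply: pt_inj.
Qed.

Lemma card_vextE : #|vext h| = (2 ^ size (extra h))%N.
Proof.
have := card_vext h; rewrite -[in RHS]size_extra expnD [RHS]mulnC => /eqP.
by rewrite eqn_pmul2r ?expn_gt0 // => /eqP.
Qed.
End EmbOrbits.

Section YoungTrace.
Variables (n N : nat) (h : perm_emb n N) (i0 : Iirr [set: cliff h]).
Notation W := 'chi_i0.
Hypothesis Wz : forall g, W (cz h * g)%g = - W g.

Notation rG := 'Chi_i0.

Lemma W_trace g : W g = \tr (rG g).
Proof. by rewrite -irrRepr cfunE inE mulr1n. Qed.

Lemma rG_mul a b : rG (a * b)%g = rG a *m rG b.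
Proof. by rewrite repr_mxM ?inE. Qed.

Lemma rG_cz a : rG (cz h * a)%g = - rG a.
Proof.
have czZ : cz h \in 'Z([set: cliff h])%g.
  by apply/centerP; split; rewrite ?inE // => x _; apply: cz_central.
have : cz h \in 'Z('chi_i0)%CF by move: czZ; rewrite -cap_cfcenter_irr => /bigcapP/(_ i0 isT).
rewrite -[X in cfcenter X]irrRepr cfcenter_repr inE => /andP[_ /is_scalar_mxP[t et]].
rewrite rG_mul et mul_scalar_mx; suff -> : t = -1 by rewrite scaleN1r.
apply: (mulIf (irr1_neq0 i0)); rewrite mulN1r -Wz !W_trace rG_mul et mul_scalar_mx.
by rewrite mxtraceZ.
Qed.

Definition Xset (B : {set 'I_N}) : 'M[algC]_(irr_degree (socle_of_Iirr i0)) := \sum_(x in B) rG (cX h x).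

Lemma Xset_ciota (B : {set 'I_N}) s : [set pe h s x | x in B] = B ->
  Xset B *m rG (ciota h s) = rG (ciota h s) *m Xset B.
Proof.
move=> sB; rewrite mulmx_suml mulmx_sumr -[in RHS]sB big_imset /=; last by move=> x y _ _; apply: perm_inj.
by apply: eq_bigr => x _; rewrite -!rG_mul -cXJ -conjgC.
Qed.

Lemma cX_anti x y : x != y -> rG (cX h x) *m rG (cX h y) = - (rG (cX h y) *m rG (cX h x)).
Proof.
move=> xy; rewrite -!rG_mul -rG_cz; congr (rG _).
have := cX_comm h x 0 (vdelta y); rewrite vwt_delta ffunE (negbTE xy) addr0 addr0.
rewrite -[cl h 0 (vdelta y) 1]/(cX h y) => ->.
by rewrite mulgA; congr (_ * _)%g; rewrite /cX /cV czM addr0.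
Qed.

(** Added to itself with the order of summation exchanged, the double sum loses all its off-diagonal
    terms. *)
Lemma Xset_sq B : Xset B *m Xset B = #|B|%:R%:M.
Proof.
have E : Xset B *m Xset B = \sum_(x in B) \sum_(y in B) rG (cX h x) *m rG (cX h y).
  by rewrite mulmx_suml; apply: eq_bigr => x _; rewrite mulmx_sumr.
have two0 : (2 : algC) != 0 by rewrite pnatr_eq0.
apply: (scalerI two0); rewrite !scaler_nat !mulr2n {2}E exchange_big {1}E -big_split /=.
rewrite (eq_bigr (fun=> (2%:R : algC)%:M)) => [|x xB].
  by rewrite sumr_const -raddfMn /= -raddfD /=; congr (_%:M); rewrite -natrD addnn -muln2 natrM mulr_natl.
rewrite -big_split (bigD1 x) //= big1 ?addr0 => [|y /andP[yB yx]].
  by rewrite -rG_mul cXX repr_mx1 -raddfD.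
by rewrite cX_anti 1?eq_sym // addNr.
Qed.

Lemma Xset_anti (B B' : {set 'I_N}) : [disjoint B & B'] -> Xset B *m Xset B' = - (Xset B' *m Xset B).
Proof.
move=> dis; rewrite mulmx_suml mulmx_suml -sumrN.
rewrite (eq_bigr (fun x => \sum_(y in B') rG (cX h x) *m rG (cX h y))); last first.
  by move=> x _; rewrite mulmx_sumr.
rewrite exchange_big /=; apply: eq_bigr => y yB'; rewrite mulmx_sumr -sumrN.
apply: eq_bigr => x xB; apply: cX_anti; apply/eqP => xy.
by move/pred0P: dis => /(_ x) /=; rewrite xB xy yB'.
Qed.

Section Mu.
Variable mu : seq nat.
Hypothesis sum_mu : sumn mu = n.
Hypothesis mu0 : 0%N \notin mu.
Notation f := (fun x : 'I_n => reshape_index mu x).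
Notation Y := (young_subgroup n mu).

Definition young_proj := #|Y|%:R^-1 *: \sum_(y in Y) rG (ciota h y).
Notation P := young_proj.

Lemma young_projM s : s \in Y -> rG (ciota h s) *m P = P.
Proof.
move=> sY; rewrite /P -scalemxAr mulmx_sumr; congr (_ *: _).
rewrite [RHS](reindex_inj (mulgI s)) /=; apply: eq_big => [y|y _]; first by rewrite groupMl.
by rewrite ciotaM rG_mul.
Qed.

Lemma young_proj_idem : P *m P = P.
Proof.
rewrite {1}/P -scalemxAl mulmx_suml (eq_bigr (fun=> P)); last by move=> s sY; apply: young_projM.
by rewrite sumr_const -scaler_nat scalerA mulVf ?scale1r // pnatr_eq0 -lt0n cardG_gt0.
Qed.

Definition pblk i : {set 'I_N} := [set pt h x | x in [set x | f x == i]].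

Definition young_fam :=
  [seq (Xset (pblk i), (nth 0%N mu i)%:R : algC) | i <- iota 0 (size mu)]
  ++ [seq (Xset [set y], 1) | y <- extra h].

Lemma young_famP : cliff_fam P young_fam.
Proof.
have comm (B : {set 'I_N}) : (forall s, s \in Y -> [set pe h s x | x in B] = B) -> Xset B *m P = P *m Xset B.
  move=> hB; rewrite /P -scalemxAr -scalemxAl mulmx_sumr mulmx_suml; congr (_ *: _).
  by apply: eq_bigr => s /hB; apply: Xset_ciota.
have card_pblk i : #|pblk i| = nth 0%N mu i.
  by rewrite card_imset ?card_reshape_index //; apply: pt_inj.
apply/andP; split.
  rewrite all_cat; apply/andP; split; apply/allP => x /mapP[i hi ->] /=; apply/and3P; split.
  - apply/eqP/comm => s sY; apply/eqP; rewrite eqEcard card_imset ?leqnn ?andbT; last exact: perm_inj.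
    apply/subsetP => _ /imsetP[_ /imsetP[z + ->] ->]; rewrite inE => /eqP fz; rewrite pe_pt.
    by apply: imset_f; rewrite inE -fz; apply/eqP; move/fiber_stabP: sY => ->.
  - by rewrite Xset_sq card_pblk.
  - by rewrite pnatr_eq0; apply: contra mu0 => /eqP <-; apply: mem_nth; rewrite mem_iota in hi.
  - apply/eqP/comm => s _; rewrite imset_set1 pe_out //; by rewrite mem_extra in hi.
  - by rewrite Xset_sq cards1.
  by rewrite oner_eq0.
rewrite pairwise_cat; apply/and3P; split.
- apply/allrelP => _ _ /mapP[i hi ->] /mapP[y hy ->] /=; apply/eqP/Xset_anti.
  apply/pred0P => z /=; rewrite inE; apply/negP => /andP[/imsetP[x _ ->] /eqP e].
  by move: hy; rewrite mem_extra -e codom_f.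
- rewrite pairwise_map; apply: (sub_pairwise (r := fun i j => i != j)); last first.
    by rewrite -uniq_pairwise iota_uniq.
  move=> i j ij /=; apply/eqP/Xset_anti; apply/pred0P => z /=; apply/negP.
  case/andP => /imsetP[x + ->] /imsetP[x' + /pt_inj ex]; rewrite !inE -ex => /eqP fi /eqP fj.
  by rewrite -fi -fj eqxx in ij.
rewrite pairwise_map; apply: (sub_pairwise (r := fun i j => i != j)); last first.
  by rewrite -uniq_pairwise enum_uniq.
move=> y y' yy' /=; apply/eqP/Xset_anti; rewrite disjoints1 inE //.
Qed.

Lemma size_young_fam : size young_fam = (size mu + size (extra h))%N.
Proof. by rewrite size_cat !size_map size_iota. Qed.

Lemma prod_young_fam : \prod_(x <- young_fam) `|x.2| = (\prod_(m <- mu) m)%:R.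
Proof.
rewrite big_cat !big_map /= [X in _ * X]big1 ?mulr1 => [|y _]; last by rewrite normr1.
rewrite natr_prod [RHS](big_nth 0%N) -[X in iota _ X]subn0.
by apply: eq_bigr => i _; rewrite normr_nat.
Qed.

(** Expanding the product of the block sums selects one generator in each block. *)
Lemma fam_prod_young :
  fam_prod young_fam = \sum_(L <- choices f (iota 0 (size mu))) rG (prodX h (basis_pts h L)).
Proof.
have fam_cat A B : fam_prod (A ++ B) = fam_prod A *m fam_prod B
    :> 'M[algC]_(irr_degree (socle_of_Iirr i0)).
  by elim: A => [|a A IH] /=; rewrite ?mul1mx // IH mulmxA.
have e2 E : fam_prod [seq (Xset [set y], 1 : algC) | y <- E] = rG (prodX h E).
  elim: E => [|y E IH] /=; first by rewrite /prodX big_nil repr_mx1.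
  by rewrite IH prodX_cons rG_mul /Xset big_set1.
have e1 r : fam_prod [seq (Xset (pblk i), (nth 0%N mu i)%:R : algC) | i <- r]
    = \sum_(L <- choices f r) rG (prodX h (map (pt h) L)).
  elim: r => [|i r IH] /=; first by rewrite big_seq1 /prodX big_nil repr_mx1.
  rewrite IH big_allpairs_dep /Xset big_imset /=; last by move=> x y _ _; apply: pt_inj.
  rewrite mulmx_suml big_enum; apply: eq_big => [x|x _]; first by rewrite !inE.
  by rewrite mulmx_sumr; apply: eq_bigr => L _; rewrite prodX_cons rG_mul.
rewrite fam_cat e1 e2 mulmx_suml; apply: eq_bigr => L _.
by rewrite -rG_mul /prodX /basis_pts big_cat.
Qed.

Lemma tr_young_fam : \tr (P *m fam_prod young_fam)
  = #|Y|%:R^-1 * \sum_(y in Y) \sum_(L <- choices f (iota 0 (size mu))) W (gel h y (basis_pts h L)).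
Proof.
rewrite fam_prod_young /P -scalemxAl mxtraceZ mulmx_suml raddf_sum; congr (_ * _).
apply: eq_bigr => y _ /=; rewrite mulmx_sumr raddf_sum; apply: eq_bigr => L _.
by rewrite /= -rG_mul -W_trace.
Qed.

(** Frobenius reciprocity: the trace is the multiplicity of the trivial character of the Young
    subgroup. *)
Lemma tr_young_proj : \tr P = n`!%:R^-1 * \sum_s Wres i0 s * (npi mu s)%:R.
Proof.
pose F : 'CF(Symn n) := mkcf (fun x y => etrans (congr1 (fun g => W g) (esym (ciotaJ h x y))) (WJ i0 (ciota h x) (ciota h y))).
have FE s : F s = Wres i0 s by rewrite mkcfE.
transitivity '['Res[Y] F, 1].
  rewrite cfdotE /P mxtraceZ raddf_sum; congr (_ * _); apply: eq_bigr => y yY.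
  by rewrite cfResE ?subsetT // FE cfun1E yY rmorph1 mulr1 /Wres W_trace.
rewrite cfdot_Res_l cfdotTE card_Sn; congr (_ * _); apply: eq_bigr => s _.
by rewrite FE -/(ind_triv n mu) ind_trivE // rmorph_nat.
Qed.

Section Lead.
Variables (c : 'S_n) (L0 : seq 'I_n).
Hypothesis cE : forall x z, (z \in porbit c x) = (f z == f x).
Hypothesis LE : map f L0 = iota 0 (size mu).
Hypothesis oddb : odd (size mu + size (extra h)).

Lemma size_basis L : map f L = iota 0 (size mu) -> size (basis_pts h L) = (size mu + size (extra h))%N.
Proof. by move/(congr1 size); rewrite size_map size_iota /basis_pts size_cat size_map => ->. Qed.

Lemma nth_L L x0 (x : 'I_n) : map f L = iota 0 (size mu) -> f (nth x0 L (f x)) = f x.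
Proof.
move=> e; have lx : (f x < size mu)%N by apply: lt_f.
have sL : size L = size mu by rewrite -(size_map f) e size_iota.
by rewrite -(nth_map x0 0%N f) ?sL // e nth_iota.
Qed.

(** Some cycle of [y] misses the point of [L] in its block. If it has length m, its vector gives (m
    - 1) + m + 0, as the generators are odd in number and none lies on the cycle; the total is odd
    and [spin_stable0] applies. *)
Lemma partial_cycle_W0 y L : y \in Y -> map f L = iota 0 (size mu) ->
  (exists x z, f z = f x /\ z \notin porbit y x) -> W (gel h y (basis_pts h L)) = 0.
Proof.
move=> yY eL [x [z [fzx nzx]]]; pose l := nth x L (f x).
have fl : f l = f x by apply: nth_L.
have sY i w : f ((y ^+ i)%g w) = f w.
  by elim: i => [|i IH]; rewrite ?perm1 // expgSr permM; move/fiber_stabP: yY => ->.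
have [w fw nlw] : exists2 w, f w = f x & l \notin porbit y w.
  case: (boolP (l \in porbit y x)) => lx; last by exists x.
  exists z => //; apply: contra nzx => lz; rewrite porbit_sym.
  by move: lx lz; rewrite -!eq_porbit_mem => /eqP <-.
pose O := porbit (pe h y) (pt h w).
have [d ->] := gelE h y (basis_pts h L).
have hO : vact (vset O) (pe h y) = vset O by rewrite vact_set imset_porbit.
apply: (spin_stable0 (W := fun g => W g) (@WJ _ _ _ i0) Wz d hO).
rewrite vinv_porbit vwt_set vwt_delta_sum vdot_delta_sum size_basis // (F2_natr (_ + _)) oddb mulr1.
rewrite big1_seq ?addr0 => [|j /andP[_]].
  by rewrite -/O addrAC F2_addxx add0r.
rewrite mem_cat mem_extra ffunE => /orP[/mapP[l' l'L ->]|nj].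
  rewrite porbit_pt; case: (boolP (l' \in porbit y w)) => // l'w; case/negP: nlw.
  have fl' : f l' = f w by case/porbitP: l'w => i ->; rewrite sY.
  have uL : uniq (map f L) by rewrite eL iota_uniq.
  have lL : l \in L.
    apply: mem_nth; rewrite -(size_map f) eL size_iota; exact: lt_f.
  suff -> : l = l' by [].
  by apply: (uniq_map_inj uL) => //; rewrite /= fl' fw.
case: (boolP (j \in O)) => // jO; have : pt h w \in porbit (pe h y) j by rewrite porbit_sym.
by rewrite (orb_out y _ nj) => /eqP e; move: nj; rewrite -e codom_f.
Qed.

Lemma full_cycle_conj y L : y \in Y -> map f L = iota 0 (size mu) ->
  (forall x z, f z = f x -> z \in porbit y x) ->
  exists2 u, u \in Y & y = (c ^ u)%g /\ L = map u L0.
Proof.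
move=> yY eL full; have yE x z : (z \in porbit y x) = (f z == f x).
  apply/idP/eqP => [|/full //]; case/porbitP => i ->.
  by elim: i => [|i IH]; rewrite ?perm1 // expgSr permM; move/fiber_stabP: yY => ->.
pose a x := nth x L0 (f x); pose a' x := nth x L (f x).
have indep L' x x' : map f L' = iota 0 (size mu) -> f x = f x' -> nth x L' (f x) = nth x' L' (f x').
  move=> e ->; apply: set_nth_default; rewrite -(size_map f) e size_iota; exact: lt_f.
have [|||||u [e1 e2 e3]] := @conj_build _ c y a a'.
- by move=> x; apply/setP => z; rewrite cE yE.
- by move=> x; rewrite cE; apply/eqP/nth_L.
- by move=> x; rewrite cE; apply/eqP/nth_L.
- by move=> x z; rewrite cE => /eqP e; apply: indep.
- by move=> x z; rewrite cE => /eqP e; apply: indep.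
exists u; first by apply/fiber_stabP => x; apply/eqP; rewrite -cE.
split=> //; have sL : size L = size L0 by rewrite -!(size_map f) eL LE.
have {}e3 x : u (nth x L0 (f x)) = nth x L (f x) := e3 x.
case: L0 LE e3 sL => [|x0 L0'] e0 e3 sL; first by apply: size0nil.
set L1 := x0 :: L0' in e0 e3 sL *.
apply: (@eq_from_nth _ x0); first by rewrite size_map.
move=> i; rewrite sL => hi; rewrite (nth_map x0) //.
have fi : f (nth x0 L1 i) = i.
  by rewrite -(nth_map x0 0%N f) // e0 nth_iota // -(size_iota 0 (size mu)) -e0 size_map.
have := e3 (nth x0 L1 i); rewrite fi (set_nth_default x0) // (set_nth_default x0) ?sL //.
Qed.

(** The contributing pairs of [y] and [L] are the conjugates of [c] and [L0] under the Young
    subgroup, which acts freely on them. There are as many as elements of the subgroup, so the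
    average is a single value. *)
Lemma tr_young_famE : \tr (P *m fam_prod young_fam) = W (gel h c (basis_pts h L0)).
Proof.
rewrite tr_young_fam; apply: (canLR (mulKf _)); first by rewrite pnatr_eq0 -lt0n cardG_gt0.
pose F (p : 'S_n * seq 'I_n) := W (gel h p.1 (basis_pts h p.2)).
pose S := [seq (y, L) | y <- enum Y, L <- choices f (iota 0 (size mu))].
pose T := [seq ((c ^ u)%g, map u L0) | u <- enum Y].
have uS : uniq S by apply: allpairs_uniq; rewrite ?enum_uniq ?choices_uniq // => -[? ?] [? ?].
have uT : uniq T.
  rewrite map_inj_in_uniq ?enum_uniq // => u v _ _ [ec eL]; apply/permP => x.
  have : f x \in map f L0 by rewrite LE mem_iota add0n; apply: lt_f.
  case/mapP => l lL ex; have : x \in porbit c l by rewrite cE ex.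
  have E (w : 'S_n) i : w ((c ^+ i)%g l) = ((c ^ w) ^+ i)%g (w l) by rewrite -conjXg -!permM -conjgC.
  by case/porbitP => i ->; rewrite !E ec; congr (_ _); move/eq_in_map: eL => ->.
have cY : c \in Y.
  by apply/fiber_stabP => x; apply/eqP; rewrite -cE; apply: (mem_porbit c 1).
have memS y L : ((y, L) \in S) = (y \in Y) && (map f L == iota 0 (size mu)).
  apply/allpairsP/andP => [[[y' L'] /= [+ + [-> ->]]]|[yY eL]].
    by rewrite mem_enum mem_choices.
  by exists (y, L); split; rewrite ?mem_enum ?mem_choices.
have TS : {subset T <= S}.
  move=> _ /mapP[u + ->]; rewrite mem_enum => uY; rewrite memS groupJ //= -LE -map_comp.
  by apply/eqP; apply: eq_map => x /=; move/fiber_stabP: uY => ->.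
have -> : \sum_(y in Y) \sum_(L <- choices f (iota 0 (size mu))) W (gel h y (basis_pts h L))
    = \sum_(p <- S) F p.
  by rewrite big_allpairs_dep big_enum.
rewrite (bigID (mem T)) /= [X in _ + X]big1_seq ?addr0; last first.
  case=> y L /andP[nT]; rewrite memS => /andP[yY /eqP eL]; apply: partial_cycle_W0 => //.
  case: (pickP (fun p : 'I_n * 'I_n => (f p.2 == f p.1) && (p.2 \notin porbit y p.1))) => [[x z] /= /andP[/eqP e ne]|none].
    by exists x, z.
  case/negP: nT; have [|u uY [-> ->]] := @full_cycle_conj y L yY eL.
    by move=> x z e; have := none (x, z); rewrite /= e eqxx /= => /negbFE.
  by apply: map_f; rewrite mem_enum.
rewrite -big_filter (perm_big T) /=; last first.
  apply: uniq_perm; rewrite ?filter_uniq // => p; rewrite mem_filter.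
  by case: (boolP (p \in T)) => // /TS ->.
rewrite big_map (eq_bigr (fun=> W (gel h c (basis_pts h L0)))).
  by rewrite big_enum sumr_const mulr_natl.
by move=> u _; rewrite /F /= -basis_ptsJ -gelJ WJ.
Qed.

End Lead.
End Mu.
End YoungTrace.

Lemma transversal_exists n (mu : seq nat) : sumn mu = n -> 0%N \notin mu ->
  exists L : seq 'I_n, map (fun x : 'I_n => reshape_index mu x) L = iota 0 (size mu).
Proof.
move=> smu mu0; set f := fun x : 'I_n => _.
have : (0 < size (choices f (iota 0 (size mu))))%N.
  rewrite size_choices big_seq prodn_cond_gt0 // => i; rewrite mem_iota => /andP[_ hi].
  by rewrite (card_reshape_index smu) lt0n; apply: contra mu0 => /eqP <-; apply: mem_nth.
case E: (choices f _) => [|L s] // _; exists L; apply/eqP; rewrite -mem_choices E.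
exact: mem_head.
Qed.

(** By [tr_young_proj], for [sumn z = n] this is the dimension of the invariants of the Young
    subgroup of [z] in the representation. *)
Definition young_dim n N (h : perm_emb n N) (i0 : Iirr [set: cliff h]) (z : seq nat) : algC :=
  n`!%:R^-1 * \sum_s Wres i0 s * (npi z s)%:R.

Section Leading.
Variables (n N : nat) (h : perm_emb n N) (i0 : Iirr [set: cliff h]).
Notation W := 'chi_i0.
Notation phi := (young_dim i0).
Hypothesis Wz : forall g, W (cz h * g)%g = - W g.
Variable g1 : cliff h.
Hypothesis g1_odd : vdeg g1 = 1.
Hypothesis Wg1 : W g1 != 0.

Lemma Wres_allpos s : Wres i0 s != 0 -> allpos s.
Proof. by move/(Wres_neq0 Wz); apply: allpos_pe. Qed.

Lemma qlike_young_dim : qlike phi.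
Proof. exact/qlikeZ/qlike_npi/Wres_allpos. Qed.

Lemma young_dim_size w : phi w != 0 -> sumn w = n.
Proof.
move=> nz; apply/eqP; apply: contraNT nz => ne; rewrite /young_dim big1 ?mulr0 // => s _.
by rewrite npi_sum // mulr0.
Qed.

(** Here the Young subgroup is trivial and the value is the degree of the representation. *)
Lemma young_dim_ones : phi (nseq n 1%N) != 0.
Proof.
have e : sumn (nseq n 1%N) = n by rewrite sumn_nseq mul1n.
rewrite /young_dim -(tr_young_proj i0 e) /young_proj mxtraceZ raddf_sum /=.
have Y1 : young_subgroup n (nseq n 1%N) = 1%g :> {set 'S_n}.
  apply/setP => s; rewrite [RHS]inE; apply/fiber_stabP/eqP => [fs|-> x]; last by rewrite perm1.
  apply/permP => x; rewrite perm1.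
  have : (#|[set z : 'I_n | reshape_index (nseq n 1%N) z == reshape_index (nseq n 1%N) x]| <= 1)%N.
    by rewrite (card_reshape_index e) nth_nseq; case: ifP.
  by move/card_le1_eqP; apply; rewrite inE ?fs ?eqxx.
by rewrite Y1 big_set1 cards1 invr1 mul1r -W_trace irr1_neq0.
Qed.

Lemma leading_arith b m : (0 < m)%N -> (2 * (m * 2 ^ b./2) ^ 2 <= 2 ^ b)%N -> odd b /\ m = 1%N.
Proof.
move=> m0; rewrite -{2}(odd_double_half b) expnD expnMn -expnM muln2 mulnA leq_pmul2r ?expn_gt0 //.
by case: (odd b); rewrite ?expn1 ?expn0; [split=> // | ]; nia.
Qed.

Lemma spin_leading : exists mu, [/\ strict_part mu, sumn mu = n, bounded mu phi,
  odd (size mu + size (extra h)) &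
  forall c L, (forall x z : 'I_n, (z \in porbit c x) = (reshape_index mu z == reshape_index mu x)) ->
    map (fun x : 'I_n => reshape_index mu x) L = iota 0 (size mu) ->
    `|W (gel h c (basis_pts h L))| ^+ 2
    = 2 ^+ (size mu + size (extra h)).-1 * (\prod_(m <- mu) m)%:R].
Proof.
have [mu [smu bmu nz emu]] := qlike_chain qlike_young_dim young_dim_size young_dim_ones.
have mu0 : 0%N \notin mu by case/andP: smu.
have fam := young_famP Wz emu mu0; have PP := young_proj_idem i0 mu.
have [m em] := cliff_fam_trace PP fam; rewrite size_young_fam in em.
have ephi : phi mu = \tr (young_proj i0 mu) by rewrite tr_young_proj.
have m0 : (0 < m)%N by rewrite lt0n; apply: contraNneq nz => m0; rewrite ephi em m0 mul0n.
have [ob m1] : odd (size mu + size (extra h)) /\ m = 1%N.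
  apply: leading_arith => //; rewrite -(ler_nat algC) natrM [X in 2 * X]natrX.
  have -> : ((m * 2 ^ (size mu + size (extra h))./2)%:R : algC) = `|phi mu|.
    by rewrite ephi em normr_nat.
  have := bounded_norm Wres_allpos smu emu bmu; rewrite -/(phi mu) => le.
  apply: le_trans (ler_wpM2l (ler0n _ 2) le) _; rewrite mulrCA expnD natrM natrX.
  by rewrite ler_wpM2l ?exprn_ge0 ?ler0n // -card_vextE; apply: (Wres_norm Wz g1_odd Wg1).
exists mu; split=> // c L cE LE.
rewrite -(tr_young_famE Wz emu cE LE ob) (cliff_fam_top PP fam) ?size_young_fam //.
  by rewrite prod_young_fam.
by rewrite em m1 mul1n.
Qed.

End Leading.

(** * The spin character attached to the staircase *)

Lemma staircase_cons k : (0 < k)%N -> staircase k = k :: staircase k.-1.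
Proof. by case: k => // m _; rewrite /staircase -[X in iota 1 X]addn1 iotaD rev_cat /= add1n. Qed.

Section Staircase.
Variable k : nat.
Notation n := (k * k.+1)./2.

Lemma sumn_staircase : sumn (staircase k) = n.
Proof.
rewrite /staircase sumn_rev; elim: k => // m IH.
have -> : (m.+1 * m.+2 = (m.+1).*2 + m * m.+1)%N by lia.
rewrite -[X in iota 1 X]addn1 iotaD sumn_cat IH halfD odd_double doubleK /=; lia.
Qed.

Lemma strict_staircase : strict_part (staircase k).
Proof.
rewrite /strict_part /staircase rev_sorted mem_rev mem_iota /= andbT.
by have := iota_ltn_sorted 1 k; apply: sub_sorted => x y.
Qed.

Lemma size_staircase : size (staircase k) = k.
Proof. by rewrite size_rev size_iota. Qed.

Theorem spin_staircase : (0 < k)%N ->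
  exists (N : nat) (h : perm_emb n N) (i0 : Iirr [set: cliff h]) (c : 'S_n) (g1 : cliff h),
  [/\ forall g, 'chi_i0 (cz h * g)%g = - 'chi_i0 g,
      vdeg g1 = 1 /\ 'chi_i0 g1 != 0,
      forall x z : 'I_n, (z \in porbit c x) = (reshape_index (staircase k) z == reshape_index (staircase k) x),
      forall g, vdeg g = 1 -> 'chi_i0 g != 0 -> exists t, prS g = (c ^ t)%g
    & forall a w, (k < a)%N -> young_dim i0 (a :: w) = 0].
Proof.
(* One further fixed generator is added when [k] is even, so that the product of one generator per
   cycle has odd degree. *)
move=> k0; have [N [h oe]] : exists N (h : perm_emb n N), odd (k + size (extra h)).
  case: (boolP (odd k)) => ok.
    exists n, (perm_emb_id n); have := size_extra (perm_emb_id n).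
    by move/eqP; rewrite -[X in _ == X]addn0 eqn_add2l => /eqP ->; rewrite addn0.
  exists n.+1, (perm_emb_lift n); have := size_extra (perm_emb_lift n).
  by move/eqP; rewrite -[X in _ == X]addn1 eqn_add2l => /eqP ->; rewrite addn1.
have sr := sumn_staircase; have str := strict_staircase.
have [srt r0] := andP str.
have ur : uniq (staircase k).
  by apply: sorted_uniq srt => [x y z /= h1 h2|x /=]; [exact: ltn_trans h2 h1 | rewrite ltnn].
have [c cE] := fibre_cycle_exists (fun x : 'I_n => reshape_index (staircase k) x).
have [L LE] := transversal_exists sr r0.
have sJ L' (mu : seq nat) : map (fun x : 'I_n => reshape_index mu x) L' = iota 0 (size mu) ->
  size (basis_pts h L') = (size mu + size (extra h))%N.
  by move=> e; rewrite size_cat size_map -(size_map (fun x : 'I_n => reshape_index mu x)) e size_iota.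
have oJ : odd (size (basis_pts h L)) by rewrite (sJ _ _ LE) size_staircase.
have [i0 Wz Wg] := spin_irr_exists (g_nonconj sr ur cE LE oJ).
have dg : vdeg (gel h c (basis_pts h L)) = 1 by rewrite vdeg_gel F2_natr oJ.
have [mu [smu emu bmu ob lead]] := spin_leading Wz dg Wg.
have [srtm mu0] := andP smu.
have um : uniq mu.
  by apply: sorted_uniq srtm => [x y z /= h1 h2|x /=]; [exact: ltn_trans h2 h1 | rewrite ltnn].
have [cm cmE] := fibre_cycle_exists (fun x : 'I_n => reshape_index mu x).
have [Lm LmE] := transversal_exists emu mu0.
have ojm : odd (size (basis_pts h Lm)) by rewrite (sJ _ _ LmE).
have dgm : vdeg (gel h cm (basis_pts h Lm)) = 1 by rewrite vdeg_gel F2_natr ojm.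
have supp x : vdeg x = 1 -> 'chi_i0 x != 0 -> exists t, prS x = (cm ^ t)%g.
  rewrite -[cm](prS_gel h cm (basis_pts h Lm)).
  apply: (spin_odd_support (b := size mu + size (extra h)) (m := \prod_(m <- mu) m) Wz dgm).
  - by case: (_ + _)%N ob.
  - by rewrite big_seq prodn_cond_gt0 // => m mm; rewrite lt0n; apply: contra mu0 => /eqP <-.
  - exact: (g_nonconj emu um cmE LmE ojm).
  - have := card_cent_g h emu um cmE LmE; by rewrite (sJ _ _ LmE).
  exact: lead.
(* By choice the character does not vanish at the staircase element, while its odd part lives over
   the class of cycle type [mu]; the cycle lengths determine a strict partition. *)
have er : staircase k = mu.
  have [t et] := supp _ dg Wg; rewrite prS_gel in et.
  exact/esym/(strict_cycle_type_eq smu str emu sr cmE cE et).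
have [t et] := supp _ dg Wg; rewrite prS_gel in et.
exists N, h, i0, c, (gel h c (basis_pts h L)); split=> //.
  move=> x dx Wx; have [u ->] := supp x dx Wx; exists (t^-1 * u)%g.
  by rewrite conjgM et conjgK.
move=> a w ka; move: bmu; rewrite -er staircase_cons //.
by case=> h1 _; apply: h1.
Qed.

End Staircase.

(** * Completeness of the partition labels *)

Section CycleTypeClass.
Variable n : nat.
Implicit Types s t : 'S_n.

Let cgeq (A B : {set 'I_n}) := (#|B| <= #|A|)%N.

Definition orbs s : seq {set 'I_n} := sort cgeq (enum (porbits s)).
Definition cyc_type s : seq nat := map (fun A : {set 'I_n} => #|A|) (orbs s).

Lemma mem_orbs s x : porbit s x \in orbs s.
Proof. by rewrite mem_sort mem_enum imset_f. Qed.

Lemma orbs_uniq s : uniq (orbs s).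
Proof. by rewrite sort_uniq enum_uniq. Qed.

Definition orb_label s x : nat := index (porbit s x) (orbs s).

Lemma orb_label_eq s x z : (orb_label s z == orb_label s x) = (z \in porbit s x).
Proof.
rewrite -eq_porbit_mem; apply/eqP/eqP => [e|e]; last by rewrite /orb_label e.
by rewrite -(nth_index set0 (mem_orbs s z)) -/(orb_label s z) e nth_index ?mem_orbs.
Qed.

Lemma card_orb_label s i : #|[set x | orb_label s x == i]| = nth 0%N (cyc_type s) i.
Proof.
have [lt|ge] := ltnP i (size (orbs s)); last first.
  rewrite nth_default ?size_map //; apply/eqP; rewrite cards_eq0; apply/eqP/setP => x.
  rewrite !inE; apply/negP => /eqP e; have := mem_orbs s x.
  by rewrite -index_mem -/(orb_label s x) e ltnNge ge.
rewrite (nth_map set0) //; have : nth set0 (orbs s) i \in porbits s.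
  by have := mem_nth set0 lt; rewrite mem_sort mem_enum.
case/imsetP => x _ ex; rewrite ex; apply: eq_card => z; rewrite inE -orb_label_eq.
by rewrite /orb_label -ex index_uniq ?orbs_uniq.
Qed.

(** A relabelling [p] makes the cycles agree as sets; [conj_build] then matches the permutations on
    each cycle. *)
Lemma cyc_type_conj s t : cyc_type s = cyc_type t -> exists u, (s ^ u)%g = t.
Proof.
move=> e; have : perm_eq [seq orb_label s i | i <- enum 'I_n] [seq orb_label t i | i <- enum 'I_n].
  apply/allP => i _ /=; apply/eqP; rewrite !count_map.
  have cntE (P : pred 'I_n) : count P (Finite.enum 'I_n) = #|[set x | P x]|.
    by rewrite cardsE cardE -size_filter.
  by rewrite !cntE !card_orb_label e.
case/perm_eq_perm => p hp.
have same x : porbit (s ^ p)%g x = porbit t x.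
  rewrite -[x](permKV p) porbit_conj; apply/setP => z; apply/imsetP/idP => [[w + ->]|].
    by rewrite -!orb_label_eq -!hp.
  rewrite -orb_label_eq -[z](permKV p) -!hp => hz; exists (p^-1%g z) => //.
  by rewrite -orb_label_eq.
pose a x := odflt x [pick z in porbit (s ^ p)%g x].
have ax x : a x \in porbit (s ^ p)%g x by rewrite /a; case: pickP => [z //|/(_ x)]; rewrite porbit_id.
have aE x z : z \in porbit (s ^ p)%g x -> a z = a x.
  rewrite -eq_porbit_mem /a => /eqP ->; case: pickP => //= /(_ x); by rewrite porbit_id.
have [u [e1 _ _]] := conj_build same ax ax aE aE.
by exists (p * u)%g; rewrite conjgM.
Qed.

Lemma cyc_type_part s : is_partition n (cyc_type s).
Proof.
apply/and3P; split.
- have tot : total cgeq by move=> A B; apply: leq_total.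
  by rewrite /cyc_type sorted_map; apply: (sort_sorted tot).
- apply/negP => /mapP[A]; rewrite mem_sort mem_enum => /imsetP[x _ ->] /esym/eqP.
  by rewrite cards_eq0 => /eqP/setP/(_ x); rewrite porbit_id inE.
rewrite sumnE big_map.
have -> : (\sum_(A <- orbs s) #|A| = \sum_(A in porbits s) #|A|)%N.
  by rewrite (perm_big (enum (porbits s))) ?perm_sort // big_enum.
have cov : cover (porbits s) = [set: 'I_n].
  apply/setP => x; rewrite inE; apply/bigcupP; exists (porbit s x); first exact: imset_f.
  exact: porbit_id.
have tI : trivIset (porbits s).
  apply/trivIsetP => _ _ /imsetP[x _ ->] /imsetP[y _ ->]; apply: contraNT => /pred0Pn[z /= /andP[]].
  by rewrite -!eq_porbit_mem => /eqP <- /eqP <-.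
by move: tI; rewrite /trivIset => /eqP ->; rewrite cov cardsT card_ord.
Qed.
End CycleTypeClass.

(** Successive differences in [t] count the parts larger than [t], and these counts determine the
    multiplicities. *)
Lemma partition_summin_eq n mu nu : is_partition n mu -> is_partition n nu ->
  (forall t, \sum_(m <- mu) minn m t = \sum_(m <- nu) minn m t)%N -> mu = nu.
Proof.
move=> /and3P[smu mu0 _] /and3P[snu nu0 _] e.
have cnt c : count (fun m => c < m)%N mu = count (fun m => c < m)%N nu.
  by have := e c.+1; rewrite -!sum_count_gt !big_ord_recr /= !sum_count_gt e => /addnI.
apply: (sorted_eq (leT := geq)) => //.
- by move=> x y z h1 h2; apply: leq_trans h2 h1.
- by move=> x y /andP[h1 h2]; apply/eqP; rewrite eqn_leq; apply/andP.
apply/allP => m _ /=; apply/eqP; case: m => [|m]; first by rewrite (count_memPn mu0) (count_memPn nu0).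
have E (s : seq nat) : (count_mem m.+1 s + count (fun x => m.+1 < x) s = count (fun x => m < x) s)%N.
  elim: s => //= x s IH; have e' : ((x == m.+1) + (m.+1 < x) = (m < x))%N.
    by rewrite [(m < x)%N]leq_eqVlt eq_sym; case: eqVneq => [->|_]; rewrite ?ltnn.
  lia.
by apply: (@addIn (count (fun x => m.+1 < x)%N mu)); rewrite {2}cnt !E cnt.
Qed.

Lemma common_constt_neq0 (gT : finGroupType) (G : {group gT}) (phi psi : 'CF(G)) i :
    phi \is a character -> psi \is a character ->
  i \in irr_constt phi -> i \in irr_constt psi -> '[phi, psi] != 0.
Proof.
move=> Np Nq ip iq; rewrite cfdot_char_r // psumr_eq0 => [|j _]; last first.
  by rewrite natr_ge0 // rpredM ?Cnat_cfdot_char_irr.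
apply/allPn; exists i; first exact: mem_index_enum.
by rewrite /= mulf_eq0 negb_or -!irr_consttE ip iq.
Qed.

Section Completeness.
Variable n : nat.

(** On each fibre of [f] composed with [y] the map [h] is injective, so at most [t] points of the
    fibre have [h x < t]. *)
Lemma transverse_summin (f h : 'I_n -> nat) y : transverse f h y -> forall t b,
  (forall x, f x < b)%N ->
  (#|[set x | h x < t]| <= \sum_(r < b) minn #|[set x | f x == r]| t)%N.
Proof.
move=> /injectiveP inj t b fb.
rewrite -sum1dep_card (partition_big (fun x => Ordinal (fb (y x))) xpredT) //=.
apply: leq_sum => r _; rewrite sum1dep_card leq_min; apply/andP; split.
  rewrite -[leqRHS](card_imset _ (@perm_inj _ y^-1)); apply: subset_leq_card.
  apply/subsetP => x; rewrite inE => /andP[_ /eqP e]; apply/imsetP; exists (y x); rewrite ?permK //.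
  by rewrite inE -e.
case: t => [|t].
  by rewrite leqn0 cards_eq0; apply/eqP/setP => x; rewrite !inE ltn0.
rewrite -[leqRHS](card_ord t.+1).
rewrite -(card_in_imset (f := fun x => inord (h x) : 'I_t.+1)) ?max_card //.
move=> x x'; rewrite !inE => /andP[lx /eqP ex] /andP[lx' /eqP ex'] /(congr1 val).
rewrite /= !inordK // => eh; apply: inj.
by move: ex'; rewrite -ex => /(congr1 val) /= ->; rewrite eh.
Qed.

(** A common constituent forces a transverse permutation to exist. In terms of conjugate partitions,
    the inequality says that [nu] dominates [mu]. *)
Lemma part_index_summin mu nu i : is_partition n mu -> is_partition n nu ->
  i \in irr_constt (ind_triv n mu) -> i \in irr_constt (ind_sign n (conj_part nu)) ->
  forall t, (\sum_(m <- nu) minn m t <= \sum_(m <- mu) minn m t)%N.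
Proof.
move=> pmu pnu imu inu t; have smu : sumn mu = n by case/and3P: pmu => _ _ /eqP.
have Nt : ind_triv n mu \is a character by rewrite cfInd_char ?rpred1.
have Ns : ind_sign n (conj_part nu) \is a character.
  by rewrite cfInd_char ?cfRes_char ?cf_sign_char.
have := common_constt_neq0 Nt Ns imu inu.
rewrite cfdot_ind_triv_sign mulf_eq0 negb_or => /andP[_].
rewrite pnatr_eq0 -lt0n => /card_gt0P[y ty].
have lt_r (x : 'I_n) : (reshape_index mu x < size mu)%N by rewrite reshape_indexP // smu.
have := transverse_summin ty t lt_r.
have -> : (\sum_(r < size mu) minn #|[set x : 'I_n | reshape_index mu x == r]| t
   = \sum_(m <- mu) minn m t)%N.
  by rewrite (big_nth 0%N) big_mkord; apply: eq_bigr => r _; rewrite card_reshape_index.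
apply: leq_trans; rewrite -sum_count_gt.
under eq_bigr do rewrite -(nth_conj_part pnu) -(card_reshape_index (sumn_conj_part pnu)) -sum1dep_card.
rewrite -sum1dep_card; case: t => [|t]; first by rewrite big_ord0.
rewrite [leqRHS](partition_big (fun x : 'I_n => inord (reshape_index (conj_part nu) x) : 'I_t.+1) xpredT) //=.
apply: leq_sum => c _; rewrite [leqRHS](eq_bigl (fun x : 'I_n => reshape_index (conj_part nu) x == c)) //.
move=> x; apply/andP/eqP => [[lt /eqP <-]|e]; first by rewrite inordK.
by rewrite e ltn_ord; split=> //; apply/eqP/val_inj; rewrite /= inordK.
Qed.

Lemma part_index_in mu : is_partition n mu ->
  part_index n mu \in irr_constt (ind_triv n mu)
  /\ part_index n mu \in irr_constt (ind_sign n (conj_part mu)).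
Proof. by move=> p; have := part_indexP p (part_index n mu); rewrite eqxx => /andP. Qed.

Lemma part_index_inj mu nu : is_partition n mu -> is_partition n nu ->
  part_index n mu = part_index n nu -> mu = nu.
Proof.
move=> pm pn e; have [m1 m2] := part_index_in pm; have [n1 n2] := part_index_in pn.
apply: (partition_summin_eq pm pn) => t; apply/eqP; rewrite eqn_leq.
rewrite (part_index_summin pn pm n1) -?e // (part_index_summin pm pn m1) //.
by rewrite e.
Qed.

(** Counting: through cycle types, the labels inject the conjugacy classes into the irreducible
    characters, and these are equally many. *)
Lemma part_index_surj (i : Iirr (Symn n)) : exists2 mu, is_partition n mu & i = part_index n mu.
Proof.
pose g (C : {set 'S_n}) := part_index n (cyc_type (repr C)).
have ginj : {in classes (Symn n) &, injective g}.
  move=> _ _ /imsetP[s _ ->] /imsetP[t _ ->] /(part_index_inj (cyc_type_part _) (cyc_type_part _)).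
  case/cyc_type_conj => u e.
  have c1 x : (repr (x ^: Symn n) ^: Symn n = x ^: Symn n)%g.
    by apply/class_eqP; apply: (mem_repr x); apply: class_refl.
  rewrite -(c1 s) -(c1 t); apply/esym/class_eqP; rewrite -e memJ_class ?inE //.
have : g @: classes (Symn n) = [set: Iirr (Symn n)].
  apply/eqP; rewrite eqEcard subsetT cardsT card_ord card_in_imset // -NirrE; exact: leqnn.
move/setP/(_ i); rewrite inE => /imsetP[C _ ->].
by exists (cyc_type (repr C)) => //; apply: cyc_type_part.
Qed.
End Completeness.

(** * Restriction of the staircase spin character to the symmetric group *)

Section SpinRestriction.
Variables (k : nat).
Hypothesis k0 : (0 < k)%N.
Notation n := (k * k.+1)./2.
Variables (N : nat) (h : perm_emb n N) (i0 : Iirr [set: cliff h]).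
Hypothesis Wz : forall g, 'chi_i0 (cz h * g)%g = - 'chi_i0 g.
Hypothesis phi0 : forall a w, (k < a)%N -> young_dim i0 (a :: w) = 0.
Notation phi := (young_dim i0).

Definition spin_res : 'CF(Symn n) := cfRepr (MxRepresentation (pullG_repr 'Chi_i0)).

Lemma spin_resE s : spin_res s = Wres i0 s.
Proof. by rewrite /Wres W_trace cfunE inE mulr1n. Qed.

(** An odd power of [s], with the product of the orbit lengths over all points as exponent, is the
    identity. *)
Lemma allpos_even m (s : 'S_m) : allpos s -> odd_perm s = false.
Proof.
move=> pos; pose q := (\prod_x #|porbit s x|)%N.
have oq : odd q.
  by rewrite /q; elim/big_ind: _ => // [a b oa ob|x _]; [rewrite oddM oa ob | apply: odd_porbit].
have sq : (s ^+ q = 1)%g.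
  apply/permP => x; rewrite perm1; apply/eqP.
  have := expg_porbit_eq s x q 0; rewrite perm1 => ->.
  by rewrite mod0n -/(dvdn _ _) /q (bigD1 x) //= dvdn_mulr.
have : odd_perm (s ^+ q)%g = odd q && odd_perm s.
  elim: q {oq sq} => [|q IH]; first by rewrite odd_perm1.
  by rewrite expgS odd_permM IH /=; case: (odd q); case: (odd_perm s).
by rewrite sq odd_perm1 oq /= => <-.
Qed.

Lemma cfdot_spin_triv z : sumn z = n -> '[spin_res, ind_triv n z] = phi z.
Proof.
move=> e; rewrite cfdotTE card_Sn; congr (_ * _); apply: eq_bigr => s _.
by rewrite spin_resE ind_trivE // rmorph_nat.
Qed.

(** The restriction is supported on even permutations and therefore does not see the sign
    character. *)
Lemma cfdot_spin_sign z : sumn z = n -> '[spin_res, ind_sign n z] = phi z.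
Proof.
move=> e; rewrite -cfdot_spin_triv // -!cfdot_Res_l !cfdotE; congr (_ * _).
apply: eq_bigr => y yY; rewrite !cfResE ?subsetT // cf_signE cfun1E yY spin_resE rmorph1.
have [->|/(Wres_allpos Wz)/allpos_even ->] := eqVneq (Wres i0 y) 0; first by rewrite !mul0r.
by rewrite rmorph1.
Qed.

Lemma count_staircase c m : count (fun x => c < x)%N (staircase m) = (m - c)%N.
Proof.
by elim: m => // m IH; rewrite staircase_cons //= IH; case: ltnP => /=; lia.
Qed.

Lemma summin_staircase t : (\sum_(m <- staircase k) minn m t = \sum_(i < t) (k - i))%N.
Proof. by rewrite -sum_count_gt; apply: eq_bigr => c _; apply: count_staircase. Qed.

Lemma sum_triangleE q : (q <= k)%N -> ((\sum_(i < q) (k - i)) * 2 + q * q = 2 * q * k + q)%N.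
Proof.
elim: q => [|q IH] qk; first by rewrite big_ord0.
by rewrite big_ord_recr /=; have := IH (ltnW qk); move: (\sum_(i < q) _)%N => S; lia.
Qed.

(** Bounding [minn m t] by [t] for the [q] largest parts and by [m] for the others gives the
    inequality, since those [q] parts add up to the first sum. The proof compares closed forms. *)
Lemma sum_triangle q : (q <= k)%N -> forall t, (t <= k)%N ->
  (\sum_(i < q) (k - i) + \sum_(m <- staircase k) minn m t <= n + q * t)%N.
Proof.
move=> qk t tk; rewrite summin_staircase; have := sum_triangleE qk; have := sum_triangleE tk.
have : (n * 2 = k * k.+1)%N by rewrite muln2 halfK oddM oddS; case: (odd k); rewrite ?subn0.
move: (\sum_(i < q) _)%N (\sum_(i < t) _)%N n => S T m.
case: (leqP (q + t) k) => h1 *.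
  have [d ed] : exists d, (k = q + t + d)%N by exists (k - (q + t))%N; lia.
  have e1 : (k * k = (q + t + d) * k)%N by rewrite {1}ed.
  have e2 : ((q + t + d) * k = (q + t + d) * (q + t + d))%N by rewrite {1}ed.
  have e3 : (q * k = q * (q + t + d))%N by rewrite {1}ed.
  have e4 : (t * k = t * (q + t + d))%N by rewrite {1}ed.
  have := leq0n (d * d); lia.
have [d ed] : exists d, (q + t = k + d.+1)%N by exists (q + t - k).-1; lia.
have e1 : ((q + t) * (q + t) = q * q + t * t + 2 * (q * t))%N by lia.
have e2 : (2 * q * k + 2 * t * k = 2 * k * (q + t))%N by lia.
rewrite ed in e1 e2; have e3 : (d.+1 <= d.+1 * d.+1)%N by rewrite leq_pmulr.
have e4 : ((k + d.+1) * (k + d.+1) = k * k + 2 * k * d.+1 + d.+1 * d.+1)%N by lia.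
have e5 : (2 * k * (k + d.+1) = 2 * (k * k) + 2 * k * d.+1)%N by lia.
lia.
Qed.

Lemma is_partition_staircase : is_partition n (staircase k).
Proof.
apply/and3P; split; last by rewrite sumn_staircase.
  have /andP[+ _] := strict_staircase k; apply: sub_sorted => x y; exact: ltnW.
by have /andP[] := strict_staircase k.
Qed.

(** For a constituent labelled [nu], [young_dim] is nonzero at [nu] and at its conjugate, so by
    [qlike_dominated] both are dominated by the staircase. Conjugation reverses dominance and fixes
    the staircase, whence equality. *)
Lemma spin_res_constt i : i \in irr_constt spin_res -> i = part_index n (staircase k).
Proof.
move=> ci; have [nu pnu ei] := part_index_surj i; have [ct cs] := part_index_in pnu.
rewrite -ei in ct cs; have snu : sumn nu = n by case/and3P: pnu => _ _ /eqP.
have Nr : spin_res \is a character by apply: cfRepr_char.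
have nz psi : psi \is a character -> i \in irr_constt psi -> '[spin_res, psi] != 0.
  by move=> Npsi cpsi; apply: (common_constt_neq0 Nr Npsi ci).
have pt : phi nu != 0 by rewrite -cfdot_spin_triv // nz // cfInd_char ?rpred1.
have ps : phi (conj_part nu) != 0.
  rewrite -cfdot_spin_sign ?(sumn_conj_part pnu) // nz // cfInd_char ?cfRes_char ?cf_sign_char //.
have q := qlike_young_dim Wz.
have lek z : phi z != 0 -> forall m, m \in z -> (m <= k)%N.
  move=> nzz m mz; rewrite leqNgt; apply/negP => lt; case/eqP: nzz.
  by rewrite (qlike_perm q (perm_to_rem mz)) phi0.
have dom u w : perm_eq (u ++ w) nu \/ perm_eq (u ++ w) (conj_part nu) -> (size u <= k)%N ->
    (sumn u <= \sum_(i < size u) (k - i))%N.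
  move=> hp su; rewrite leqNgt; apply/negP => lt; have := qlike_dominated w q phi0 su lt.
  case: hp => hp; rewrite (qlike_perm q hp) => /eqP; first by rewrite (negbTE pt).
  by rewrite (negbTE ps).
have sz : (size nu <= k)%N.
  case E: nu => [|a nu'] //; have := lek _ ps (size nu); rewrite -E; apply.
  have nu0 : 0%N \notin nu by case/and3P: pnu.
  have h0 : (0 < head 0%N nu)%N by rewrite E /= lt0n; apply: contra nu0 => /eqP <-; rewrite E mem_head.
  apply/mapP; exists 0%N; first by rewrite mem_iota.
  apply/esym/eqP; rewrite -all_count; apply/allP => m mm; rewrite lt0n.
  by apply: contra nu0 => /eqP <-.
rewrite ei; congr (part_index n _); apply: (partition_summin_eq pnu is_partition_staircase) => t.
have [tk|kt] := leqP t k; last first.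
  transitivity ((k * k.+1)./2).
    rewrite -snu sumnE; apply: eq_big_seq => m mm; apply/minn_idPl.
    by apply: leq_trans (ltnW kt); apply: lek mm.
  rewrite -[LHS]sumn_staircase sumnE; apply/esym/eq_big_seq => m; rewrite mem_rev mem_iota => /andP[_ mk].
  by apply/minn_idPl; lia.
apply/eqP; rewrite eqn_leq; apply/andP; split.
  (* Upper bound: the sum on the left is that of the first [t] parts of the conjugate partition. *)
  rewrite summin_staircase -sum_count_gt.
  have := dom (take t (conj_part nu)) (drop t (conj_part nu)); rewrite cat_take_drop => /(_ (or_intror (perm_refl _))).
  rewrite size_take_min => /(_ (leq_trans (geq_minl _ _) tk)) => le.
  have -> : (\sum_(c < t) count (fun m => c < m)%N nu = sumn (take t (conj_part nu)))%N.
    under eq_bigr do rewrite -(nth_conj_part pnu).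
    rewrite sumnE (big_nth 0%N) size_take_min big_mkord [RHS](big_ord_widen _ (fun i => nth 0%N (take t (conj_part nu)) i) (geq_minl _ _)).
    rewrite [RHS]big_mkcond; apply: eq_bigr => c _; case: ifP => hc; first by rewrite nth_take.
    by move: hc; rewrite ltn_min ltn_ord /= => /negbT; rewrite -leqNgt => /(nth_default 0%N) ->.
  apply: leq_trans le _; rewrite [leqRHS](bigID (fun i : 'I_t => i < minn t (size (conj_part nu)))%N) /=.
  by rewrite (big_ord_widen _ (fun i => k - i)%N (geq_minl t (size (conj_part nu)))) leq_addr.
(* Lower bound: truncating at [t] removes [sumn u - size u * t] in total, so the bound on the sum of
   these largest parts is what is needed. *)
pose u := [seq m <- nu | t < m]%N.
have su : (size u <= k)%N by apply: leq_trans sz; rewrite size_filter count_size.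
have pf : perm_eq (u ++ [seq m <- nu | predC (fun m => t < m)%N m]) nu.
  by rewrite /u perm_filterC perm_refl.
have := dom _ _ (or_introl pf) su.
have -> : (\sum_(m <- nu) minn m t = n - sumn u + size u * t)%N.
  rewrite -snu /u; elim: (nu) => [|m s IH] /=; first by rewrite big_nil.
  have le : (sumn [seq m <- s | t < m] <= sumn s)%N.
    by elim: (s) => //= x s' IH'; case: ifP => _ /=; lia.
  by rewrite big_cons IH; case: ltnP => hm /=; lia.
have := sum_triangle su tk; have : (sumn u <= n)%N.
  rewrite -snu /u; elim: (nu) => //= x s' IH'; case: ifP => _ /=; lia.
move: (sumn u) (size u * t)%N (\sum_(i < size u) _)%N (\sum_(m <- staircase k) _)%N ((k * k.+1)./2).
by clear => *; lia.
Qed.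

Lemma spin_res_part : exists2 a : algC, a != 0 & spin_res = a *: part_char n (staircase k).
Proof.
set r := part_index n (staircase k).
have e : spin_res = '[spin_res, 'chi_r] *: 'chi_r.
  rewrite {1}[spin_res]cfun_sum_cfdot (bigD1 r) //= big1 ?addr0 // => i ir.
  have [->|nz] := eqVneq '[spin_res, 'chi_i] 0; first by rewrite scale0r.
  by case/eqP: ir; apply: spin_res_constt; rewrite irr_consttE.
exists '[spin_res, 'chi_r] => //; apply/eqP => a0.
have := spin_resE 1; rewrite e a0 scale0r cfunE /Wres => /esym/eqP.
by rewrite (negbTE (irr1_neq0 i0)).
Qed.

End SpinRestriction.

(** * Hook characters *)

Section SignInduced.
Variable n : nat.
Notation V := {ffun 'I_n -> 'F_2}.
Implicit Types (A B C : V) (s t y : 'S_n).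

Definition vsz B := #|[set x | B x != 0]|.

Lemma vsz_act B s : vsz (vact B s) = vsz B.
Proof.
rewrite /vsz -[RHS](card_imset _ (@perm_inj _ s)); apply: eq_card => x; rewrite inE ffunE.
apply/idP/imsetP => [nz|[z + ->]]; last by rewrite inE permK.
by exists (s^-1%g x); rewrite ?permKV // inE.
Qed.

Lemma vsz_le B : (vsz B < n.+1)%N.
Proof. by rewrite ltnS -[leqRHS](card_ord n) max_card. Qed.

Lemma vsz_transport B C : vsz B = vsz C -> exists y, vact B y = C.
Proof.
move=> e; have c1 A : cnt A 1 = vsz A.
  by apply: eq_card => x; rewrite !inE; case: (F2_cases (A x)) => ->.
have c0 A : cnt A 0 = (n - vsz A)%N.
  suff : (vsz A + cnt A 0%R = n)%N by lia.
  rewrite -[RHS](card_ord n) -(cardsC [set x | A x != 0]); congr (_ + _)%N.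
  by apply: eq_card => x; rewrite !inE negbK.
have [k|p hp] := @cnt_transport n _ C B.
  by case: (F2_cases k) => ->; rewrite ?c0 ?c1 e.
by exists p^-1%g; apply/ffunP => x; rewrite ffunE invgK hp.
Qed.

Definition vstabg B : {set 'S_n} := [set s | vstab B s].

Lemma vstabg_group_set B : group_set (vstabg B).
Proof.
apply/group_setP; split=> [|s t]; rewrite !inE /vstab ?vact1 // vactM.
by move=> /eqP -> /eqP ->.
Qed.

Canonical vstabg_group B := Group (vstabg_group_set B).

Lemma vsgn_repr B : mx_repr (vstabg B) (fun s => (F2sg (vinv s B))%:M : 'M[algC]_1).
Proof.
split=> [|s t]; first by rewrite vinv1.
by rewrite !inE => /eqP hs _; rewrite vinvM hs F2sgD scalar_mxM.
Qed.

Definition vsgn B : 'CF(vstabg B) := cfRepr (MxRepresentation (vsgn_repr B)).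

Lemma vsgnE B s : vsgn B s = if vstab B s then F2sg (vinv s B) else 0.
Proof.
by rewrite cfunE inE; case: ifP => _; rewrite ?mulr0n // mulr1n /= mxtrace_scalar.
Qed.

Lemma vsgn_lin B : vsgn B \is a linear_char.
Proof. by rewrite qualifE /= cfRepr_char /= vsgnE /vstab vact1 eqxx vinv1. Qed.

Lemma vstab_conj s y B : vstab B (s ^ y)%g = vstab (vact B y^-1) s.
Proof.
apply/eqP/eqP => [st|st].
  have := congr1 (fun A => vact A y^-1) st; rewrite /conjg /= -!vactM -!mulgA mulgV mulg1.
  by [].
by rewrite /conjg !vactM st -vactM mulVg vact1.
Qed.

Lemma vinv_conj s y B : vstab B (s ^ y)%g -> vinv (s ^ y)%g B = vinv s (vact B y^-1).
Proof.
rewrite vstab_conj => /eqP st; rewrite /conjg !vinvM st addrCA.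
have := vinvM y^-1 y B; rewrite mulVg vinv1 => <-.
by rewrite addr0.
Qed.

Lemma card_vact_fibre B C : vsz C = vsz B -> #|[set y | vact B y == C]| = #|vstabg B|.
Proof.
move=> e; have [y0 e0] := vsz_transport (esym e).
rewrite -[RHS](card_imset _ (mulIg y0)); apply: eq_card => y; rewrite inE; apply/eqP/imsetP => [ey|[s + ->]].
  exists (y * y0^-1)%g; last by rewrite mulgKV.
  by rewrite inE /vstab vactM ey -e0 -vactM mulgV vact1.
by rewrite inE => /eqP st; rewrite vactM st.
Qed.

Lemma sum_vact_orbit B (g : V -> algC) :
  \sum_y g (vact B y) = #|vstabg B|%:R * \sum_(C | vsz C == vsz B) g C.
Proof.
rewrite (partition_big (fun y => vact B y) (fun C => vsz C == vsz B)) /=; last first.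
  by move=> y _; rewrite vsz_act.
rewrite mulr_sumr; apply: eq_bigr => C /eqP hC.
rewrite (eq_bigr (fun=> g C)) => [|y /eqP -> //].
by rewrite sumr_const -(card_vact_fibre hC) mulr_natl cardsE.
Qed.

(* Induced from the character sgn x 1 of S_l x S_(n-l), l being the size of B. *)
Definition Hsgn B : 'CF(Symn n) := 'Ind[Symn n] (vsgn B).

Lemma HsgnE B s : Hsgn B s = \sum_(C | (vsz C == vsz B) && vstab C s) F2sg (vinv s C).
Proof.
rewrite /Hsgn cfIndE ?subsetT //.
pose g C : algC := if vstab C s then F2sg (vinv s C) else 0.
rewrite (eq_bigl xpredT) => [|y]; last by rewrite inE.
rewrite (eq_bigr (fun y => g (vact B y^-1))) => [|y _]; last first.
  by rewrite vsgnE /g -vstab_conj; case: ifP => // st; rewrite vinv_conj.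
rewrite (reindex_inj invg_inj) /= (eq_bigr (fun y => g (vact B y))) => [|y _]; last by rewrite invgK.
rewrite sum_vact_orbit mulKf; last by rewrite pnatr_eq0 -lt0n; apply: (cardG_gt0 (vstabg_group B)).
by rewrite -big_mkcondr.
Qed.

Lemma Hsgn_eq B C : vsz B = vsz C -> Hsgn B = Hsgn C.
Proof. by move=> e; apply/cfun_inP => s _; rewrite !HsgnE e. Qed.

Lemma Hsgn_char B : Hsgn B \is a character.
Proof. by rewrite cfInd_char // lin_charW // vsgn_lin. Qed.

Definition vseg (l : nat) : V := [ffun x : 'I_n => (x < l)%N%:R].

Lemma vsz_seg l : (l <= n)%N -> vsz (vseg l) = l.
Proof.
move=> ln; rewrite /vsz -[RHS](card_ord l) -cardsT -(card_imset _ (f := widen_ord ln)); last first.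
  by move=> x z /(congr1 val) /= /val_inj.
apply: eq_card => x; rewrite inE ffunE; apply/idP/imsetP => [|[z _ ->]]; last by rewrite /= ltn_ord.
by case: ltnP => //= lt _; exists (Ordinal lt) => //; apply: val_inj.
Qed.

Lemma kappa_Hsgn s : kappa s = \sum_(l < n.+1) Hsgn (vseg l) s.
Proof.
rewrite /kappa (partition_big (fun B => Ordinal (vsz_le B)) xpredT) //=.
apply: eq_bigr => l _; rewrite HsgnE vsz_seg -1?ltnS //.
by apply: eq_bigl => C; rewrite andbC.
Qed.

(** The scalar product is a positive multiple of a sum over pairs [B], [C]; each pair contributes
    the sum of a linear character over the common stabilizer, which is nonnegative. When [C] is [B]
    with one more point, this character is trivial. *)
Lemma cfdot_Hsgn_succ l : (l < n)%N -> '[Hsgn (vseg l), Hsgn (vseg l.+1)] != 0.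
Proof.
move=> ln; pose ps B C : algC := \sum_(s | vstab B s && vstab C s) F2sg (vinv s B + vinv s C).
have ps_ge0 B C : 0 <= ps B C.
  case: (pickP [pred s | [&& vstab B s, vstab C s & vinv s B + vinv s C == 1]]) => [t /and3P[/eqP tB /eqP tC /eqP t1]|none].
    suff : ps B C = - ps B C.
      by move/eqP; rewrite -addr_eq0 -mulr2n mulrn_eq0 /= => /eqP ->.
    rewrite {1}/ps (reindex_inj (mulgI t)) -sumrN /=; apply: eq_big => s.
      by rewrite /vstab !vactM tB tC.
    by move=> _; rewrite !vinvM tB tC addrACA t1 (F2sgD 1) F2sg1 mulN1r.
  apply: sumr_ge0 => s /andP[sB sC]; have := none s; rewrite /= sB sC /=.
  by case: (F2_cases (vinv s B + vinv s C)) => ->; rewrite ?F2sg0 ?ler01 // eqxx.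
have E : '[Hsgn (vseg l), Hsgn (vseg l.+1)] = n`!%:R^-1 *
    \sum_(B | vsz B == l) \sum_(C | vsz C == l.+1) ps B C.
  rewrite cfdotTE card_Sn; congr (_ * _).
  transitivity (\sum_s \sum_(B | (vsz B == l) && vstab B s) \sum_(C | (vsz C == l.+1) && vstab C s)
     F2sg (vinv s B + vinv s C)).
    apply: eq_bigr => s _; rewrite !HsgnE !vsz_seg ?(ltnW ln) // rmorph_sum mulr_suml.
    apply: eq_bigr => B _; rewrite mulr_sumr; apply: eq_bigr => C _.
    by rewrite F2sgD [in LHS]/F2sg /= rmorph_sign.
  rewrite (exchange_big_dep (fun B => vsz B == l)) /= => [|s B _ /andP[] //].
  apply: eq_bigr => B hB; rewrite (exchange_big_dep (fun C => vsz C == l.+1)) /= => [|s C _ /andP[] //].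
  by apply: eq_bigr => C hC; apply: eq_bigl => s; rewrite hB hC.
rewrite E mulf_neq0 ?invr_eq0 ?nfact_neq0 // gt_eqF //.
rewrite (bigD1 (vseg l)) /=; last by rewrite vsz_seg // ltnW.
rewrite ltr_pwDl //; last by do 2!(apply: sumr_ge0 => ? _).
rewrite (bigD1 (vseg l.+1)) /=; last by rewrite vsz_seg.
rewrite ltr_pwDl //; last by apply: sumr_ge0.
rewrite /ps (eq_bigr (fun=> 1)) => [|s /andP[/eqP sl /eqP sl1]].
  rewrite sumr_const ltr0n; apply/card_gt0P; exists 1%g.
  by rewrite unfold_in /vstab !vact1 !eqxx.
have el : vseg l.+1 = vseg l + vdelta (Ordinal ln).
  apply/ffunP => x; rewrite !ffunE ltnS leq_eqVlt -(inj_eq val_inj) /=.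
  by case: ltngtP => _ /=; rewrite ?addr0 ?add0r.
have sd : vact (vdelta (Ordinal ln)) s = vdelta (Ordinal ln).
  by apply: (addrI (vseg l)); rewrite -{1}sl -vactD -el sl1.
by rewrite el vinv_stableD // vinv_delta addr0 F2_addxx F2sg0.
Qed.

Lemma vinv_full s : vinv s [ffun=> 1] = (odd_perm s)%:R.
Proof.
have st t : vact ([ffun=> 1] : V) t = [ffun=> 1] by apply/ffunP => x; rewrite !ffunE.
case: (prod_tpermP s) => ts -> /allP hts.
elim: ts hts => [|[x z] ts IH] hts; first by rewrite big_nil vinv1 odd_perm1.
have hxz : x != z := hts (x, z) (mem_head _ _).
rewrite big_cons vinvM st odd_permM /= odd_tperm hxz IH => [|p pts]; last first.
  by apply: hts; rewrite inE pts orbT.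
rewrite vinv_tperm ?ffunE ?oner_eq0 //.
by case: (odd_perm _); rewrite /= ?addr0 // F2_addxx.
Qed.

Lemma vinv_supported s B : vact B s = B -> (forall x, B x = 0 -> s x = x) -> vinv s B = (odd_perm s)%:R.
Proof.
move=> sB fx; rewrite -vinv_full.
have -> : ([ffun=> 1] : V) = B + ([ffun=> 1] + B) by rewrite addrCA vaddxx addr0.
have fC x : ([ffun=> 1] + B) x != 0 -> s x = x.
  by rewrite !ffunE => h; apply: fx; case: (F2_cases (B x)) h => -> //.
by rewrite vinv_stableD ?(vinv_fix fC) ?addr0 // vact_fix.
Qed.

(** Inducing [psi] only up to the stabilizer of [B] already yields [vsgn B] as a constituent;
    induction is transitive. *)
Lemma constt_Hsgn_sub B (Y : {group 'S_n}) (psi : 'CF(Y)) i : Y \subset vstabg B ->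
    psi \in irr Y -> 'Res[Y] (vsgn B) = psi ->
  i \in irr_constt (Hsgn B) -> i \in irr_constt ('Ind[Symn n] psi).
Proof.
move=> sY /irrP[b ->] eb; have /irrP[a ea] := lin_char_irr (vsgn_lin B).
rewrite /Hsgn ea !constt_Ind_Res => ha.
have hb : b \in irr_constt ('Res[Y] 'chi_a) by rewrite -ea eb irr_consttE cfnorm_irr oner_eq0.
have := constt_Res_trans (cfRes_char (vstabg_group B) (irr_char i)) ha hb.
by rewrite cfResRes ?subsetT.
Qed.

Lemma reshape_hook a m x : (x < a + m)%N ->
  reshape_index (a :: nseq m 1%N) x = if (x < a)%N then 0%N else (x - a).+1.
Proof.
have E (q p : nat) : (q < p)%N -> find (pred1 0%N) (scanl subn q.+1 (nseq p 1%N)) = q.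
  elim: p q => [|p IH] q; first by [].
  case: q => [|q] qp /=; first by rewrite ?subn1.
  by rewrite ?subn1 /= IH.
move=> xam; rewrite /reshape_index /= subn_eq0; case: ifP => // /negbT; rewrite -leqNgt => ax.
by rewrite subSn // E // ltn_subLR.
Qed.

Lemma young_hook a m s : (a + m = n)%N -> s \in young_subgroup n (a :: nseq m 1%N) ->
  (forall x : 'I_n, (a <= x)%N -> s x = x) /\ (forall x : 'I_n, (s x < a)%N = (x < a)%N).
Proof.
move=> e /fiber_stabP fs; have E (x : 'I_n) : reshape_index (a :: nseq m 1%N) x = if (x < a)%N then 0%N else (x - a).+1.
  by rewrite reshape_hook // e.
split=> x; last by have := fs x; rewrite !E; case: (ltnP (s x) a) => h1; case: (ltnP x a) => h2.
move=> ax; have := fs x; rewrite !E (leq_gtF ax); case: ltnP => // as1 [] e1.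
by apply: val_inj => /=; lia.
Qed.

Lemma vseg_stable a m s : (a + m = n)%N -> s \in young_subgroup n (a :: nseq m 1%N) ->
  vact (vseg a) s = vseg a.
Proof.
move=> e sY; have [_ h] := young_hook e sY; apply/ffunP => x.
by rewrite !ffunE -[in LHS]h permKV.
Qed.

(** The Young subgroup moves only the first [a] points, and there the sign attached to [vseg a] is
    the sign of the permutation. *)
Lemma constt_Hsgn_sign a m i : (a + m = n)%N ->
  i \in irr_constt (Hsgn (vseg a)) -> i \in irr_constt (ind_sign n (a :: nseq m 1%N)).
Proof.
move=> e; have sl : cf_sign n \is a linear_char by rewrite qualifE /= cf_sign_char cf_signE odd_perm1 expr0 eqxx.
have sub : young_subgroup n (a :: nseq m 1%N) \subset vstabg (vseg a).
  by apply/subsetP => s sY; rewrite inE /vstab (vseg_stable e sY).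
apply: (constt_Hsgn_sub sub); first by rewrite lin_char_irr // cfRes_lin_char.
apply/cfun_inP => s sY; rewrite !cfResE ?subsetT // vsgnE cf_signE.
rewrite /vstab (vseg_stable e sY) eqxx vinv_supported ?(vseg_stable e sY) //.
  by rewrite /F2sg; case: (odd_perm s).
have [fx _] := young_hook e sY; move=> x; rewrite ffunE; case: ltnP => // ax _.
exact: fx.
Qed.

(** With [B] the set of the last [m] points, which the Young subgroup fixes, [vsgn B] is trivial on
    that subgroup. *)
Lemma constt_Hsgn_triv a m i : (a + m = n)%N ->
  i \in irr_constt (Hsgn (vseg m)) -> i \in irr_constt (ind_triv n (a :: nseq m 1%N)).
Proof.
move=> e; pose B : V := [ffun x : 'I_n => (a <= x)%N%:R].
have am : (a <= n)%N by rewrite -e leq_addr.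
have sB : vsz B = m.
  have := cardsC [set x | vseg a x != 0]; rewrite -/(vsz (vseg a)) vsz_seg // card_ord.
  have -> : #|~: [set x | vseg a x != 0]| = vsz B.
    by apply: eq_card => x; rewrite !inE !ffunE negbK; case: (ltnP x a).
  by lia.
have fx s x : s \in young_subgroup n (a :: nseq m 1%N) -> B x != 0 -> s x = x.
  move=> sY; rewrite ffunE; case: leqP => // ax _; by have [h _] := young_hook e sY; apply: h.
rewrite -(Hsgn_eq (B := B)); last by rewrite sB vsz_seg // -e leq_addl.
have sub : young_subgroup n (a :: nseq m 1%N) \subset vstabg B.
  by apply/subsetP => s sY; rewrite inE /vstab vact_fix // => x; apply: fx.
apply: (constt_Hsgn_sub sub); first by rewrite -irr0 mem_irr.
apply/cfun_inP => s sY; rewrite !cfResE // vsgnE cfun1E sY.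
have fxs x : B x != 0 -> s x = x by apply: fx.
by rewrite /vstab vact_fix // eqxx vinv_fix.
Qed.

Lemma hook_partition j : (j < n)%N -> is_partition n (hook n j).
Proof.
move=> jn; apply/and3P; split.
- rewrite /hook /=; have : (1 <= n - j)%N by rewrite subn_gt0.
  by elim: j {jn} (n - j)%N => //= j IH a a1; rewrite a1 IH.
- by rewrite inE mem_nseq negb_or eq_sym -lt0n subn_gt0 jn /= andbF.
by rewrite /= sumn_nseq mul1n subnK // ltnW.
Qed.

Lemma conj_hook j : (j < n)%N -> conj_part (hook n j) = j.+1 :: nseq (n - j.+1) 1%N.
Proof.
move=> jn; have e : (n - j = (n - j.+1).+1)%N by rewrite subnSK.
rewrite /conj_part /hook [head _ _]/= e; set m := (n - j.+1)%N.
have -> : iota 0 m.+1 = 0%N :: iota 1 m by [].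
rewrite map_cons; congr (_ :: _); first by rewrite /= count_nseq /= mul1n.
apply: (@eq_from_nth _ 0%N) => [|i]; first by rewrite size_map size_iota size_nseq.
rewrite size_map size_iota => hi; rewrite (nth_map 0%N) ?size_iota // nth_iota // nth_nseq hi.
by rewrite /= count_nseq; case: ltnP => h1; case: ltnP => h2; lia.
Qed.

Lemma common_constt_exists (gT : finGroupType) (G : {group gT}) (phi psi : 'CF(G)) :
    psi \is a character -> '[phi, psi] != 0 ->
  exists2 i, i \in irr_constt phi & i \in irr_constt psi.
Proof.
move=> Np; rewrite cfdot_char_r // => nz.
case: (pickP [pred i | (i \in irr_constt phi) && (i \in irr_constt psi)]) => [i /andP[]|none].
  by exists i.
case/eqP: nz; apply: big1 => i _; have := none i; rewrite /= !irr_consttE.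
have [-> _|_] := eqVneq '[phi, 'chi_i] 0; first by rewrite mul0r.
by have [-> _|] := eqVneq '[psi, 'chi_i] 0; first by rewrite mulr0.
Qed.

(** [Hsgn (vseg j)] and [Hsgn (vseg j.+1)] share a constituent. The first places it in [ind_triv] of
    the hook, the second in [ind_sign] of the conjugate hook, and only the hook character lies in
    both. *)
Lemma hook_constt_Hsgn j : (j < n)%N -> part_index n (hook n j) \in irr_constt (Hsgn (vseg j)).
Proof.
move=> jn; have [i i1 i2] := common_constt_exists (Hsgn_char _) (cfdot_Hsgn_succ jn).
suff /eqP <- : i == part_index n (hook n j) by [].
rewrite -(part_indexP (hook_partition jn)) conj_hook //; apply/andP; split.
  by apply: constt_Hsgn_triv i1; rewrite subnK // ltnW.
by apply: constt_Hsgn_sign i2; rewrite subnKC.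
Qed.

End SignInduced.

(** * Two-row characters *)

Section TwoRow.
Variable n : nat.
Notation pi2 j := (ind_triv n (two_row n j)).

Lemma two_row_sum j : (j <= n)%N -> sumn (two_row n j) = n.
Proof. by rewrite /two_row; case: eqP => [->|_] jn /=; rewrite addn0 ?subnK. Qed.

Lemma two_row_npi j (s : 'S_n) : (j <= n)%N -> pi2 j s = (npi [:: (n - j)%N; j] s)%:R.
Proof.
move=> jn; rewrite ind_trivE ?two_row_sum // /two_row; case: eqP => // ->.
by rewrite subn0 (@npi_perm n [:: n; 0%N] [:: 0%N; n]) ?npi0 // (perm_catC [:: n] [:: 0%N]).
Qed.

Lemma wform_row (x y r : nat) : (x + y = r)%N -> wform (fun=> 1) [:: r] [:: x; y] = 1 :> algC.
Proof.
move=> e; rewrite /wform box_cons big_ord_recr /= [X in X + _]big1 ?add0r => [|i _].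
  rewrite box_cons big_ord_recr /= [X in X + _]big1 ?add0r => [|i _].
    by rewrite box_nil /= addn0 e eqxx /kapw !big_cons big_nil /= !subnn !mulr1.
  by rewrite box_nil /= addn0 -e eqn_add2l ltn_eqF.
rewrite box_cons big1 // => i' _; rewrite box_nil /= addn0; case: eqP => // h.
by have := ltn_ord i; have := ltn_ord i'; lia.
Qed.

(** A 2 by 2 matrix with these margins is determined by the entry [i'] in the row of sum [n - a] and
    the column of sum [b]; each value from 0 to [b] occurs because [b <= a <= n - a]. *)
Lemma wform_two_row a b : (b <= a)%N -> (a.*2 <= n)%N ->
  wform (fun=> 1) [:: (n - a)%N; a] [:: (n - b)%N; b] = b.+1%:R :> algC.
Proof.
move=> ba an; have -> : wform (fun=> 1) [:: (n - a)%N; a] [:: (n - b)%N; b]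
    = \sum_(l <- box [:: (n - b)%N; b] | sumn l == (n - a)%N)
        kapw (fun=> 1) l * wform (fun=> 1) [:: a] (subw [:: (n - b)%N; b] l) :> algC by [].
rewrite box_cons.
transitivity (\sum_(i < (n - b).+1) \sum_(i' < b.+1) ((i + i' == n - a)%N)%:R : algC).
  apply: eq_bigr => i _; rewrite box_cons; apply: eq_bigr => i' _.
  rewrite box_nil (_ : sumn _ = (i + i')%N); last by rewrite /= addn0.
  case: eqP => // e; rewrite /kapw !big_cons big_nil !mul1r.
  have hi : (val i < (n - b).+1)%N := ltn_ord i; have hi' : (val i' < b.+1)%N := ltn_ord i'.
  have e' : (val i + val i' = n - a)%N := e; apply: wform_row.
  by move: (val i) (val i') hi hi' e' => p q hp hq epq; clear -ba an hp hq epq; lia.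
rewrite exchange_big /=; transitivity (\sum_(i' < b.+1) (1 : algC)); last by rewrite sumr_const card_ord.
apply: eq_bigr => i' _; have h : (n - a - i' < (n - b).+1)%N by have := ltn_ord i'; lia.
rewrite (bigD1 (Ordinal h)) //= big1 ?addr0 => [|i ne].
  by rewrite subnK ?eqxx //; have := ltn_ord i'; lia.
case: eqP => // e; case/eqP: ne; apply: val_inj => /=; lia.
Qed.

Lemma cfdot_two_row a b : (b <= a)%N -> (a.*2 <= n)%N -> '[pi2 a, pi2 b] = b.+1%:R.
Proof.
move=> ba an; rewrite cfdotTE card_Sn -(wform_two_row ba an).
apply: (canLR (mulKf (nfact_neq0 n))); rewrite -npi_plain ?addn0 /=; try lia.
by apply: eq_bigr => s _; rewrite !two_row_npi ?rmorph_nat //; lia.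
Qed.

Lemma two_row_partition j : (0 < n)%N -> (j.*2 <= n)%N -> is_partition n (two_row n j).
Proof.
move=> n0 jn; rewrite /is_partition two_row_sum; last by lia.
rewrite /two_row; case: eqP => [_|/eqP j0] /=; rewrite eqxx ?andbT !inE; last by lia.
by rewrite eq_sym -lt0n.
Qed.

(** [D] has norm 1. By dominance the wanted character is absent from the second term, so it has
    multiplicity [d > 0] in [D]; then the squared norm of the difference of [D] and that character
    is [2 - 2 d], which leaves only 0. *)
Lemma two_row_char j : (0 < j)%N -> (j.*2 <= n)%N -> part_char n (two_row n j) = pi2 j - pi2 j.-1.
Proof.
move=> j0 jn; have n0 : (0 < n)%N by lia.
have pj := two_row_partition n0 jn; have pj1 : is_partition n (two_row n j.-1) by apply: two_row_partition => //; lia.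
have [c1 c2] := part_index_in pj; set r := part_index n (two_row n j) in c1 c2 *.
have Npi i : pi2 i \is a character by rewrite cfInd_char ?rpred1.
have r0 : '[pi2 j.-1, 'chi_r] = 0.
  apply/eqP; apply: contraT => nz; have /(_ j) := part_index_summin pj1 pj (nz : r \in irr_constt _) c2.
  rewrite /two_row (gtn_eqF j0) !big_cons !big_nil; case: eqP => [|_]; rewrite ?big_cons ?big_nil; lia.
set D := pi2 j - pi2 j.-1; have DD : '[D] = 1.
  rewrite cfnormB !cfdot_two_row // ?prednK //; try lia.
  rewrite rmorph_nat -!natrD -natrB; last by lia.
  by have -> : (j.+1 + j - (j + j) = 1)%N by lia.
have [d Dd] : exists d : nat, '[D, 'chi_r] = d%:R.
  by apply/natrP; rewrite cfdotBl r0 subr0 Cnat_cfdot_char_irr.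
have d0 : (0 < d)%N.
  rewrite lt0n -(pnatr_eq0 algC) -Dd cfdotBl r0 subr0; by move: c1; rewrite irr_consttE.
suff : '[D - 'chi_r] == 0 by rewrite cfnorm_eq0 subr_eq0 => /eqP ->.
rewrite eq_le cfnorm_ge0 andbT cfnormB DD cfnorm_irr Dd rmorph_nat subr_le0.
by rewrite -[X in X <= _]/(2%:R) -natrD ler_nat; lia.
Qed.

End TwoRow.

(** A subset fixed by [c] is a union of cycles, and the cycle lengths are 1, ..., k once each; so
    the fixed subsets of size [j] are the sets of distinct parts with sum [j]. *)
Lemma npi_staircase k (c : 'S_((k * k.+1)./2)) j : (j <= (k * k.+1)./2)%N ->
  (forall x z : 'I_((k * k.+1)./2), (z \in porbit c x) = (reshape_index (staircase k) z == reshape_index (staircase k) x)) ->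
  npi [:: ((k * k.+1)./2 - j)%N; j] c = num_distinct_parts k j.
Proof.
set n := (k * k.+1)./2 => jn cE; have sk : sumn (staircase k) = n by apply: sumn_staircase.
have lt_b (x : 'I_n) : (reshape_index (staircase k) x < k)%N.
  by rewrite -[X in (_ < X)%N](size_staircase k) reshape_indexP // sk.
(* The blocks of the staircase come in decreasing size, so after [rev_ord] the cycle through [x] has
   length [part x + 1]. *)
pose part (x : 'I_n) : 'I_k := rev_ord (Ordinal (lt_b x)).
have partE x z : (part x == part z) = (reshape_index (staircase k) x == reshape_index (staircase k) z).
  by rewrite (inj_eq rev_ord_inj) -(inj_eq val_inj).
have card_part (i : 'I_k) : #|[set x | part x == i]| = i.+1.
  have -> : #|[set x | part x == i]| = #|[set x : 'I_n | reshape_index (staircase k) x == rev_ord i]|.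
    by apply: eq_card => x; rewrite !inE -(inj_eq rev_ord_inj) /part rev_ordK -(inj_eq val_inj).
  rewrite card_reshape_index // /staircase nth_rev; last by rewrite size_iota ltn_ord.
  by rewrite size_iota nth_iota /=; have := ltn_ord i; lia.
pose F (A : {set 'I_k}) : {ffun 'I_n -> 'I_2} := [ffun x => if part x \in A then ord_max else ord0].
have surj_part i : exists x, part x = i.
  have : (0 < #|[set x | part x == i]|)%N by rewrite card_part.
  by case/card_gt0P => x; rewrite inE => /eqP; exists x.
have Finj : injective F.
  move=> A B /ffunP e; apply/setP => i; have [x <-] := surj_part i.
  by have := e x; rewrite !ffunE; case: (_ \in A); case: (_ \in B).
rewrite /num_distinct_parts -(card_imset _ Finj); apply: eq_card => f.
have cF A : cnt (F A) ord_max = (\sum_(i in A) i.+1)%N.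
  rewrite /cnt -sum1dep_card (partition_big part (mem A)) /= => [|x]; last first.
    by rewrite ffunE; case: ifP.
  apply: eq_bigr => i iA; rewrite sum1dep_card -[RHS]card_part; apply: eq_card => x; rewrite !inE ffunE.
  by case: (part x =P i) => [->|]; rewrite ?iA ?andbF.
have cF0 A : (cnt (F A) ord0 + cnt (F A) ord_max = n)%N.
  by rewrite -[RHS](sum_cnt (F A)) big_ord_recl big_ord1; congr (_ + cnt _ _)%N; apply: val_inj.
have wE A : wcol (fun i : 'I_(size [:: (n - j)%N; j]) => nth 0%N [:: (n - j)%N; j] i) (F A) = (\sum_(i in A) i.+1 == j)%N.
  apply/forallP/eqP => [h|h i]; first by rewrite -cF; have /eqP := h ord_max.
  have := cF0 A; have := cF A; rewrite h.
  case: i => -[|[|//]] hi /= e1 e2; apply/eqP.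
    rewrite (_ : cnt (F A) _ = cnt (F A) ord0); last by congr (cnt _ _); apply: val_inj.
    lia.
  by rewrite -e1; congr (cnt _ _); apply: val_inj.
rewrite inE; apply/andP/imsetP => [[wf /cstabP sf]|[A + ->]]; last first.
  rewrite inE -wE => ->; split=> //; apply/cstabP => x; rewrite !ffunE.
  have /eqP -> // : part (c x) == part x.
  by rewrite partE -cE; apply: (mem_porbit c 1).
pose A := [set part x | x in [set x | f x == ord_max]].
have fE : f = F A.
  apply/ffunP => x; rewrite ffunE; case: ifP => [/imsetP[z + e]|].
    rewrite inE => /eqP <-; have : x \in porbit c z by rewrite cE -partE e.
    by case/porbitP => i ->; elim: i => [|i IH]; rewrite ?perm1 // expgSr permM sf IH.
  apply: contraFeq => nf; apply: imset_f; rewrite inE; move: nf.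
  by rewrite -!(inj_eq val_inj) /=; case: (f x) => -[|[|]].
by exists A => //; rewrite inE -wE -fE.
Qed.

(** * Constituents of the square *)

Lemma constt_of_scale (gT : finGroupType) (G : {group gT}) (a : algC) (phi psi : 'CF(G)) i :
  a *: phi = psi -> i \in irr_constt psi -> i \in irr_constt phi.
Proof.
by move=> <-; rewrite !irr_consttE cfdotZl; apply: contraNneq => ->; rewrite mulr0.
Qed.

Lemma constt_mul_sub (gT : finGroupType) (G : {group gT}) (phi psi : 'CF(G)) a b :
    phi \is a character -> psi \is a character ->
    a \in irr_constt phi -> b \in irr_constt psi ->
  {subset irr_constt ('chi_a * 'chi_b) <= irr_constt (phi * psi)}.
Proof.
move=> Np Nq ha hb i; have [phi1 N1 ->] := constt_charP _ Np ha.
have [psi1 M1 ->] := constt_charP _ Nq hb.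
rewrite mulrDl mulrDr -addrA; set R := 'chi_a * psi1 + _ => hi.
have NR : R \is a character by apply: rpredD; rewrite rpredM ?irr_char // rpredD ?irr_char.
move: hi; rewrite !irr_consttE cfdotDl; apply: contraNneq => e.
have Nab : 'chi_a * 'chi_b \is a character by rewrite rpredM ?irr_char.
have h1 := natr_ge0 (Cnat_cfdot_char_irr i Nab); have h2 := natr_ge0 (Cnat_cfdot_char_irr i NR).
by move/eqP: e; rewrite paddr_eq0 // => /andP[].
Qed.

Lemma constt_sumP (gT : finGroupType) (G : {group gT}) (I : finType) (F : I -> 'CF(G)) i :
  i \in irr_constt (\sum_j F j) -> exists j, i \in irr_constt (F j).
Proof.
rewrite irr_consttE cfdot_suml => nz; case: (pickP [pred j | i \in irr_constt (F j)]) => [j|none].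
  by exists j.
by case/eqP: nz; apply: big1 => j _; have /negbT := none j; rewrite /= irr_consttE negbK => /eqP.
Qed.

Lemma constt_sum_char (gT : finGroupType) (G : {group gT}) (I : finType) (F : I -> 'CF(G)) j i :
  (forall j, F j \is a character) -> i \in irr_constt (F j) -> i \in irr_constt (\sum_j F j).
Proof.
move=> NF; rewrite !irr_consttE cfdot_suml; apply: contraNneq => /eqP.
rewrite psumr_eq0; first by move/allP/(_ j (mem_index_enum j)).
by move=> l _; rewrite natr_ge0 // Cnat_cfdot_char_irr.
Qed.

(** A permutation has the same orbits as its inverse and is therefore conjugate to it. *)
Lemma symn_char_real n (phi : 'CF(Symn n)) s : phi \is a character -> (phi s)^* = phi s.
Proof.
move=> Nphi; rewrite -char_inv //; have [|u <-] := @cyc_type_conj n s s^-1%g.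
  by rewrite /cyc_type /orbs porbitsV.
by rewrite cfunJ ?inE.
Qed.

Lemma two_row_stab n j : (j <= n)%N ->
  young_subgroup n (two_row n j) = vstabg [ffun x : 'I_n => (n - j <= x)%N%:R] :> {set 'S_n}.
Proof.
move=> jn; have E (x : 'I_n) : reshape_index (two_row n j) x = (n - j <= x)%N.
  have xn := ltn_ord x; rewrite /two_row /reshape_index; case: eqP => [->|_] /=.
    by rewrite subn0 subn_eq0 xn leqNgt xn.
  rewrite !subn_eq0 ltnNge; case: leqP => //= le.
  by have -> : (x.+1 - (n - j) <= j)%N by lia.
apply/setP => s; rewrite [RHS]inE; apply/fiber_stabP/vstabP => h x.
  have := h x; rewrite !E !ffunE; case: (leqP (n - j) (s x)) => _; by case: (leqP (n - j) x) => _.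
have F2b (b1 b2 : bool) : b1%:R = b2%:R :> 'F_2 -> b1 = b2 by case: b1; case: b2 => // /(congr1 val).
by have := h x; rewrite !E !ffunE => /F2b ->.
Qed.

Section Conclusion.
Variable k : nat.
Hypothesis k0 : (0 < k)%N.
Notation n := (k * k.+1)./2.
Notation chi := (part_char n (staircase k)).

Lemma staircase_theta : exists (th : 'CF(Symn n)) (c : 'S_n) (b : algC),
  [/\ th \is a character, '[th, 'chi_0] = 1, forall s, th s != 0 -> allpos s,
      (forall x z : 'I_n, (z \in porbit c x) = (reshape_index (staircase k) z == reshape_index (staircase k) x))
    & (forall j, 'chi_j c != 0 -> j \in irr_constt th) /\
      b *: chi ^+ 2 = \sum_(l < n.+1) Hsgn (vseg n l) * th].
Proof.
have [N [h [i0 [c [g1 [Wz [dg Wg] cE supp phi0]]]]]] := spin_staircase k0.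
have [a a0 ea] := spin_res_part k0 Wz phi0.
have aut s : (chi s)^* = chi s by apply/symn_char_real/irr_char.
exists (theta i0), c, (2 / #|vext h|%:R * `|a| ^+ 2); split=> //.
- exact: theta_char.
- exact: theta_triv dg Wg.
- exact: theta_allpos.
split=> [j nz|]; first by rewrite irr_consttE; apply: (theta_supp dg Wg supp nz).
apply/cfun_inP => s _; rewrite sum_cfunE (eq_bigr (fun l : 'I_n.+1 => Hsgn (vseg n l) s * theta i0 s)); last first.
  by move=> l _; rewrite cfunE.
rewrite -mulr_suml -kappa_Hsgn (kappa_theta Wz) // -spin_resE ea !cfunE normrM exprMn.
by rewrite (normCK (chi s)) aut !mulrA.
Qed.

Theorem staircase_square :
  (forall j : nat, (j.*2 <= n)%N -> ~~ exceptional k j ->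
     {subset irr_constt (chi_hook n * part_char n (two_row n j))
      <= irr_constt (part_char n (staircase k) ^+ 2)})
  /\
  (forall j : nat, (j.*2 <= n)%N ->
     part_index n (two_row n j) \in irr_constt (part_char n (staircase k) ^+ 2)).
Proof.
have [th [c [b [Nth th1 thpos cE [thc eb]]]]] := staircase_theta.
have NH l : Hsgn (vseg n l) * th \is a character by rewrite rpredM // Hsgn_char.
have n0 : (0 < n)%N by rewrite -sumn_staircase staircase_cons // -[k in (k :: _)](prednK k0).
have main l i : (l <= n)%N -> i \in irr_constt (Hsgn (vseg n l) * th) -> i \in irr_constt (chi ^+ 2).
  rewrite -ltnS => ln hi; apply: (constt_of_scale eb).
  exact: (@constt_sum_char _ _ _ (fun l : 'I_n.+1 => Hsgn (vseg n l) * th) (Ordinal ln)).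
split=> j jn.
  move=> nex i; rewrite /chi_hook mulr_suml => /constt_sumP[l hl].
  apply: (main l); first exact: ltnW.
  apply: (constt_mul_sub (Hsgn_char _) Nth (hook_constt_Hsgn (ltn_ord l)) _ hl).
  (* It remains to see that the two-row character is nonzero at [c]. For [j = 0] it is the trivial
     character; otherwise its value is the difference of the numbers of distinct partitions of [j]
     and [j - 1]. *)
  apply: thc; have [j0|j0] := posnP j.
    have [c1 _] := part_index_in (two_row_partition n0 jn); rewrite j0 in c1 *.
    have /irrP[a ea] : ind_triv n (two_row n 0) \in irr (Symn n).
      rewrite irrEchar; apply/andP; split; first by rewrite cfInd_char ?rpred1.
      by rewrite (@cfdot_two_row n 0 0) // eqxx.
    have c0 : 0 \in irr_constt (ind_triv n (two_row n 0)).
      by rewrite /ind_triv -irr0 constt_Ind_Res irr0 rmorph1 -irr0 constt_irr inE.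
    move: c1 c0; rewrite ea !constt_irr !inE => /eqP -> /eqP <-.
    by rewrite irr0 cfun1E inE oner_eq0.
  rewrite -/(part_char n (two_row n j)) two_row_char // !cfunE !two_row_npi; try lia.
  rewrite !npi_staircase //; try lia.
  by rewrite subr_eq0 eqr_nat eq_sym; move: nex; rewrite /exceptional j0.
(* Move [Hsgn] to the other side of the scalar product: its product with the two-row character is
   induced from [vsgn B] times the restriction of that character, and the restriction contains the
   trivial character. *)
apply: (main j); first by lia.
have jle : (j <= n)%N by lia.
have [cj _] := part_index_in (two_row_partition n0 jn); set r := part_index n (two_row n j) in cj *.
pose B : {ffun 'I_n -> 'F_2} := [ffun x : 'I_n => (n - j <= x)%N%:R].
have eY : young_subgroup n (two_row n j) = vstabg B :> {set 'S_n} by apply: two_row_stab.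
have sB : vsz B = j.
  have := cardsC [set x | vseg n (n - j) x != 0]; rewrite -/(vsz (vseg n (n - j))) vsz_seg ?leq_subr // card_ord.
  have -> : #|~: [set x | vseg n (n - j) x != 0]| = vsz B.
    by apply: eq_card => x; rewrite !inE !ffunE negbK; case: (ltnP x (n - j)).
  by move=> e; apply/eqP; rewrite -(eqn_add2l (n - j)) e subnK.
rewrite (@Hsgn_eq _ (vseg n j) B) ?sB ?vsz_seg // irr_consttE.
have Nv := lin_charW (vsgn_lin B).
have -> : '[Hsgn B * th, 'chi_r] = '[th, Hsgn B * 'chi_r].
  rewrite !cfdotTE; congr (_ * _); apply: eq_bigr => s _; rewrite !cfunE rmorphM /=.
  by rewrite (symn_char_real s (Hsgn_char B)) [_ * th s]mulrC mulrA.
have ge0 (gT : finGroupType) (G : {group gT}) (u v : 'CF(G)) : u \is a character -> v \is a character -> 0 <= '[u, v].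
  by move=> Nu Nv'; rewrite natr_ge0 // Cnat_cfdot_char.
have c0 : 0 \in irr_constt ('Res[vstabg B] 'chi_r).
  have E : '['Res[young_subgroup n (two_row n j)] 'chi_r, 1] = '['Res[vstabg B] 'chi_r, 1].
    rewrite !cfdotE; congr (_ * _); first by rewrite eY.
    apply: eq_big => [s|s sY]; first by rewrite eY.
    have sS : s \in vstabg B by rewrite -eY.
    by rewrite !cfResE ?subsetT // !cfun1E sS sY.
  by move: cj; rewrite /ind_triv -irr0 constt_Ind_Res !irr_consttE !irr0 E.
have /constt_charP : 0 \in irr_constt ('Res[vstabg B] 'chi_r) by [].
case; first by rewrite cfRes_char ?irr_char.
move=> psi Npsi e; rewrite -cfIndM ?subsetT // e irr0 mulrDr mulr1 linearD /= cfdotDr.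
rewrite gt_eqF // ltr_pwDl //; last by rewrite ge0 // cfInd_char // rpredM.
rewrite -cfdot_Res_l.
(* Where [th] is nonzero all stable vectors have sign 1, so [vsgn B] can be replaced by the trivial
   character, which [th] contains. *)
have -> : '['Res[vstabg B] th, vsgn B] = '['Res[vstabg B] th, 1].
  rewrite !cfdotE; congr (_ * _); apply: eq_bigr => s sS; rewrite cfResE ?subsetT // cfun1E sS.
  have [->|/thpos/allposP pos] := eqVneq (th s) 0; first by rewrite !mul0r.
  by move: sS; rewrite inE => sS; rewrite vsgnE sS pos ?F2sg0 //; apply/eqP.
have /constt_charP [//|ph Nph ->] : 0 \in irr_constt th by rewrite irr_consttE th1 oner_eq0.
rewrite irr0 linearD /= rmorph1 cfdotDl cfnorm1 ltr_pwDl // ge0 ?cfRes_char ?rpred1 //.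
Qed.
End Conclusion.

Theorem corollary4p9 (k n : nat) (k_gt0 : (0 < k)%N)
    (def_n : n = (k * k.+1)./2) :
  (forall j : nat, (j.*2 <= n)%N -> ~~ exceptional k j ->
     {subset irr_constt (chi_hook n * part_char n (two_row n j))
      <= irr_constt (part_char n (staircase k) ^+ 2)})
  /\
  (forall j : nat, (j.*2 <= n)%N ->
     part_index n (two_row n j) \in irr_constt (part_char n (staircase k) ^+ 2)).
Proof. by rewrite def_n; apply: staircase_square. Qed.
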